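(* Let $(V_i)_{i\ge0}$, $(A_i)_{i\ge0}$, $(B_i)_{i\ge0}$ be mutually independent sequences of i.i.d. random variables with generic copies $V,A,B$, where $A,B\ge 0$, $\mathbb{E}|V|<\infty$ and $\mathbb{E}|B-A|<\infty$. Let $W_0=w\ge 0$ and $W_{i+1}=[V_iW_i+B_i-A_i]^+$ for $i=0,1,\dots$. Suppose that $V<0$ a.s. and that $B$ has a rational Laplace–Stieltjes transform $\Phi_B(s)=N_B(s)/D_B(s)$, where $D_B(s)=\prod_{j=1}^{\ell}(s-s_j)$ with $\mathrm{Re}\,s_j<0$ for $j=1,\dots,\ell$, and $N_B$ is a polynomial of degree at most $\ell-1$ sharing no zeros with $D_B$. If $\mathbb{P}(B\le A)>0$, then $W_i$ converges weakly to a proper limit $W$ as $i\to\infty$, and $$\Phi_W(s)=\frac{\sum_{k=0}^{\ell}a_ks^k}{D_B(s)},\qquad \mathrm{Re}\,s\ge 0,$$ where $$a_0=(-1)^\ell\prod_{i=1}^{\ell}s_i,$$ and the remaining constants $a_1,\dots,a_\ell$ can be determined from the following system of $\ell$ linear equations: for $j=1,\dots,\ell$, $$\sum_{k=0}^{\ell}a_ks_j^k\left(1-N_B(s_j)\,\Phi_A(-s_j)\int_{-\infty}^{0}\frac{y^k}{\prod_{m=1}^{\ell}(s_jy-s_m)}\,\mathbb{P}(V\in \mathrm{d}y)\right)=0.$$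
   Context: Notation: $[x]^+=\max\{x,0\}$; $\Phi_X(s)=\mathbb{E}e^{-sX}$ for a non-negative random variable $X$ and $\mathrm{Re}\,s\ge0$. A limit is proper if it is an almost surely finite random variable.
   Formalization: That the system together with a_0 determines a_1,…,a_ℓ uniquely is proved only for pairwise distinct s_1,…,s_ℓ; with a repeated s_j two of the ℓ equations coincide and the solution is never unique. All other claims are proved for arbitrary s_j. *)

(* Defs.v *)
From mathcomp Require Import all_boot all_order all_algebra.
From mathcomp Require Import finmap.
From mathcomp Require Import all_classical all_reals all_analysis.
From mathcomp Require Export complex.

Set Implicit Arguments.
Unset Strict Implicit.
Unset Printing Implicit Defensive.

Import Order.TTheory GRing.Theory Num.Theory.
Import numFieldNormedType.Exports.

Local Open Scope classical_set_scope.
Local Open Scope ring_scope.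
Local Open Scope complex_scope.

Section ComplexIntegral.
Context {R : realType}.

Definition cexp (z : R[i]) : R[i] :=
  (expR (complex.Re z))%:C * (cos (complex.Im z) +i* sin (complex.Im z)).

(* The parts are real-valued integrals (finite part of the extended-real one),
   so this is the usual integral whenever f is integrable. *)
Definition cintegral {d : measure_display} {T : measurableType d}
    (mu : {measure set T -> \bar R}) (D : set T) (f : T -> R[i]) : R[i] :=
  (\int[mu]_(x in D) complex.Re (f x)) +i* (\int[mu]_(x in D) complex.Im (f x)).

Definition lst {d : measure_display} {T : measurableType d}
    (P : probability T R) (X : T -> R) (s : R[i]) : R[i] :=
  cintegral P setT (fun t => cexp (- s * (X t)%:C)).

End ComplexIntegral.

Section Independence.
Context {R : realType} {d : measure_display} {T : measurableType d}.
Variable P : probability T R.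

Definition sigma_rv (X : T -> R) : set (set T) :=
  preimage_set_system setT X measurable.

Definition sigma_seq (X : nat -> T -> R) : set (set T) :=
  <<s \bigcup_n sigma_rv (X n) >>.

Definition independent_rvs (X : nat -> T -> R) : Prop :=
  forall (J : {fset nat}) (E : nat -> set T),
    (forall j, j \in J -> sigma_rv (X j) (E j)) ->
    P (\bigcap_(j in [set` J]) E j) = (\prod_(j <- J) P (E j))%E.

(* Equality of laws is required on Borel sets only: the value of a measure on a
   non-measurable set carries no meaning. *)
Definition iid (X : nat -> T -> R) : Prop :=
  independent_rvs X /\
  forall n (E : set R), measurable E -> P (X n @^-1` E) = P (X 0%N @^-1` E).

(* Taking one of the events to be the whole space gives the pairwise product
   rules, so this is mutual independence. *)
Definition independent_seqs (X Y Z : nat -> T -> R) : Prop :=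
  forall E F G : set T, sigma_seq X E -> sigma_seq Y F -> sigma_seq Z G ->
    P (E `&` F `&` G) = (P E * P F * P G)%E.

End Independence.

Definition cvg_weakly {R : realType}
    {d : measure_display} {T : measurableType d} (P : probability T R)
    (X : nat -> T -> R)
    {d' : measure_display} {T' : measurableType d'} (Q : probability T' R)
    (Y : T' -> R) : Prop :=
  forall f : R -> R, continuous f -> (exists M : R, forall x, `|f x| <= M) ->
    ('E_P[f \o X n] @[n --> \oo] --> 'E_Q[f \o Y])%E.

Fixpoint reflected_ar {R : realType} {T : Type} (w : R)
    (V A B : nat -> T -> R) (n : nat) (t : T) : R :=
  if n is i.+1 then
    Num.max (V i t * reflected_ar w V A B i t + B i t - A i t) 0
  else w.

Definition root_poly {R : realType} (l : nat) (r : 'I_l -> R[i]) : {poly R[i]} :=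
  \prod_(j < l) ('X - (r j)%:P).

(* The integral is over the open half-line, against the law of V. *)
Definition coef_system {R : realType}
    {d : measure_display} {T : measurableType d} (P : probability T R)
    (V : {RV P >-> R}) (A : T -> R) (l : nat) (r : 'I_l -> R[i])
    (N : {poly R[i]}) (a : 'I_l.+1 -> R[i]) : Prop :=
  forall j : 'I_l,
    \sum_(k < l.+1) a k * r j ^+ k *
      (1 - N.[r j] * lst P A (- r j) *
           cintegral (distribution P V) `]-oo, 0[
             (fun y : R => y%:C ^+ k / \prod_(m < l) (r j * y%:C - r m))) = 0.

(* Main.v *)
(* On the event that V <= 0 and B <= A, which has positive probability, every
   state is sent to 0.  Hence the chain regenerates at 0 at geometric times: the
   cycle decomposition gives an invariant law Q, and two copies of the chain
   merge geometrically fast, which is the weak convergence.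

   Put D = D_B and let c_k(y), q_k be such that sum_k c_k(y) q_k(X) is N_B(X) e^(yX)
   reduced modulo D.  For y >= 0 and Re s >= 0,
     E exp(- s [B - y]^+) = 1 + sum_k c_k(y) (q_k(s)/D(s) - q_k(0)/D(0)).
   Taking y = A - V W >= 0 and integrating against any finite complex measure m
   for W shows that the transform of m after one step is p/D, where p has degree
   at most l, p(0) = m(1) D(0), and
     p(s_j) = N_B(s_j) Phi_A(-s_j) E[m^(s_j V)]   with m^ the transform of m.
   For m = Q, whose transform is therefore p/D, this is the linear system.

   Conversely let the s_j be distinct, and let p solve the system with p(0) = 0.
   Then p/D is the transform of a complex measure m (an atom at 0 plus a
   density) of total mass 0, and p and the polynomial of m after one step agree at
   0 and at the s_j, so m is invariant.  Iterating the step on a test function f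
   makes it converge to the constant Q(f), whence m(f) = Q(f) m(1) = 0, so p = 0. *)

Require Import Defs.
From mathcomp Require Import all_boot all_order all_algebra.
From mathcomp Require Import finmap.
From mathcomp Require Import all_classical all_reals all_analysis.
From mathcomp Require Import measurable_realfun.
From mathcomp Require Import ring lra.
From HB Require Import structures.
Set Implicit Arguments.
Unset Strict Implicit.
Unset Printing Implicit Defensive.

Import Order.TTheory GRing.Theory Num.Theory.
Import numFieldNormedType.Exports.

Local Open Scope classical_set_scope.
Local Open Scope ring_scope.
Local Open Scope complex_scope.

(** * Complex-valued integrals *)

(** Only the transform [N / D] of [B] is known, so the formula for E exp(- s [B - y]^+) is proved
    for an explicit complex density [kappa] with that transform and carried over to [B] by
    uniqueness of Laplace transforms. Roots may be repeated, which rules out a partial fraction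
    expansion into pure exponentials; Newton's divided differences solve a triangular system of
    linear differential equations and treat all multiplicities alike. At the roots, which lie in Re
    s < 0, only the numerator polynomial is evaluated; the transform of the measure is taken at s_j
    V, whose real part is non-negative because V < 0. Measures are compared through their transforms
    at the integers: polynomials in exp(- x) approximate every bounded continuous function of x >= 0
    pointwise under a uniform bound, and dominated convergence does the rest. This reaches
    continuous functions only, which is why the transition operator is shown to preserve them. Test
    functions depend on the state through its positive part; this keeps exponentials bounded on the
    whole line and lets [R] serve as state space. *)

Section ComplexParts.
Context {R : realType}.
Implicit Types x y z : R[i].
Local Notation Re := complex.Re.
Local Notation Im := complex.Im.

Lemma cReD x y : Re (x + y) = Re x + Re y. Proof. by case: x y => [? ?] []. Qed.
Lemma cImD x y : Im (x + y) = Im x + Im y. Proof. by case: x y => [? ?] []. Qed.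
Lemma cReM x y : Re (x * y) = Re x * Re y - Im x * Im y.
Proof. by case: x y => [? ?] []. Qed.
Lemma cImM x y : Im (x * y) = Re x * Im y + Im x * Re y.
Proof. by case: x y => [? ?] []. Qed.
Lemma cReN x : Re (- x) = - Re x. Proof. by case: x. Qed.
Lemma cImN x : Im (- x) = - Im x. Proof. by case: x. Qed.
Lemma cReV x : Re x^-1 = Re x / (Re x ^+ 2 + Im x ^+ 2).
Proof. by case: x. Qed.
Lemma cImV x : Im x^-1 = - (Im x / (Re x ^+ 2 + Im x ^+ 2)).
Proof. by case: x. Qed.

Lemma complex_ext x y : Re x = Re y -> Im x = Im y -> x = y.
Proof. by case: x y => [? ?] [? ?] /= -> ->. Qed.

Definition cReImE := (cReD, cImD, cReM, cImM, cReN, cImN).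

Lemma cexpD x y : cexp (x + y) = cexp x * cexp y.
Proof.
rewrite /cexp !cReImE expRD cosD sinD.
by apply: complex_ext; rewrite !cReImE /=; ring.
Qed.

Lemma cexp0 : cexp 0 = 1 :> R[i].
Proof.
by rewrite /cexp expR0 cos0 sin0; apply: complex_ext; rewrite !cReImE /=; ring.
Qed.

Lemma cexp_real (a : R) : cexp a%:C = (expR a)%:C.
Proof.
by rewrite /cexp /= cos0 sin0; apply: complex_ext; rewrite !cReImE /=; ring.
Qed.

Lemma Re_cexp z : Re (cexp z) = expR (Re z) * cos (Im z).
Proof. by rewrite /cexp !cReImE /=; ring. Qed.

Lemma Im_cexp z : Im (cexp z) = expR (Re z) * sin (Im z).
Proof. by rewrite /cexp !cReImE /=; ring. Qed.

Lemma Re_cexp_le z : `|Re (cexp z)| <= expR (Re z).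
Proof.
rewrite Re_cexp normrM ger0_norm ?expR_ge0// ler_piMr ?expR_ge0//.
by rewrite ler_norml cos_geN1 cos_le1.
Qed.

Lemma Im_cexp_le z : `|Im (cexp z)| <= expR (Re z).
Proof.
rewrite Im_cexp normrM ger0_norm ?expR_ge0// ler_piMr ?expR_ge0//.
by rewrite ler_norml sin_geN1 sin_le1.
Qed.

End ComplexParts.

Section ComplexMeasurable.
Context {R : realType} {d : measure_display} {T : measurableType d}.
Implicit Types f g : T -> R[i].
Local Notation Re := complex.Re.
Local Notation Im := complex.Im.

Definition cmeasurable f :=
  measurable_fun setT (fun x => Re (f x)) /\
  measurable_fun setT (fun x => Im (f x)).

Definition cbounded f :=
  exists M : R, forall x, `|Re (f x)| <= M /\ `|Im (f x)| <= M.

(** This class is closed under sums, products and measurable substitutions, and its members are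
    integrable for every probability. Both conditions are put on the real and imaginary parts, as in
    [cintegral]. *)
Definition cbm f := cmeasurable f /\ cbounded f.

Lemma cmeasurableD f g : cmeasurable f -> cmeasurable g ->
  cmeasurable (fun x => f x + g x).
Proof.
move=> [f1 f2] [g1 g2]; split.
- by under eq_fun do rewrite cReD; exact: measurable_funD.
- by under eq_fun do rewrite cImD; exact: measurable_funD.
Qed.

Lemma cmeasurableM f g : cmeasurable f -> cmeasurable g ->
  cmeasurable (fun x => f x * g x).
Proof.
move=> [f1 f2] [g1 g2]; split.
- under eq_fun do rewrite cReM.
  by apply: measurable_funB; exact: measurable_funM.
- under eq_fun do rewrite cImM.
  by apply: measurable_funD; exact: measurable_funM.
Qed.

Lemma cmeasurable_cst (c : R[i]) : cmeasurable (fun _ => c).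
Proof. by split; exact: measurable_cst. Qed.

Lemma cmeasurable_real (f : T -> R) : measurable_fun setT f ->
  cmeasurable (fun x => (f x)%:C).
Proof. by move=> mf; split => //=; exact: measurable_cst. Qed.

Lemma cmeasurableV f : cmeasurable f -> cmeasurable (fun x => (f x)^-1).
Proof.
move=> [f1 f2].
have m : measurable_fun setT (fun x => (Re (f x) ^+ 2 + Im (f x) ^+ 2)^-1).
  (* The squared modulus is non-negative, so its inverse is its power -1, also where it vanishes and
     the inverse is 0 by convention. *)
  under eq_fun do rewrite -powR_inv1 ?addr_ge0 ?sqr_ge0//.
  apply: (measurableT_comp (measurable_powR (-1))).
  by apply: measurable_funD; exact: measurable_funX.
split.
- by under eq_fun do rewrite cReV; exact: measurable_funM.
- under eq_fun do rewrite cImV.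
  by apply: measurableT_comp => //; exact: measurable_funM.
Qed.

Lemma cmeasurable_cexp f : cmeasurable f -> cmeasurable (fun x => cexp (f x)).
Proof.
move=> [f1 f2]; split.
- under eq_fun do rewrite Re_cexp.
  apply: measurable_funM; first exact: measurableT_comp.
  by apply: measurableT_comp => //; apply: continuous_measurable_fun; exact: continuous_cos.
- under eq_fun do rewrite Im_cexp.
  apply: measurable_funM; first exact: measurableT_comp.
  by apply: measurableT_comp => //; apply: continuous_measurable_fun; exact: continuous_sin.
Qed.

Lemma cmeasurable_prod I (s : seq I) (P : pred I) (F : I -> T -> R[i]) :
  (forall i, cmeasurable (F i)) -> cmeasurable (fun x => \prod_(i <- s | P i) F i x).
Proof.
move=> mF; elim: s => [|i s ih].
  by under eq_fun do rewrite big_nil; exact: cmeasurable_cst.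
under eq_fun do rewrite big_cons; case: (P i) => //.
exact: cmeasurableM.
Qed.

Lemma cboundedD f g : cbounded f -> cbounded g -> cbounded (fun x => f x + g x).
Proof.
move=> [M fM] [N gN]; exists (M + N) => x; rewrite !cReImE.
have [f1 f2] := fM x; have [g1 g2] := gN x.
by split; rewrite (le_trans (ler_normD _ _))// lerD.
Qed.

Lemma cboundedM f g : cbounded f -> cbounded g -> cbounded (fun x => f x * g x).
Proof.
move=> [M fM] [N gN]; exists (M * N + M * N) => x; rewrite !cReImE.
have [f1 f2] := fM x; have [g1 g2] := gN x.
split.
- by rewrite (le_trans (ler_normB _ _))// !normrM lerD// ler_pM.
- by rewrite (le_trans (ler_normD _ _))// !normrM lerD// ler_pM.
Qed.

Lemma cbounded_cst (c : R[i]) : cbounded (fun _ => c).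
Proof.
by exists (`|Re c| + `|Im c|) => x; split; [rewrite lerDl|rewrite lerDr].
Qed.

Lemma cbmD f g : cbm f -> cbm g -> cbm (fun x => f x + g x).
Proof. by move=> [? ?] [? ?]; split; [exact: cmeasurableD|exact: cboundedD]. Qed.

Lemma cbmM f g : cbm f -> cbm g -> cbm (fun x => f x * g x).
Proof. by move=> [? ?] [? ?]; split; [exact: cmeasurableM|exact: cboundedM]. Qed.

Lemma cbm_cst (c : R[i]) : cbm (fun _ => c).
Proof. by split; [exact: cmeasurable_cst|exact: cbounded_cst]. Qed.

Lemma cbm_sum I (s : seq I) (P : pred I) (F : I -> T -> R[i]) :
  (forall i, cbm (F i)) -> cbm (fun x => \sum_(i <- s | P i) F i x).
Proof.
move=> mF; elim: s => [|i s ih].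
  by under eq_fun do rewrite big_nil; exact: cbm_cst.
under eq_fun do rewrite big_cons; case: (P i) => //.
exact: cbmD.
Qed.

Lemma cbm_real (f : T -> R) (M : R) : measurable_fun setT f ->
  (forall x, `|f x| <= M) -> cbm (fun x => (f x)%:C).
Proof.
move=> mf fM; split; first exact: cmeasurable_real.
by exists M => x; rewrite fM normr0 (le_trans _ (fM x)).
Qed.

Lemma cbm_cexp f : cmeasurable f -> (forall x, Re (f x) <= 0) ->
  cbm (fun x => cexp (f x)).
Proof.
move=> mf f0; split; first exact: cmeasurable_cexp.
have h x : expR (Re (f x)) <= 1 by rewrite expR_le1.
by exists 1 => x; split; apply: le_trans (h x);
  [exact: Re_cexp_le|exact: Im_cexp_le].
Qed.

End ComplexMeasurable.

Lemma cmeasurable_comp {R : realType} d d' (T : measurableType d)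
    (T' : measurableType d') (phi : T -> T') (f : T' -> R[i]) :
  measurable_fun setT phi -> cmeasurable f -> cmeasurable (f \o phi).
Proof.
move=> mphi [f1 f2].
by split; [exact: (measurableT_comp f1)|exact: (measurableT_comp f2)].
Qed.

Lemma cbm_comp {R : realType} d d' (T : measurableType d)
    (T' : measurableType d') (phi : T -> T') (f : T' -> R[i]) :
  measurable_fun setT phi -> cbm f -> cbm (f \o phi).
Proof.
move=> mphi [mf [M fM]]; split; first exact: cmeasurable_comp.
by exists M => x; exact: fM.
Qed.

Section ComplexIntegrable.
Context {R : realType} {d : measure_display} {T : measurableType d}.
Variable mu : {measure set T -> \bar R}.
Implicit Types f g k : T -> R[i].
Local Notation Re := complex.Re.
Local Notation Im := complex.Im.

Definition cintegrable f :=
  mu.-integrable setT (EFin \o (fun x => Re (f x))) /\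
  mu.-integrable setT (EFin \o (fun x => Im (f x))).

Lemma eq_cintegral D f g : {in D, f =1 g} ->
  cintegral mu D f = cintegral mu D g.
Proof.
by move=> fg; congr (_ +i* _); apply: eq_Rintegral => x xD; rewrite fg.
Qed.

Lemma integrable_Rmul (f g : T -> R) (M : R) :
  measurable_fun setT f -> (forall x, `|f x| <= M) ->
  mu.-integrable setT (EFin \o g) ->
  mu.-integrable setT (EFin \o (fun x => f x * g x)).
Proof.
move=> mf fM ig.
have := @integrableMr _ _ _ mu setT measurableT f (EFin \o g) mf _ ig.
have : [bounded f x | x in setT].
  exists M; split; first exact: num_real.
  by move=> N MN x _ /=; rewrite (le_trans (fM x))// ltW.
by move=> h /(_ h); apply: eq_integrable => // x _; rewrite /= EFinM.
Qed.

Lemma integrable_EFinD (f g : T -> R) :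
  mu.-integrable setT (EFin \o f) -> mu.-integrable setT (EFin \o g) ->
  mu.-integrable setT (EFin \o (fun x => f x + g x)).
Proof.
move=> f1 g1; have := integrableD measurableT f1 g1.
by apply: eq_integrable => // x _; rewrite /= EFinD.
Qed.

Lemma integrable_EFinB (f g : T -> R) :
  mu.-integrable setT (EFin \o f) -> mu.-integrable setT (EFin \o g) ->
  mu.-integrable setT (EFin \o (fun x => f x - g x)).
Proof.
move=> f1 g1; have := integrableB measurableT f1 g1.
by apply: eq_integrable => // x _; rewrite /= EFinB.
Qed.

Lemma cintegrableD f g : cintegrable f -> cintegrable g ->
  cintegrable (fun x => f x + g x).
Proof.
move=> [f1 f2] [g1 g2]; split.
- by under eq_fun do rewrite cReD; exact: integrable_EFinD.
- by under eq_fun do rewrite cImD; exact: integrable_EFinD.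
Qed.

Lemma cintegrableM f k : cbm f -> cintegrable k ->
  cintegrable (fun x => f x * k x).
Proof.
move=> [[f1 f2] [M fM]] [g1 g2].
have fM1 x := (fM x).1; have fM2 x := (fM x).2.
split.
- under eq_fun do rewrite cReM.
  by apply: integrable_EFinB; exact: integrable_Rmul.
- under eq_fun do rewrite cImM.
  by apply: integrable_EFinD; exact: integrable_Rmul.
Qed.

Lemma cintegrableZ (c : R[i]) f : cintegrable f -> cintegrable (fun x => c * f x).
Proof. by move=> intf; apply: cintegrableM => //; exact: cbm_cst. Qed.

Lemma cintegralD f g : cintegrable f -> cintegrable g ->
  cintegral mu setT (fun x => f x + g x)
  = cintegral mu setT f + cintegral mu setT g.
Proof.
move=> [f1 f2] [g1 g2]; apply: complex_ext; rewrite cReImE /=.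
- by under eq_Rintegral do rewrite cReD; rewrite RintegralD.
- by under eq_Rintegral do rewrite cImD; rewrite RintegralD.
Qed.

Lemma integrable_EFinZ (r : R) (h : T -> R) : mu.-integrable setT (EFin \o h) ->
  mu.-integrable setT (EFin \o (fun x => r * h x)).
Proof.
by move=> ih; apply: (@integrable_Rmul (cst r) _ `|r|) => //; exact: measurable_cst.
Qed.

Lemma cintegralZ (c : R[i]) f : cintegrable f ->
  cintegral mu setT (fun x => c * f x) = c * cintegral mu setT f.
Proof.
move=> [f1 f2]; apply: complex_ext; rewrite cReImE /=.
- under eq_Rintegral do rewrite cReM.
  by rewrite RintegralB ?RintegralZl//; exact: integrable_EFinZ.
- under eq_Rintegral do rewrite cImM.
  by rewrite RintegralD ?RintegralZl//; exact: integrable_EFinZ.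
Qed.

Lemma cintegrable0 : cintegrable (fun _ => 0).
Proof. by split; exact: integrable0. Qed.

Lemma cintegral0 : cintegral mu setT (fun _ => 0) = 0.
Proof.
by apply: complex_ext; rewrite /= /Rintegral integral0_eq.
Qed.

Lemma cintegrable_sum I (s : seq I) (P : pred I) (F : I -> T -> R[i]) :
  (forall i, cintegrable (F i)) ->
  cintegrable (fun x => \sum_(i <- s | P i) F i x).
Proof.
move=> mF; elim: s => [|i s ih].
  by under eq_fun do rewrite big_nil; exact: cintegrable0.
under eq_fun do rewrite big_cons; case: (P i) => //.
exact: cintegrableD.
Qed.

Lemma cintegral_sum I (s : seq I) (P : pred I) (F : I -> T -> R[i]) :
  (forall i, cintegrable (F i)) ->
  cintegral mu setT (fun x => \sum_(i <- s | P i) F i x)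
  = \sum_(i <- s | P i) cintegral mu setT (F i).
Proof.
move=> mF; elim: s => [|i s ih].
  by under eq_cintegral do rewrite big_nil; rewrite big_nil cintegral0.
under eq_cintegral do rewrite big_cons; rewrite big_cons; case: (P i) => //.
by rewrite cintegralD ?ih//; exact: cintegrable_sum.
Qed.

Lemma ae_eq_cintegral f g : cmeasurable f -> cmeasurable g ->
  {ae mu, forall x, f x = g x} -> cintegral mu setT f = cintegral mu setT g.
Proof.
move=> [f1 f2] [g1 g2] fg; congr (_ +i* _); rewrite /Rintegral; congr fine;
  apply: ae_eq_integral => //; do ?[exact/measurable_EFinP];
  by apply: filterS fg => x -> .
Qed.

End ComplexIntegrable.

Section DominatedConvergence.
Context {R : realType} {d : measure_display} {T : measurableType d}.
Variable mu : {measure set T -> \bar R}.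
Local Notation Re := complex.Re.
Local Notation Im := complex.Im.

Definition ccvg (u : nat -> R[i]) (l : R[i]) : Prop :=
  Re (u n) @[n --> \oo] --> Re l /\ Im (u n) @[n --> \oo] --> Im l.

Lemma ccvg_unique u (l l' : R[i]) : ccvg u l -> ccvg u l' -> l = l'.
Proof.
move=> [u1 u2] [u1' u2'].
by apply: complex_ext; [exact: (cvg_unique _ u1 u1')|exact: (cvg_unique _ u2 u2')].
Qed.

Lemma ccvg_cst (l : R[i]) : ccvg (fun _ => l) l.
Proof. by split; exact: cvg_cst. Qed.

Lemma Rintegral_dominated (f_ : nat -> T -> R) (f g : T -> R) :
  (forall n, measurable_fun setT (f_ n)) ->
  (forall x, f_ n x @[n --> \oo] --> f x) ->
  mu.-integrable setT (EFin \o g) -> (forall n x, `|f_ n x| <= g x) ->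
  \int[mu]_x f_ n x @[n --> \oo] --> \int[mu]_x f x.
Proof.
move=> mf_ f_f ig f_g.
have mf : measurable_fun setT f.
  by apply: (measurable_fun_cvg mf_) => x _; exact: f_f.
have [||||intf _ h] := @dominated_convergence _ _ _ mu setT measurableT
  (fun n => EFin \o f_ n) (EFin \o f) (EFin \o g) _ _ _ ig.
- by move=> n; exact/measurable_EFinP.
- exact/measurable_EFinP.
- by apply: aeW => x _; apply: cvg_EFin; [exact: nearW|exact: f_f].
- by apply: aeW => x n _; rewrite /= lee_fin.
rewrite /Rintegral; apply: fine_cvg; rewrite fineK//.
exact: integrable_fin_num.
Qed.

Lemma cintegral_dominated (h_ : nat -> T -> R) (h : T -> R) (k : T -> R[i])
    (M : R) :
  (forall n, measurable_fun setT (h_ n)) ->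
  (forall x, h_ n x @[n --> \oo] --> h x) ->
  (forall n x, `|h_ n x| <= M) -> cintegrable mu k ->
  ccvg (fun n => cintegral mu setT (fun x => (h_ n x)%:C * k x))
       (cintegral mu setT (fun x => (h x)%:C * k x)).
Proof.
move=> mh h_h hM [k1 k2].
have M0 : forall x : T, 0 <= M by move=> x; rewrite (le_trans _ (hM 0%N x)).
have key (q : T -> R) : mu.-integrable setT (EFin \o q) ->
    \int[mu]_x (h_ n x * q x) @[n --> \oo] --> \int[mu]_x (h x * q x).
  move=> iq; apply: (@Rintegral_dominated _ _ (fun x => M * `|q x|)).
  - move=> n; apply: measurable_funM => //.
    by move/integrableP : iq => [/measurable_EFinP].
  - by move=> x; apply: cvgM => //; exact: cvg_cst.
  - by apply: integrable_EFinZ; exact: (integrable_norm iq).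
  - by move=> n x; rewrite normrM ler_wpM2r.
split => /=.
- rewrite (_ : (fun n => _) = fun n => \int[mu]_x (h_ n x * Re (k x))); last first.
    apply/funext => n; apply: eq_Rintegral => x _.
    by rewrite cReM /= mul0r subr0.
  rewrite (_ : Rintegral _ _ _ = \int[mu]_x (h x * Re (k x))); last first.
    by apply: eq_Rintegral => x _; rewrite cReM /= mul0r subr0.
  exact: key.
- rewrite (_ : (fun n => _) = fun n => \int[mu]_x (h_ n x * Im (k x))); last first.
    apply/funext => n; apply: eq_Rintegral => x _.
    by rewrite cImM /= mul0r addr0.
  rewrite (_ : Rintegral _ _ _ = \int[mu]_x (h x * Im (k x))); last first.
    by apply: eq_Rintegral => x _; rewrite cImM /= mul0r addr0.
  exact: key.
Qed.

End DominatedConvergence.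

(* [probability_setT] does not match when [P] is used through its measure structure. *)
Lemma measure_probability_setT {R : realType} {d} {T : measurableType d}
  (P : probability T R) : (P : {measure set T -> \bar R}) setT = 1%E.
Proof. exact: probability_setT. Qed.

Section FiniteMeasure.
Context {R : realType} {d : measure_display} {T : measurableType d}.
Variable P : probability T R.
Local Notation Re := complex.Re.
Local Notation Im := complex.Im.

Lemma bounded_integrable (f : T -> R) (M : R) : measurable_fun setT f ->
  (forall x, `|f x| <= M) -> P.-integrable setT (EFin \o f).
Proof.
move=> mf fM; apply: measurable_bounded_integrable => //.
  by rewrite (le_lt_trans (probability_le1 _ _)) ?ltry.
exists M; split; first exact: num_real.
by move=> N MN x _ /=; rewrite (le_trans (fM x))// ltW.
Qed.

Lemma cbm_integrable (f : T -> R[i]) : cbm f -> cintegrable P f.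
Proof.
move=> [[f1 f2] [M fM]].
by split; apply: (@bounded_integrable _ M) => // x; case: (fM x).
Qed.

Lemma cintegral_cst (c : R[i]) : cintegral P setT (fun _ => c) = c.
Proof.
by apply: complex_ext; rewrite /= /Rintegral integral_cst// measure_probability_setT mule1.
Qed.

Lemma Rintegral_cst1 (c : R) : \int[P]_x c = c.
Proof. by rewrite /Rintegral integral_cst// measure_probability_setT mule1. Qed.

Lemma Rintegral_le_bound (f : T -> R) (M : R) : measurable_fun setT f ->
  (forall x, `|f x| <= M) -> `|\int[P]_x f x| <= M.
Proof.
move=> mf fM; have intf := bounded_integrable mf fM.
rewrite (le_trans (le_normr_Rintegral measurableT intf))//.
rewrite -[leRHS](Rintegral_cst1 M); apply: le_Rintegral => //.
- exact: integrable_norm.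
- by apply: (@bounded_integrable _ `|M|) => //; exact: measurable_cst.
Qed.

Lemma cintegral_distribution {d'} {T' : measurableType d'}
    (X : {mfun T >-> T'}) (f : T' -> R[i]) : cbm f ->
  cintegral (distribution P X) setT f = cintegral P setT (f \o X).
Proof.
move=> [[f1 f2] [M fM]].
congr (_ +i* _); rewrite /Rintegral; congr fine; rewrite integral_distribution//.
- exact/measurable_EFinP.
- apply: (@bounded_integrable (fun x => Re (f (X x))) M).
    exact: (measurableT_comp f1).
  by move=> x; case: (fM (X x)).
- exact/measurable_EFinP.
- apply: (@bounded_integrable (fun x => Im (f (X x))) M).
    exact: (measurableT_comp f2).
  by move=> x; case: (fM (X x)).
Qed.

End FiniteMeasure.

Section ComplexFubini.
Context {R : realType} {d1 d2 : measure_display}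
  {T1 : measurableType d1} {T2 : measurableType d2}.
Variables (m1 : {sigma_finite_measure set T1 -> \bar R})
          (m2 : {sigma_finite_measure set T2 -> \bar R}).
Local Notation Re := complex.Re.
Local Notation Im := complex.Im.

Section Real.
Variable f : T1 * T2 -> R.
Hypothesis intf : (m1 \x m2)%E.-integrable setT (EFin \o f).

Let mf : measurable_fun setT (EFin \o f).
Proof. by case/integrableP: intf. Qed.

Lemma Rfubini1 : \int[(m1 \x m2)%E]_z f z = \int[m1]_x \int[m2]_y f (x, y).
Proof.
rewrite /Rintegral -integral12_prod_meas1//; congr fine.
(* The inner integral is known to be finite for almost every [x] only; elsewhere [fine] may change
   it. *)
apply: ae_eq_integral => //.
- exact: (measurable_fubini_F intf).
- apply/measurable_EFinP; apply: measurableT_comp => //.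
  exact: (measurable_fubini_F intf).
- apply: filterS (ae_integrable1 intf) => x ix _.
  by rewrite /fubini_F/= fineK//; exact: integrable_fin_num.
Qed.

Lemma Rfubini2 : \int[(m1 \x m2)%E]_z f z = \int[m2]_y \int[m1]_x f (x, y).
Proof.
rewrite /Rintegral -integral21_prod_meas1//; congr fine.
apply: ae_eq_integral => //.
- exact: (measurable_fubini_G intf).
- apply/measurable_EFinP; apply: measurableT_comp => //.
  exact: (measurable_fubini_G intf).
- apply: filterS (ae_integrable2 intf) => x ix _.
  by rewrite /fubini_G/= fineK//; exact: integrable_fin_num.
Qed.

End Real.

Lemma cfubini1 (f : T1 * T2 -> R[i]) : cintegrable (m1 \x m2)%E f ->
  cintegral (m1 \x m2)%E setT f
  = cintegral m1 setT (fun x => cintegral m2 setT (fun y => f (x, y))).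
Proof. by move=> [i1 i2]; congr (_ +i* _); rewrite Rfubini1. Qed.

Lemma cfubini2 (f : T1 * T2 -> R[i]) : cintegrable (m1 \x m2)%E f ->
  cintegral (m1 \x m2)%E setT f
  = cintegral m2 setT (fun y => cintegral m1 setT (fun x => f (x, y))).
Proof. by move=> [i1 i2]; congr (_ +i* _); rewrite Rfubini2. Qed.

End ComplexFubini.

Section ProbabilityFubini.
Context {R : realType} {d1 d2 : measure_display}
  {T1 : measurableType d1} {T2 : measurableType d2}.
Variables (m1 : {sigma_finite_measure set T1 -> \bar R}) (m2 : probability T2 R).
Local Notation Re := complex.Re.
Local Notation Im := complex.Im.

Lemma integrable_fst (k : T1 -> R) : m1.-integrable setT (EFin \o k) ->
  (m1 \x m2)%E.-integrable setT (EFin \o (fun z => k z.1)).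
Proof.
move=> ik; have /integrableP[mk _] := ik.
apply/integrable12ltyP => /=.
  by apply: (measurableT_comp mk) => //; exact: measurable_fst.
under eq_integral do rewrite integral_cst// measure_probability_setT mule1.
by case/integrableP: ik.
Qed.

Lemma cintegrable_fst (k : T1 -> R[i]) : cintegrable m1 k ->
  cintegrable (m1 \x m2)%E (fun z => k z.1).
Proof.
by move=> [k1 k2]; split; [exact: (integrable_fst k1)|exact: (integrable_fst k2)].
Qed.

(** [m1] weighted by [k] plays the part of a complex measure, for instance a Lebesgue density, and
    [m2] that of a law. The weight [k] is integrable on the product because [m2] has mass 1. *)
Lemma cfubini_swap (k : T1 -> R[i]) (F : T1 * T2 -> R[i]) :
  cintegrable m1 k -> cbm F ->
  cintegral m1 setT (fun x => cintegral m2 setT (fun y => F (x, y)) * k x)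
  = cintegral m2 setT (fun y => cintegral m1 setT (fun x => F (x, y) * k x)).
Proof.
move=> ik bF.
have iF : cintegrable (m1 \x m2)%E (fun z => F z * k z.1).
  by apply: cintegrableM => //; exact: cintegrable_fst.
transitivity (cintegral (m1 \x m2)%E setT (fun z => F z * k z.1)); last first.
  exact: cfubini2.
rewrite cfubini1//; apply: eq_cintegral => x _ /=.
rewrite mulrC -cintegralZ; first by apply: eq_cintegral => y _; rewrite mulrC.
apply: cbm_integrable; apply: (cbm_comp _ bF).
exact: measurable_pair1.
Qed.

Lemma cbm_cintegral (F : T1 * T2 -> R[i]) : cbm F ->
  cbm (fun x => cintegral m2 setT (fun y => F (x, y))).
Proof.
move=> bF; have [[f1 f2] [M fM]] := bF; split; last first.
  have mx (x : T1) : measurable_fun setT (fun y : T2 => (x, y)).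
    exact: measurable_pair1.
  exists M => x; split => /=; apply: Rintegral_le_bound.
  - exact: (measurableT_comp f1 (mx x)).
  - by move=> y; case: (fM (x, y)).
  - exact: (measurableT_comp f2 (mx x)).
  - by move=> y; case: (fM (x, y)).
have aux (f : T1 * T2 -> R) : measurable_fun setT f ->
    (forall x, `|f x| <= M) -> measurable_fun setT (fun x => \int[m2]_y f (x, y)).
  move=> mf fb.
  (* Adding the bound [M] makes the integrand non-negative, as Tonelli's measurability theorem
     requires; the shift integrates to [M] because [m2] has mass 1. *)
  apply: (eq_measurable_fun (fun x => fine (\int[m2]_y (f (x,y) + M)%:E) - M)).
    move=> x _ /=.
    have ix : m2.-integrable setT (EFin \o (fun y => f (x, y))).
      apply: (@bounded_integrable _ _ _ _ _ M) => [|y]; last exact: fb.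
      by apply: (measurableT_comp mf); exact: measurable_pair1.
    rewrite -/(Rintegral _ _ _) RintegralD//; last first.
      by apply: (@bounded_integrable _ _ _ _ _ `|M|) => //; exact: measurable_cst.
    by rewrite Rintegral_cst1 addrK.
  apply: measurable_funB; last exact: measurable_cst.
  apply: (measurableT_comp) => //.
  apply: (@measurable_fun_fubini_tonelli_F _ _ _ _ _ m2 (fun z => (f z + M)%:E)) => //.
    by apply/measurable_EFinP; apply: measurable_funD => //; exact: measurable_cst.
  by move=> z; rewrite lee_fin -lerBlDr sub0r; have := fb z; rewrite ler_norml => /andP[].
split.
- by apply: (aux (fun z => complex.Re (F z))) => // x; case: (fM x).
- by apply: (aux (fun z => complex.Im (F z))) => // x; case: (fM x).
Qed.

End ProbabilityFubini.

Section ProductProbability.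
Context {R : realType} {d1 d2 : measure_display}
  {T1 : measurableType d1} {T2 : measurableType d2}.
Variables (P1 : probability T1 R) (P2 : probability T2 R).

Definition prod_prob : set (T1 * T2) -> \bar R := (P1 \x P2)%E.

HB.instance Definition _ := Measure.on prod_prob.

Let prod_prob_setT : prod_prob setT = 1%E.
Proof.
rewrite /prod_prob -setXTT [LHS]product_measure1E// !measure_probability_setT.
by rewrite mule1.
Qed.

HB.instance Definition _ :=
  Measure_isProbability.Build _ _ _ prod_prob prod_prob_setT.

Lemma cintegral_prod_prob (f : T1 * T2 -> R[i]) : cbm f ->
  cintegral prod_prob setT f
  = cintegral P1 setT (fun x => cintegral P2 setT (fun y => f (x, y))).
Proof.
by move=> bf; apply: cfubini1; exact: (@cbm_integrable _ _ _ prod_prob).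
Qed.

End ProductProbability.

(** * Uniqueness of Laplace transforms *)

Section Bernstein.
Context {R : realType}.
Implicit Types (f g : nat -> R) (z : R).

(* The Bernstein polynomial [\sum_j 'C(n, j) f(j) X^j (1 - X)^(n-j)], by the
   recursion that conditions on one trial. *)
Fixpoint bernstein (n : nat) f : {poly R} :=
  if n is m.+1 then
    'X * bernstein m (fun j => f j.+1) + (1 - 'X) * bernstein m f
  else (f 0%N)%:P.

Lemma bernstein0E f z : (bernstein 0 f).[z] = f 0%N.
Proof. by rewrite /= hornerC. Qed.

Lemma bernsteinSE n f z : (bernstein n.+1 f).[z] =
  z * (bernstein n (fun j => f j.+1)).[z] + (1 - z) * (bernstein n f).[z].
Proof. by rewrite /= !hornerE. Qed.

Lemma bernstein_lin n (a : R) f g z :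
  (bernstein n (fun j => a * f j + g j)).[z]
  = a * (bernstein n f).[z] + (bernstein n g).[z].
Proof.
elim: n f g => [|n ih] f g; first by rewrite !bernstein0E.
by rewrite !bernsteinSE (ih (fun j => f j.+1) (fun j => g j.+1)) ih; ring.
Qed.

Lemma bernstein_cst n (c : R) z : (bernstein n (fun _ => c)).[z] = c.
Proof.
by elim: n => [|n ih]; rewrite ?bernstein0E// bernsteinSE ih; ring.
Qed.

Lemma bernstein_id n z : (bernstein n (fun j => j%:R)).[z] = n%:R * z.
Proof.
elim: n => [|n ih]; first by rewrite bernstein0E mul0r.
rewrite bernsteinSE ih.
rewrite (_ : (fun j => _) = fun j => 1 * j%:R + 1); last first.
  by apply/funext => j; rewrite mul1r -natr1.
by rewrite bernstein_lin ih bernstein_cst -natr1; ring.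
Qed.

Lemma bernstein_sqr n z : (bernstein n (fun j => j%:R ^+ 2)).[z] =
  n%:R * (z * (1 - z)) + (n%:R * z) ^+ 2.
Proof.
elim: n => [|n ih]; first by rewrite bernstein0E; ring.
rewrite bernsteinSE ih.
rewrite (_ : (fun j => _) = fun j => 1 * j%:R ^+ 2 + (2 * j%:R + 1)); last first.
  by apply/funext => j; rewrite mul1r -natr1; ring.
by rewrite !bernstein_lin ih bernstein_id bernstein_cst -natr1; ring.
Qed.

(** The variance of a binomial variable with [n] trials and success probability [z]. *)
Lemma bernstein_variance n z :
  (bernstein n (fun j => (j%:R - n%:R * z) ^+ 2)).[z] = n%:R * (z * (1 - z)).
Proof.
rewrite (_ : (fun j => _) =
    fun j => 1 * j%:R ^+ 2 + ((- (2 * n%:R * z)) * j%:R + (n%:R * z) ^+ 2)); last first.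
  by apply/funext => j; ring.
by rewrite !bernstein_lin bernstein_sqr bernstein_id bernstein_cst; ring.
Qed.

Lemma ler_bernstein n f g z : 0 <= z <= 1 -> (forall j, `|f j| <= g j) ->
  `|(bernstein n f).[z]| <= (bernstein n g).[z].
Proof.
move=> /andP[z0 z1]; elim: n f g => [|n ih] f g fg; first by rewrite !bernstein0E.
rewrite !bernsteinSE (le_trans (ler_normD _ _))// !normrM.
have z1' : 0 <= 1 - z by rewrite subr_ge0.
rewrite (ger0_norm z0) (ger0_norm z1').
by rewrite lerD// ler_wpM2l ?subr_ge0//; apply: ih => j.
Qed.

Lemma bernstein_bound n f (M : R) z : 0 <= z <= 1 -> (forall j, `|f j| <= M) ->
  `|(bernstein n f).[z]| <= M.
Proof.
by move=> z01 fM; rewrite (le_trans (ler_bernstein _ z01 fM))// bernstein_cst.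
Qed.

(** Chebyshev's argument at a single point: continuity at [z] controls the nodes within [del] of
    [z], and the variance bounds the weight of the others. *)
Lemma bernstein_cvg (phi : R -> R) (M z : R) : 0 <= z <= 1 ->
  (forall x, `|phi x| <= M) -> {for z, continuous phi} ->
  (bernstein n (fun j => phi (j%:R / n%:R))).[z] @[n --> \oo] --> phi z.
Proof.
move=> z01 phiM cphi; have /andP[z0 z1] := z01.
have M0 : 0 <= M by rewrite (le_trans _ (phiM 0)).
apply/cvgrPdist_le => /= e e0.
have e20 : 0 < e / 2 by rewrite divr_gt0.
have /cvgrPdist_le /(_ _ e20) [del /= del0 hdel] := cphi.
(* Chosen so that c (x - z)^2 is at least 2 M, the trivial bound on |phi x - phi z|, once |x - z| >=
   [del]. *)
pose c := 2 * M / del ^+ 2.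
have c0 : 0 <= c by rewrite divr_ge0 ?sqr_ge0// mulr_ge0.
have key n : (0 < n)%N ->
    `|phi z - (bernstein n (fun j => phi (j%:R / n%:R))).[z]| <= e / 2 + c / n%:R.
  move=> n0; have nR0 : (0 : R) < n%:R by rewrite ltr0n.
  have -> : phi z - (bernstein n (fun j => phi (j%:R / n%:R))).[z] =
      (bernstein n (fun j => (-1) * phi (j%:R / n%:R) + phi z)).[z].
    by rewrite bernstein_lin bernstein_cst; ring.
  apply: le_trans (_ : (bernstein n (fun j =>
      (c / n%:R ^+ 2) * (j%:R - n%:R * z) ^+ 2 + e / 2)).[z] <= _).
    apply: ler_bernstein => // j; rewrite mulN1r addrC.
    have -> : c / n%:R ^+ 2 * (j%:R - n%:R * z) ^+ 2 = c * (j%:R / n%:R - z) ^+ 2.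
      by field; rewrite gt_eqF.
    have [near|far] := ltP `|z - j%:R / n%:R| del.
      by rewrite (le_trans (hdel _ near))// lerDr mulr_ge0 ?sqr_ge0.
    rewrite (le_trans (ler_normB _ _))// (le_trans (lerD (phiM _) (phiM _)))//.
    have d2 : del ^+ 2 <= (j%:R / n%:R - z) ^+ 2.
      rewrite -[leRHS]real_normK ?num_real// distrC ler_pXn2r ?nnegrE//.
      exact: ltW.
    have : c * del ^+ 2 <= c * (j%:R / n%:R - z) ^+ 2 by rewrite ler_wpM2l.
    rewrite {1}/c mulfVK ?gt_eqF ?exprn_gt0//; move: e20; lra.
  rewrite bernstein_lin bernstein_cst bernstein_variance addrC lerD2l.
  have -> : c / n%:R ^+ 2 * (n%:R * (z * (1 - z))) = c / n%:R * (z * (1 - z)).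
    by field; rewrite gt_eqF.
  by apply: ler_piMr; [rewrite divr_ge0|nra].
near=> n.
have n0 : (0 < n)%N by near: n; exact: nbhs_infty_gt.
rewrite (le_trans (key n n0))// {2}[e]splitr lerD2l.
rewrite ler_pdivrMr ?ltr0n// mulrC -ler_pdivrMr//.
by near: n; exact: nbhs_infty_ger.
Unshelve. all: by end_near. Qed.

End Bernstein.

Section LaplaceUniqueness.
Context {R : realType}.
Implicit Types (h : R -> R).

(** In the variable u = exp(- x) the function becomes [phi], continuous on u > 0 but possibly not at
    0, since [h] may have no limit at infinity. Convergence is therefore pointwise with a uniform
    bound, which is what dominated convergence asks for. *)
Lemma exp_poly_approx h (M : R) : continuous h -> (forall x, `|h x| <= M) ->
  exists p : nat -> {poly R},
    (forall n x, `|(p n).[expR (- Num.max x 0)]| <= M) /\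
    (forall x, (p n).[expR (- Num.max x 0)] @[n --> \oo] --> h (Num.max x 0)).
Proof.
move=> ch hM; pose phi u := h (- ln u).
have u01 x : 0 <= expR (- Num.max x 0) <= 1.
  by rewrite expR_ge0 expR_le1 oppr_le0 le_max lexx orbT.
exists (fun n => bernstein n (fun j => phi (j%:R / n%:R))); split.
  by move=> n x; apply: bernstein_bound => // j; exact: hM.
move=> x.
rewrite (_ : h (Num.max x 0) = phi (expR (- Num.max x 0))); last first.
  by rewrite /phi expRK opprK.
apply: (@bernstein_cvg _ phi M) => //; first by move=> u; exact: hM.
apply: continuous_comp; last exact: ch.
apply: continuousN; apply: continuous_ln; exact: expR_gt0.
Qed.

Lemma measurable_maxr0 : measurable_fun setT (fun x : R => Num.max x 0).
Proof. by apply: measurable_maxr => //; exact: measurable_cst. Qed.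

Lemma measurable_exp_poly (p : {poly R}) :
  measurable_fun setT (fun x : R => p.[expR (- Num.max x 0)]).
Proof.
under eq_fun do rewrite horner_coef.
apply: measurable_sum => i; apply: measurable_funM; first exact: measurable_cst.
apply: measurable_funX; apply: measurableT_comp => //.
by apply: measurableT_comp => //; exact: measurable_maxr0.
Qed.

Lemma exp_natE (n : nat) (x : R) :
  expR (- Num.max x 0) ^+ n = expR (- (n%:R * Num.max x 0)).
Proof. by rewrite -expRM_natl -mulrN. Qed.

Lemma cbm_exp_nat (n : nat) : cbm (fun x : R => (expR (- (n%:R * Num.max x 0)))%:C).
Proof.
apply: (@cbm_real _ _ _ _ 1).
  under eq_fun do rewrite -exp_natE.
  apply: measurable_funX; apply: measurableT_comp => //.
  by apply: measurableT_comp => //; exact: measurable_maxr0.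
move=> x; rewrite ger0_norm ?expR_ge0// expR_le1 oppr_le0 mulr_ge0//.
by rewrite le_max lexx orbT.
Qed.

Section Integral.
Context {d : measure_display} {T : measurableType d}.
Variables (mu : {measure set T -> \bar R}) (X : T -> R) (k : T -> R[i]).
Hypotheses (mX : measurable_fun setT X) (ik : cintegrable mu k).

Lemma cintegral_exp_poly (p : {poly R}) :
  cintegral mu setT (fun x => (p.[expR (- Num.max (X x) 0)])%:C * k x)
  = \sum_(i < size p) (p`_i)%:C *
      cintegral mu setT (fun x => (expR (- (i%:R * Num.max (X x) 0)))%:C * k x).
Proof.
have ie (i : nat) :
    cintegrable mu (fun x => (expR (- (i%:R * Num.max (X x) 0)))%:C * k x).
  exact: (cintegrableM (cbm_comp mX (cbm_exp_nat i)) ik).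
under [RHS]eq_bigr do rewrite -cintegralZ//.
rewrite -cintegral_sum; last by move=> i; exact: cintegrableZ.
apply: eq_cintegral => x _; rewrite horner_coef rmorph_sum mulr_suml.
by apply: eq_bigr => i _; rewrite rmorphM /= exp_natE mulrA.
Qed.

Lemma cvg_cintegral_exp_poly (p : nat -> {poly R}) h (M : R) :
  (forall n x, `|(p n).[expR (- Num.max x 0)]| <= M) ->
  (forall x, (p n).[expR (- Num.max x 0)] @[n --> \oo] --> h (Num.max x 0)) ->
  ccvg (fun n => cintegral mu setT
                   (fun x => ((p n).[expR (- Num.max (X x) 0)])%:C * k x))
       (cintegral mu setT (fun x => (h (Num.max (X x) 0))%:C * k x)).
Proof.
move=> pM ph; apply: (@cintegral_dominated _ _ _ _
  (fun n x => (p n).[expR (- Num.max (X x) 0)]) _ _ M) => //.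
by move=> n; exact: (measurableT_comp (measurable_exp_poly (p n)) mX).
Qed.

End Integral.

(** Transforms at the integers give the integrals of all polynomials in exp(- X^+), hence of their
    bounded pointwise limits. Two underlying spaces are allowed so that a law can be compared with a
    density. *)
Lemma laplace_unique {d1 d2} {T1 : measurableType d1} {T2 : measurableType d2}
    (mu1 : {measure set T1 -> \bar R}) (mu2 : {measure set T2 -> \bar R})
    (X1 : T1 -> R) (X2 : T2 -> R) (k1 : T1 -> R[i]) (k2 : T2 -> R[i]) :
  measurable_fun setT X1 -> measurable_fun setT X2 ->
  cintegrable mu1 k1 -> cintegrable mu2 k2 ->
  (forall n : nat,
    cintegral mu1 setT (fun x => (expR (- (n%:R * Num.max (X1 x) 0)))%:C * k1 x)
    = cintegral mu2 setT (fun x => (expR (- (n%:R * Num.max (X2 x) 0)))%:C * k2 x)) ->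
  forall h (M : R), continuous h -> (forall x, `|h x| <= M) ->
    cintegral mu1 setT (fun x => (h (Num.max (X1 x) 0))%:C * k1 x)
    = cintegral mu2 setT (fun x => (h (Num.max (X2 x) 0))%:C * k2 x).
Proof.
move=> mX1 mX2 ik1 ik2 e12 h M ch hM.
have [p [pM ph]] := exp_poly_approx ch hM.
have c1 := cvg_cintegral_exp_poly mX1 ik1 pM ph.
have c2 := cvg_cintegral_exp_poly mX2 ik2 pM ph.
apply: (ccvg_unique c1); move: c2; congr ccvg; apply/funext => n.
by rewrite !cintegral_exp_poly//; apply: eq_bigr => i _; rewrite e12.
Qed.

End LaplaceUniqueness.

(** * Functions with a rational Laplace transform *)

Section ComplexDerivative.
Context {R : realType}.
Implicit Types (f g : R -> R[i]) (x : R).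
Local Notation Re := complex.Re.
Local Notation Im := complex.Im.

Definition cderiv f x (l : R[i]) : Prop :=
  is_derive x 1 (fun t => Re (f t)) (Re l) /\
  is_derive x 1 (fun t => Im (f t)) (Im l).

Lemma cderiv_eq f x l l' : cderiv f x l -> l = l' -> cderiv f x l'.
Proof. by move=> fl <-. Qed.

Lemma is_derive_funD (f g : R -> R) x (a b : R) : is_derive x 1 f a ->
  is_derive x 1 g b -> is_derive x 1 (fun t => f t + g t) (a + b).
Proof. by move=> fa gb; exact: is_deriveD. Qed.

Lemma is_derive_funM (f g : R -> R) x (a b : R) : is_derive x 1 f a ->
  is_derive x 1 g b -> is_derive x 1 (fun t => f t * g t) (f x * b + a * g x).
Proof.
move=> fa gb; have -> : f x * b + a * g x = f x *: b + g x *: a.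
  by rewrite /GRing.scale /=; ring.
exact: is_deriveM.
Qed.

Lemma is_derive_funB (f g : R -> R) x (a b : R) : is_derive x 1 f a ->
  is_derive x 1 g b -> is_derive x 1 (fun t => f t - g t) (a - b).
Proof. by move=> fa gb; exact: is_deriveB. Qed.

Lemma is_derive_cst' (c x : R) : is_derive x 1 (fun _ : R => c) 0.
Proof. exact: is_derive_cst. Qed.

Lemma is_derive_scale (c x : R) : is_derive x 1 (fun t => c * t) c.
Proof.
have := is_derive_funM (is_derive_cst' c x) (is_derive_id x (1 : R)).
by rewrite mulr1 mul0r addr0.
Qed.

Lemma cderivD f g x l m : cderiv f x l -> cderiv g x m ->
  cderiv (fun t => f t + g t) x (l + m).
Proof.
move=> [f1 f2] [g1 g2]; split.
- by under eq_fun do rewrite cReD; rewrite cReD; exact: is_derive_funD.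
- by under eq_fun do rewrite cImD; rewrite cImD; exact: is_derive_funD.
Qed.

Lemma cderivM f g x l m : cderiv f x l -> cderiv g x m ->
  cderiv (fun t => f t * g t) x (f x * m + l * g x).
Proof.
move=> [f1 f2] [g1 g2]; split.
- under eq_fun do rewrite cReM; rewrite !cReImE.
  apply: (is_derive_eq (is_derive_funB (is_derive_funM f1 g1) (is_derive_funM f2 g2))).
  by ring.
- under eq_fun do rewrite cImM; rewrite !cReImE.
  apply: (is_derive_eq (is_derive_funD (is_derive_funM f1 g2) (is_derive_funM f2 g1))).
  by ring.
Qed.

Lemma cderiv_cst (c : R[i]) x : cderiv (fun _ => c) x 0.
Proof. by split; exact: is_derive_cst'. Qed.

Lemma cderivZ (c : R[i]) f x l : cderiv f x l -> cderiv (fun t => c * f t) x (c * l).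
Proof.
move=> fl; apply: cderiv_eq; first exact: cderivM (cderiv_cst c x) fl.
by rewrite mul0r addr0.
Qed.

Lemma cderiv_sum I (s : seq I) (F : I -> R -> R[i]) (l : I -> R[i]) x :
  (forall i, cderiv (F i) x (l i)) ->
  cderiv (fun t => \sum_(i <- s) F i t) x (\sum_(i <- s) l i).
Proof.
move=> Fl; elim: s => [|i s ih].
  by rewrite big_nil; under eq_fun do rewrite big_nil; exact: cderiv_cst.
by rewrite big_cons; under eq_fun do rewrite big_cons; exact: cderivD.
Qed.

Lemma cderiv_id x : cderiv (fun t => t%:C) x 1.
Proof. by split; [exact: is_derive_id|exact: is_derive_cst']. Qed.

Lemma cderivXn n x :
  cderiv (fun t => t%:C ^+ n) x (if n is m.+1 then n%:R * x%:C ^+ m else 0).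
Proof.
case: n => [|n].
  by under eq_fun do rewrite expr0; exact: cderiv_cst.
elim: n => [|n ih].
  by under eq_fun do rewrite expr1; rewrite expr0 mulr1; exact: cderiv_id.
under eq_fun do rewrite exprS.
apply: cderiv_eq; first exact: cderivM (cderiv_id x) ih.
by rewrite -[in RHS]natr1 exprS; ring.
Qed.

Lemma cderiv_cexp (a : R[i]) x :
  cderiv (fun t => cexp (a * t%:C)) x (a * cexp (a * x%:C)).
Proof.
have e t : Re (a * t%:C) = Re a * t by rewrite cReM /= mulr0 subr0.
have f t : Im (a * t%:C) = Im a * t by rewrite cImM /= mulr0 add0r.
have he : is_derive x 1 (fun t => expR (Re a * t)) (expR (Re a * x) * Re a).
  exact: (@is_derive1_comp _ _ _ _ _ _ (is_derive_expR _) (is_derive_scale _ _)).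
have hc : is_derive x 1 (fun t => cos (Im a * t)) (- sin (Im a * x) * Im a).
  exact: (@is_derive1_comp _ _ _ _ _ _ (is_derive_cos _) (is_derive_scale _ _)).
have hs : is_derive x 1 (fun t => sin (Im a * t)) (cos (Im a * x) * Im a).
  exact: (@is_derive1_comp _ _ _ _ _ _ (is_derive_sin _) (is_derive_scale _ _)).
split.
- under eq_fun do rewrite Re_cexp e f; rewrite cReM Re_cexp Im_cexp e f.
  apply: (is_derive_eq (is_derive_funM he hc)).
  by ring.
- under eq_fun do rewrite Im_cexp e f; rewrite cImM Re_cexp Im_cexp e f.
  apply: (is_derive_eq (is_derive_funM he hs)).
  by ring.
Qed.

Lemma cderiv0_cst f : (forall x, cderiv f x 0) -> forall x y, f x = f y.
Proof.
move=> f0 x y; apply: complex_ext.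
- by apply: (is_derive_0_is_cst (f := fun t => Re (f t))) => t; case: (f0 t).
- by apply: (is_derive_0_is_cst (f := fun t => Im (f t))) => t; case: (f0 t).
Qed.

End ComplexDerivative.

(** * Exponential polynomials and linear differential equations *)

Section ExpPolynomials.
Context {R : realType}.
Variable e : R.
Hypothesis e_gt0 : 0 < e.
Implicit Types (f g : R -> R[i]) (s a : R[i]).
Local Notation Re := complex.Re.
Local Notation Im := complex.Im.

(** The rates are at most -2e, while [decaying] promises only exp(- e x): the margin absorbs the
    powers of x. *)
Inductive exp_poly : (R -> R[i]) -> Prop :=
| exp_poly0 : exp_poly (fun _ => 0)
| exp_polyS c n a f : Re a <= - (2 * e) -> exp_poly f ->
    exp_poly (fun x => c * (x%:C ^+ n * cexp (a * x%:C)) + f x).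

Lemma exp_poly_monomial c n a : Re a <= - (2 * e) ->
  exp_poly (fun x => c * (x%:C ^+ n * cexp (a * x%:C))).
Proof.
move=> ae; have := exp_polyS c n ae exp_poly0.
by under eq_fun do rewrite addr0.
Qed.

Lemma exp_polyD f g : exp_poly f -> exp_poly g -> exp_poly (fun x => f x + g x).
Proof.
move=> ef eg; elim: ef => [|c n a f' ae _ ih].
  by under eq_fun do rewrite add0r.
by under eq_fun do rewrite -addrA; exact: exp_polyS.
Qed.

Lemma exp_polyZ (c : R[i]) f : exp_poly f -> exp_poly (fun x => c * f x).
Proof.
elim=> [|c' n a f' ae _ ih]; first by under eq_fun do rewrite mulr0; exact: exp_poly0.
by under eq_fun do rewrite mulrDr mulrA; exact: exp_polyS.
Qed.

Definition decaying f := exists M : R, 0 <= M /\ forall x, 0 <= x ->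
  `|Re (f x)| <= M * expR (- e * x) /\ `|Im (f x)| <= M * expR (- e * x).

Lemma decayingD f g : decaying f -> decaying g -> decaying (fun x => f x + g x).
Proof.
move=> [M [M0 fM]] [N [N0 gN]]; exists (M + N); split; first exact: addr_ge0.
move=> x x0; rewrite !cReImE mulrDl.
have [f1 f2] := fM x x0; have [g1 g2] := gN x x0.
by split; rewrite (le_trans (ler_normD _ _))// lerD.
Qed.

Lemma decayingZ (c : R[i]) f : decaying f -> decaying (fun x => c * f x).
Proof.
move=> [M [M0 fM]]; exists ((`|Re c| + `|Im c|) * M); split.
  by rewrite mulr_ge0// addr_ge0.
move=> x x0; have [f1 f2] := fM x x0; rewrite !cReImE -mulrA mulrDl.
split.
- by rewrite (le_trans (ler_normB _ _))// !normrM lerD// ler_wpM2l.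
- by rewrite (le_trans (ler_normD _ _))// !normrM lerD// ler_wpM2l.
Qed.

Lemma decaying_sum I (r : seq I) (F : I -> R -> R[i]) :
  (forall i, decaying (F i)) -> decaying (fun x => \sum_(i <- r) F i x).
Proof.
move=> dF; elim: r => [|i r ih].
  under eq_fun do rewrite big_nil.
  by exists 0; split => // x _; rewrite /= normr0 mul0r.
by under eq_fun do rewrite big_cons; exact: decayingD.
Qed.

(** The inequality d x <= exp(d x) is raised to the power [n], with [d] so small that n d <= e.
    Dividing by n + 1 instead of n covers n = 0. *)
Lemma exprn_le_expR n : exists M : R, 0 <= M /\
  forall x : R, 0 <= x -> x ^+ n <= M * expR (e * x).
Proof.
pose d := e / n.+1%:R; have d0 : 0 < d by rewrite divr_gt0.
exists (d ^- n); split; first by rewrite invr_ge0 exprn_ge0// ltW.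
move=> x x0.
have xd : x <= d^-1 * expR (d * x).
  rewrite ler_pdivlMl//.
  by rewrite (le_trans _ (expR_ge1Dx _))// lerDr.
apply: le_trans (_ : (d^-1 * expR (d * x)) ^+ n <= _).
  by rewrite lerXn2r ?nnegrE// (le_trans x0).
rewrite exprMn exprVn; apply: ler_wpM2l.
  by rewrite invr_ge0 exprn_ge0// ltW.
rewrite -expRM_natl ler_expR mulrA; apply: ler_wpM2r => //.
rewrite /d mulrCA; apply: ler_piMr; first exact: ltW.
by rewrite ler_pdivrMr// mul1r ler_nat.
Qed.

Lemma exp_poly_decaying f : exp_poly f -> decaying f.
Proof.
elim=> [|c n a f' ae _ ih].
  by exists 0; split => // x _; rewrite /= normr0 mul0r.
apply: decayingD ih; apply: decayingZ.
have [M [M0 xM]] := exprn_le_expR n.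
exists M; split => // x x0.
have -> : x%:C ^+ n = (x ^+ n)%:C by rewrite rmorphXn.
have h : x ^+ n * expR (Re (a * x%:C)) <= M * expR (- e * x).
  apply: le_trans (_ : (M * expR (e * x)) * expR (- (2 * e) * x) <= _).
    rewrite ler_pM ?exprn_ge0 ?expR_ge0 ?xM// ler_expR cReM /= mulr0 subr0.
    by rewrite ler_wpM2r.
  rewrite -mulrA -expRD ler_wpM2l// ler_expR le_eqVlt; apply/orP; left; apply/eqP.
  by ring.
move: (a * x%:C) h => z h; have [uR uI] := (Re_cexp_le z, Im_cexp_le z).
move: (cexp z) uR uI => u uR uI.
rewrite cReM cImM /= !mul0r subr0 addr0 !normrM (ger0_norm (exprn_ge0 n x0)).
by split; apply: le_trans h; rewrite ler_wpM2l ?exprn_ge0.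
Qed.

Lemma exp_poly_solve s f : Re s <= - (2 * e) -> exp_poly f ->
  exists2 c, exp_poly c & forall x, cderiv c x (s * c x + f x).
Proof.
move=> se; elim=> [|b n a f' ae _ [c ec dc]].
  exists (fun _ => 0); first exact: exp_poly0.
  by move=> x; rewrite mulr0 addr0; exact: cderiv_cst.
suff [c' ec' dc'] : exists2 c', exp_poly c' &
    forall x, cderiv c' x (s * c' x + x%:C ^+ n * cexp (a * x%:C)).
  exists (fun x => b * c' x + c x).
    by apply: exp_polyD => //; exact: exp_polyZ.
  move=> x; apply: cderiv_eq; first exact: cderivD (cderivZ b (dc' x)) (dc x).
  by ring.
(* Resonance: the forcing has the rate of the homogeneous solution, and the solution gains one power
   of x. *)
have [->|as0] := eqVneq a s.
  exists (fun x => n.+1%:R^-1 * (x%:C ^+ n.+1 * cexp (s * x%:C))).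
    exact: exp_poly_monomial.
  move=> x; apply: cderiv_eq.
    exact: cderivZ (cderivM (cderivXn n.+1 x) (cderiv_cexp s x)).
  have : (n.+1%:R : R[i]) != 0 by rewrite pnatr_eq0.
  rewrite !exprS; move: (n.+1%:R) (x%:C ^+ n) (cexp _) => m X E m0.
  by field.
have {}as0 : a - s != 0 by rewrite subr_eq0.
(* Off resonance, x^n e^(ax) / (a - s) solves the equation up to a forcing of degree one less, which
   the induction removes. *)
elim: n => [|n [c' ec' dc']].
  exists (fun x => (a - s)^-1 * (x%:C ^+ 0 * cexp (a * x%:C))).
    exact: exp_poly_monomial.
  move=> x; apply: cderiv_eq.
    exact: cderivZ (cderivM (cderivXn 0 x) (cderiv_cexp a x)).
  by rewrite /= !expr0; move: (cexp _) as0 => E as0; field.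
exists (fun x => (a - s)^-1 * (x%:C ^+ n.+1 * cexp (a * x%:C)) +
    - ((a - s)^-1 * n.+1%:R) * c' x).
  by apply: exp_polyD; [exact: exp_poly_monomial|exact: exp_polyZ].
move=> x; apply: cderiv_eq.
  apply: cderivD.
    exact: cderivZ (cderivM (cderivXn n.+1 x) (cderiv_cexp a x)).
  exact: cderivZ (dc' x).
rewrite !exprS; move: (n.+1%:R) (x%:C ^+ n) (cexp _) (c' x) as0 => m X E y as0.
by field.
Qed.

Lemma exp_poly_ivp s f (c0 : R[i]) : Re s <= - (2 * e) -> exp_poly f ->
  exists c, [/\ exp_poly c, c 0 = c0 & forall x, cderiv c x (s * c x + f x)].
Proof.
move=> se /(exp_poly_solve se) [c ec dc].
exists (fun x => c x + (c0 - c 0) * (x%:C ^+ 0 * cexp (s * x%:C))); split.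
- by apply: exp_polyD => //; exact: exp_poly_monomial.
- by rewrite expr0 mulr0 cexp0; ring.
move=> x; apply: cderiv_eq.
  apply: cderivD (dc x) _.
  exact: cderivZ (cderivM (cderivXn 0 x) (cderiv_cexp s x)).
by rewrite /= expr0; ring.
Qed.

(* [c k] is the divided difference of [z |-> e^(zy)] at [s 0, ..., s k], so
   that the Newton sum of the [c k y] is the exponential modulo the
   polynomial with roots [s]. *)
Lemma exists_newton_coefs (s : nat -> R[i]) : (forall k, Re (s k) <= - (2 * e)) ->
  exists c : nat -> R -> R[i], forall k,
    [/\ exp_poly (c k), c k 0 = (k == 0%N)%:R &
        forall x, cderiv (c k) x (s k * c k x + (if k is j.+1 then c j x else 0))].
Proof.
move=> se.
(* Each solution is packed with the proof that it is an exponential polynomial, so that the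
   recursion can use it as the forcing of the next equation. *)
have solve k (f : {f | exp_poly f}) (c0 : R[i]) : {c : {c | exp_poly c} |
    projT1 c 0 = c0 /\
    forall x, cderiv (projT1 c) x (s k * projT1 c x + projT1 f x)}.
  apply: cid; have [c [ec c0E dc]] := exp_poly_ivp c0 (se k) (projT2 f).
  by exists (exist _ c ec).
pose c := fix c k := if k is j.+1 then projT1 (solve k (c j) 0)
                     else projT1 (solve 0%N (exist _ _ exp_poly0) 1).
exists (fun k => projT1 (c k)) => -[|k]; split; try exact: projT2.
- by have [] := projT2 (solve 0%N (exist _ _ exp_poly0) 1).
- by have [] := projT2 (solve 0%N (exist _ _ exp_poly0) 1).
- by have [] := projT2 (solve k.+1 (c k) 0).
- by have [] := projT2 (solve k.+1 (c k) 0).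
Qed.

End ExpPolynomials.

(** * Integrals of decaying functions over a half-line *)

Section HalfLine.
Context {R : realType}.
Notation mu := (@lebesgue_measure R).
Implicit Types (f F : R -> R).

Lemma is_derive_cont F f : (forall x : R, is_derive x 1 F (f x)) -> continuous F.
Proof.
by move=> Ff x; apply: differentiable_continuous; exact/derivable1_diffP.
Qed.

Lemma cvg_decayexp (C e : R) : 0 < e -> C * expR (- e * x) @[x --> +oo] --> (0 : R).
Proof.
move=> e0; rewrite -(mulr0 C); apply: cvgM; first exact: cvg_cst.
rewrite (_ : (fun x => expR (- e * x)) =
             (fun z => expR (- z)) \o (fun z => e * z)); last first.
  by apply/funext => x /=; rewrite mulNr.
apply: (@cvg_comp _ _ _ _ _ _ (pinfty_nbhs R)); last exact: cvgr_expR.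
exact: gt0_cvgMry.
Qed.

Lemma integral_halfline_ge0 f F (a : R) :
  (forall x : R, is_derive x 1 F (f x)) -> continuous f ->
  (forall x, a <= x -> 0 <= f x) -> F x @[x --> +oo] --> (0 : R) ->
  mu.-integrable `[a, +oo[ (EFin \o f) /\
  \int[mu]_(x in `[a, +oo[) f x = - F a.
Proof.
move=> dF cf f0 F0.
have h : (\int[mu]_(x in `[a, +oo[) (f x)%:E = 0%:E - (F a)%:E)%E.
  apply: ge0_continuous_FTC2y => //.
  - exact: continuous_subspaceT.
  - by apply: cvg_at_right_filter; exact: is_derive_cont dF a.
  - by move=> x _; rewrite derive1E; exact: derive_val.
split; last by rewrite /Rintegral h /= sub0r.
apply/integrableP; split.
  apply/measurable_EFinP; apply: measurable_funTS.
  exact: continuous_measurable_fun.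
rewrite [ltLHS](_ : _ = (\int[mu]_(x in `[a, +oo[) (f x)%:E)%E).
  by rewrite h ltry.
apply: eq_integral => x; rewrite inE /= in_itv /= andbT => ax.
by rewrite ger0_norm// f0.
Qed.

(** The integrand has no sign, so its exponential majorant [g] is added; [f + g] and [g] both fall
    under the non-negative case and their difference is [f]. *)
Lemma integral_halfline f F (a C C' e : R) : 0 < e ->
  (forall x : R, is_derive x 1 F (f x)) -> continuous f ->
  (forall x, a <= x -> `|f x| <= C * expR (- e * x)) ->
  (forall x, a <= x -> `|F x| <= C' * expR (- e * x)) ->
  mu.-integrable `[a, +oo[ (EFin \o f) /\
  \int[mu]_(x in `[a, +oo[) f x = - F a.
Proof.
move=> e0 dF cf fC FC'.
pose g (x : R) : R := C * expR (- e * x); pose G (x : R) : R := - (C / e) * expR (- e * x).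
have dG (x : R) : is_derive x 1 G (g x).
  have h := @is_derive1_comp _ _ _ _ _ _ (is_derive_expR _) (is_derive_scale (- e) x).
  apply: (is_derive_eq (is_derive_funM (is_derive_cst' _ x) h)).
  by rewrite /g; field; rewrite gt_eqF.
have cg : continuous g.
  pose g' (x : R) : R := (- C * e) * expR (- e * x).
  apply: (@is_derive_cont _ g') => x.
  have h := @is_derive1_comp _ _ _ _ _ _ (is_derive_expR _) (is_derive_scale (- e) x).
  apply: (is_derive_eq (is_derive_funM (is_derive_cst' _ x) h)).
  by rewrite /g'; ring.
have g0 x : a <= x -> 0 <= g x by move=> ax; rewrite (le_trans _ (fC x ax)).
have F0 : F x @[x --> +oo] --> (0 : R).
  apply/cvgr0Pnorm_le => eps eps0.
  have /cvgr0Pnorm_le /(_ _ eps0) := cvg_decayexp C' e0.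
  move=> h; near=> x; apply: le_trans (_ : `|C' * expR (- e * x)| <= _).
    by rewrite (le_trans (FC' x _) (ler_norm _))//; near: x; exact: nbhs_pinfty_ge.
  by near: x.
have [ig Ig] := integral_halfline_ge0 dG cg g0 (cvg_decayexp _ e0).
have [|||ih Ih] := @integral_halfline_ge0 (fun x => f x + g x) (fun x => F x + G x) a.
- by move=> x; apply: cvgD; [exact: cf|exact: cg].
- move=> x ax; have := fC x ax; rewrite -/(g x) ler_norml => /andP[+ _].
  by rewrite -subr_ge0 opprK.
- by rewrite -(addr0 0); apply: cvgD => //; exact: cvg_decayexp.
have fE : f = fun x => (f x + g x) - g x by apply/funext => x; rewrite addrK.
split; rewrite fE.
  have mI : measurable (`[a, +oo[ : set (measurableTypeR R)) by exact: measurable_itv.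
  have := integrableB mI ih ig.
  by apply: eq_integrable => // x _; rewrite /= EFinB.
by rewrite RintegralB// Ih Ig; ring.
Unshelve. all: by end_near. Qed.

End HalfLine.

Section ComplexHalfLine.
Context {R : realType}.
Notation mu := (@lebesgue_measure R).
Local Notation Re := complex.Re.
Local Notation Im := complex.Im.

(** The derivative [f'] serves to give the continuity of [f]. The half-line is encoded by a
    conditional over the whole line, the form in which complex densities are used below. *)
Lemma complex_halfline (F f f' : R -> R[i]) (a C C' e : R) : 0 < e ->
  (forall x, cderiv F x (f x)) -> (forall x, cderiv f x (f' x)) ->
  (forall x, a <= x ->
    `|Re (f x)| <= C * expR (- e * x) /\ `|Im (f x)| <= C * expR (- e * x)) ->
  (forall x, a <= x ->
    `|Re (F x)| <= C' * expR (- e * x) /\ `|Im (F x)| <= C' * expR (- e * x)) ->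
  cintegrable mu (fun x => if a <= x then f x else 0) /\
  cintegral mu setT (fun x => if a <= x then f x else 0) = - F a.
Proof.
move=> e0 dF df fC FC.
have mI : measurable (`[a, +oo[ : set (measurableTypeR R)) by exact: measurable_itv.
have pick (q : R[i] -> R) : q 0 = 0 ->
    (fun x => q (if a <= x then f x else 0)) = (q \o f) \_ `[a, +oo[.
  move=> q0; apply/funext => x; rewrite patchE /=.
  case: ifPn => ax; first by rewrite mem_set//= in_itv/= ax.
  by rewrite memNset//= in_itv/= andbT; apply/negP.
have [i1 I1] := @integral_halfline _ (fun x => Re (f x)) (fun x => Re (F x)) a C C' e e0
  (fun x => (dF x).1) (is_derive_cont (fun x => (df x).1))
  (fun x ax => (fC x ax).1) (fun x ax => (FC x ax).1).
have [i2 I2] := @integral_halfline _ (fun x => Im (f x)) (fun x => Im (F x)) a C C' e e0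
  (fun x => (dF x).2) (is_derive_cont (fun x => (df x).2))
  (fun x ax => (fC x ax).2) (fun x ax => (FC x ax).2).
split.
  split.
  - rewrite (pick (fun z => Re z) (erefl _)) -restrict_EFin.
    exact/(integrable_mkcond _ mI).1.
  - rewrite (pick (fun z => Im z) (erefl _)) -restrict_EFin.
    exact/(integrable_mkcond _ mI).1.
apply: complex_ext; rewrite cReImE /=.
- by rewrite (pick (fun z => Re z) (erefl _)) -Rintegral_mkcond I1.
- by rewrite (pick (fun z => Im z) (erefl _)) -Rintegral_mkcond I2.
Qed.

End ComplexHalfLine.

Section RootPoly.
Context {R : realType} {l : nat} (r : 'I_l -> R[i]).
Local Notation Re := complex.Re.

Lemma root_poly_monic : root_poly r \is monic.
Proof. exact: monic_prod_XsubC. Qed.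

Lemma size_root_poly : size (root_poly r) = l.+1.
Proof. by rewrite size_prod_XsubC -sum1_size big_const_ord iter_addn addn0 mul1n. Qed.

Lemma root_poly_neq0 : root_poly r != 0.
Proof. exact: monic_neq0 root_poly_monic. Qed.

Lemma root_polyE z : (root_poly r).[z] = \prod_(j < l) (z - r j).
Proof. by rewrite horner_prod; apply: eq_bigr => j _; rewrite !hornerE. Qed.

Lemma root_poly_root j : (root_poly r).[r j] = 0.
Proof. by rewrite root_polyE (bigD1 j)//= subrr mul0r. Qed.

Lemma root_poly0 : (root_poly r).[0] = (-1) ^+ l * \prod_(i < l) r i.
Proof.
rewrite root_polyE -[X in (-1) ^+ X](card_ord l) -prodrN.
by apply: eq_bigr => i _; rewrite sub0r.
Qed.

Hypothesis r_lt0 : forall j, Re (r j) < 0.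

Lemma root_poly_Re_ge0 z : 0 <= Re z -> (root_poly r).[z] != 0.
Proof.
move=> z0; rewrite root_polyE; apply/prodf_neq0 => j _.
apply/eqP => /(congr1 (@complex.Re R)); rewrite !cReImE /=.
by have := r_lt0 j; move: z0; lra.
Qed.

(** Halving the distance to the imaginary axis provides the margin built into [exp_poly]; the
    default 1 of the minimum covers l = 0. *)
Lemma spectral_gap : exists e : R, 0 < e /\ forall j, Re (r j) <= - (2 * e).
Proof.
pose e := \big[Num.min/1]_(j < l) (- Re (r j) / 2).
exists e; split.
  by rewrite /e; elim/big_ind : _ => // [x y x0 y0|j _];
    [rewrite lt_min x0|rewrite divr_gt0// oppr_gt0].
move=> j; have : e <= - Re (r j) / 2 by exact: bigmin_le_cond.
lra.
Qed.

End RootPoly.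

(** * A density with a prescribed rational transform *)

Section RationalDensity.
Context {R : realType} {l : nat} (r : 'I_l -> R[i]) (e : R).
Hypothesis e_gt0 : 0 < e.
Local Notation Re := complex.Re.
Local Notation Im := complex.Im.
Local Notation mu := (@lebesgue_measure R).
Hypothesis r_le : forall j, Re (r j) <= - (2 * e).
Local Notation D := (root_poly r).

(** The roots as an infinite sequence. The filler obeys the same bound, so that the differential
    equations can be solved for every index; the sums below stop before [l]. *)
Let node (k : nat) : R[i] := if insub k is Some j then r j else (- (2 * e))%:C.

Let node_le k : Re (node k) <= - (2 * e).
Proof. by rewrite /node; case: insubP => [j _ _|_] //=. Qed.

Let node_ord (j : 'I_l) : node j = r j.
Proof. by rewrite /node valK. Qed.

Let newton (k : nat) : {poly R[i]} := \prod_(0 <= j < k) ('X - (node j)%:P).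

Let newton0 : newton 0 = 1. Proof. by rewrite /newton big_nil. Qed.

Let newtonS k : newton k.+1 = newton k * ('X - (node k)%:P).
Proof. by rewrite /newton big_nat_recr. Qed.

Let newton_l : newton l = D.
Proof.
by rewrite /newton big_mkord /root_poly; apply: eq_bigr => j _; rewrite node_ord.
Qed.

Let rem (M : {poly R[i]}) (k : nat) : {poly R[i]} := (M * newton k) %% D.

Let size_rem M k : (size (rem M k) <= l)%N.
Proof.
by rewrite -ltnS -(size_root_poly r) ltn_modp root_poly_neq0.
Qed.

Let rem0 (M : {poly R[i]}) : (size M <= l)%N -> rem M 0 = M.
Proof.
by move=> sM; rewrite /rem newton0 mulr1 modp_small// size_root_poly ltnS.
Qed.

Let reml M : rem M l = 0.
Proof. by rewrite /rem newton_l modp_mull. Qed.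

(** Multiplying a remainder by ['X] raises its degree to at most [l], and subtracting its top
    coefficient times the monic [D] brings it back. The relation is thus an identity of polynomials
    and not only a congruence modulo [D]; the correction term is the source of [kappa]. *)
Let remS M k : (0 < l)%N ->
  node k *: rem M k + rem M k.+1 = 'X * rem M k - (rem M k)`_l.-1 *: D.
Proof.
move=> l0; set rhs := (RHS).
have srhs : (size rhs < size D)%N.
  rewrite size_root_poly ltnS; apply/leq_sizeP => j lj.
  rewrite /rhs coefB coefZ coefXM gtn_eqF ?(leq_trans l0)//.
  have [->|jl] := eqVneq j l.
    have /monicP := root_poly_monic r; rewrite /lead_coef size_root_poly /= => ->.
    by rewrite mulr1 subrr.
  have {}lj : (l < j)%N by rewrite ltn_neqAle eq_sym jl.
  have -> : D`_j = 0 by rewrite nth_default// size_root_poly.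
  rewrite mulr0 subr0 nth_default// (leq_trans (size_rem M k))//.
  by rewrite -ltnS prednK// (leq_trans l0)// ltnW.
rewrite -(modp_small srhs) /rhs modpD modpN modpZl modpp scaler0 subr0.
rewrite /rem modp_mul -modpZl -modpD newtonS; congr (_ %% _).
by rewrite -mul_polyC; ring.
Qed.

Variable c : nat -> R -> R[i].
Hypothesis c_exp : forall k, exp_poly e (c k).
Hypothesis c_init : forall k, c k 0 = (k == 0%N)%:R.
Hypothesis c_deriv : forall k x,
  cderiv (c k) x (node k * c k x + (if k is j.+1 then c j x else 0)).

Section Residue.
Variable M : {poly R[i]}.
Hypothesis sM : (size M <= l)%N.

(** [H z x] is the value at [z] of M e^(xX) reduced modulo [D], and [kappa x] is the coefficient of
    degree l - 1 of that remainder. For l = 0 both sums are empty, so the truncated predecessor is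
    harmless. *)
Let H (z : R[i]) (x : R) := \sum_(k < l) c k x * (rem M k).[z].

Let kappa (x : R) := \sum_(k < l) c k x * (rem M k)`_l.-1.

Let H0 z : H z 0 = M.[z].
Proof.
rewrite /H; have [l0|l0] := posnP l.
  have M0 : M = 0 by apply/eqP; rewrite -size_poly_leq0 -l0.
  by rewrite M0 horner0 big1// => k _; rewrite /rem mul0r mod0p horner0 mulr0.
rewrite (bigD1 (Ordinal l0))//= c_init rem0// mul1r big1 ?addr0// => k k0.
rewrite c_init (_ : (nat_of_ord k == 0)%N = false) ?mul0r//.
by apply/negbTE; apply: contraNN k0 => /eqP k0; apply/eqP/val_inj.
Qed.

(** Summation by parts: the term that each derivative takes from the preceding [c] is moved to the
    next [q]. The boundary terms vanish, at the top by [ql] and at the bottom because nothing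
    precedes [c 0]. *)
Let deriv_comb (q : nat -> R[i]) x : q l = 0 ->
  cderiv (fun x => \sum_(k < l) c k x * q k) x
    (\sum_(k < l) c k x * (node k * q k + q k.+1)).
Proof.
move=> ql; apply: cderiv_eq.
  apply: cderiv_sum => k; exact: cderivM (c_deriv k x) (cderiv_cst (q k) x).
under eq_bigr do rewrite mulr0 add0r mulrDl.
rewrite big_split /=.
under [RHS]eq_bigr do rewrite mulrDr mulrCA mulrA.
rewrite big_split /=; congr (_ + _).
pose g k := (if k is j.+1 then c j x else 0) * q k.
have : \sum_(k < l.+1) g k = \sum_(k < l) g k.
  by rewrite big_ord_recr /= {2}/g ql mulr0 addr0.
by rewrite big_ord_recl {1}/g mul0r add0r => ->.
Qed.

(** Differentiating e^(xX) multiplies by X, and reduction modulo [D] subtracts the overflow [kappa]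
    times [D]. Equivalently e^(- z x) H z x has derivative - e^(- z x) kappa x D(z), which
    identifies the transform of [kappa]. *)
Let H_deriv z x : cderiv (H z) x (z * H z x - kappa x * D.[z]).
Proof.
apply: cderiv_eq; first by apply: (deriv_comb (q := fun k => (rem M k).[z])); rewrite reml horner0.
rewrite /H /kappa mulr_sumr mulr_suml -sumrB; apply: eq_bigr => k _.
have l0 : (0 < l)%N by rewrite (leq_ltn_trans (leq0n k)).
have -> : node k * (rem M k).[z] + (rem M k.+1).[z]
    = z * (rem M k).[z] - (rem M k)`_l.-1 * D.[z].
  by rewrite -hornerZ -hornerD remS// !hornerE.
by ring.
Qed.

Let comb_decaying (q : nat -> R[i]) : decaying e (fun x => \sum_(k < l) c k x * q k).
Proof.
apply: decaying_sum => k; under eq_fun do rewrite mulrC.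
by apply: decayingZ; exact: exp_poly_decaying.
Qed.

(** At a root the overflow term disappears, so H solves H' = r_j H with initial value M(r_j).
    Multiplicities play no part in this argument. *)
Lemma residue_root (j : 'I_l) (x : R) :
  \sum_(k < l) c k x * (rem M k).[r j] = M.[r j] * cexp (r j * x%:C).
Proof.
pose G t := cexp (- r j * t%:C) * H (r j) t.
have dG t : cderiv G t 0.
  apply: cderiv_eq; first exact: cderivM (cderiv_cexp _ t) (H_deriv _ t).
  by rewrite root_poly_root mulr0 subr0; ring.
have := cderiv0_cst dG x 0.
rewrite /G H0 mulr0 cexp0 mul1r => <-.
by rewrite mulrAC -cexpD mulNr addNr cexp0 mul1r.
Qed.

Definition half_density (x : R) : R[i] := if 0 <= x then kappa x else 0.

(** By [H_deriv], - e^(- s (x - y)) H s x / D(s) is an antiderivative of the integrand. It decays at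
    infinity because the [c k] do and the exponential is bounded for x >= y. *)
Let tail (s : R[i]) (y : R) : 0 <= Re s -> 0 <= y ->
  let f x := if y <= x then cexp (- s * (x - y)%:C) * kappa x else 0 in
  cintegrable mu f /\ cintegral mu setT f = H s y / D.[s].
Proof.
move=> s0 y0 f.
have r_lt0 j : Re (r j) < 0 by have := r_le j; move: e_gt0; lra.
have D0 := root_poly_Re_ge0 r_lt0 s0.
pose E (x : R) := cexp (- s * (x - y)%:C).
have EE x : E x = cexp (s * y%:C) * cexp (- s * x%:C).
  by rewrite /E -cexpD; congr cexp; rewrite rmorphB /=; ring.
have dE x : cderiv E x (- s * E x).
  rewrite (_ : E = fun x => cexp (s * y%:C) * cexp (- s * x%:C)); last exact/funext.
  apply: cderiv_eq; first exact: cderivZ (cderiv_cexp _ x).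
  by ring.
have E1 x : y <= x -> `|Re (E x)| <= 1 /\ `|Im (E x)| <= 1.
  move=> yx; have h : expR (Re (- s * (x - y)%:C)) <= 1.
    rewrite expR_le1 cReM /= mulr0 subr0 cReN mulNr oppr_le0 mulr_ge0//.
    by rewrite subr_ge0.
  by split; apply: le_trans h; [exact: Re_cexp_le|exact: Im_cexp_le].
have Edec g : decaying e g -> exists C, forall x, y <= x ->
    `|Re (E x * g x)| <= C * expR (- e * x) /\
    `|Im (E x * g x)| <= C * expR (- e * x).
  move=> [C [C0 gC]]; exists (C + C) => x yx.
  have [g1 g2] := gC x (le_trans y0 yx).
  move: (E x) (E1 x yx) => u [e1 e2].
  rewrite cReM cImM mulrDl; split.
  - rewrite (le_trans (ler_normB _ _))// !normrM lerD//.
    + by rewrite -[leRHS]mul1r ler_pM.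
    + by rewrite -[leRHS]mul1r ler_pM.
  - rewrite (le_trans (ler_normD _ _))// !normrM lerD//.
    + by rewrite -[leRHS]mul1r ler_pM.
    + by rewrite -[leRHS]mul1r ler_pM.
pose F x := - (E x * ((D.[s])^-1 * H s x)).
have [C1 hC1] := Edec _ (comb_decaying (fun k => (rem M k)`_l.-1)).
have [C2 hC2] :=
  Edec _ (decayingZ (D.[s])^-1 (comb_decaying (fun k => (rem M k).[s]))).
have dF x : cderiv F x (E x * kappa x).
  rewrite (_ : F = fun x => -1 * (E x * ((D.[s])^-1 * H s x))); last first.
    by apply/funext => t; rewrite mulN1r.
  apply: cderiv_eq.
    exact: cderivZ (cderivM (dE x) (cderivZ _ (H_deriv s x))).
  by move: (E x) (H s x) (kappa x) => a b k; field.
pose f' x :=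
  E x * (\sum_(k < l) c k x * (node k * (rem M k)`_l.-1 + (rem M k.+1)`_l.-1))
  + (- s * E x) * kappa x.
have df x : cderiv (fun x => E x * kappa x) x (f' x).
  apply: cderivM (dE x) _.
  by apply: (deriv_comb (q := fun k => (rem M k)`_l.-1)); rewrite reml coef0.
have hF x : y <= x ->
    `|Re (F x)| <= C2 * expR (- e * x) /\ `|Im (F x)| <= C2 * expR (- e * x).
  by move=> yx; rewrite /F cReN cImN !normrN; exact: hC2.
have [i I] := complex_halfline e_gt0 dF df hC1 hF.
split; first exact: i.
by rewrite I /F opprK /E subrr mulr0 cexp0 mul1r mulrC.
Qed.

Lemma half_density_integral (s : R[i]) (y : R) : 0 <= Re s -> 0 <= y ->
  cintegrable mu half_density /\
  cintegral mu setT (fun x => cexp (- s * (Num.max (x - y) 0)%:C) * half_density x)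
  = M.[0] / D.[0]
    + \sum_(k < l) c k y * ((rem M k).[s] / D.[s] - (rem M k).[0] / D.[0]).
Proof.
move=> s0 y0.
have [i0 I0] := tail (lexx 0 : 0 <= Re (0 : R[i])) (lexx 0).
have [i1 I1] := tail (lexx 0 : 0 <= Re (0 : R[i])) y0.
have [i2 I2] := tail s0 y0.
have dE : half_density =
    (fun x => if 0 <= x then cexp (- 0 * (x - 0)%:C) * kappa x else 0).
  by apply/funext => x; rewrite oppr0 mul0r cexp0 mul1r.
have ih : cintegrable mu half_density by rewrite dE.
split=> //.
set g1 := (X in cintegrable _ X) in i1; set g2 := (X in cintegrable _ X) in i2.
(* The exponential equals 1 for x < y, so the integrand is [kappa] on the half-line plus (e^(- s (x
   - y)) - 1) [kappa] beyond y: three instances of [tail]. *)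
have -> : (fun x => cexp (- s * (Num.max (x - y) 0)%:C) * half_density x)
    = fun x => half_density x + (g2 x + -1 * g1 x).
  apply/funext => x; rewrite /half_density /g1 /g2 oppr0 mul0r cexp0 mul1r.
  have [yx|xy] := leP y x.
    rewrite (le_trans y0 yx) max_l ?subr_ge0//; ring.
  have xy0 : x - y <= 0 by rewrite subr_le0 ltW.
  rewrite (max_r xy0).
  have -> : - s * 0%:C = 0 by exact: mulr0.
  rewrite cexp0; ring.
have i1' : cintegrable mu (fun x => -1 * g1 x) by exact: cintegrableZ.
transitivity (cintegral mu setT half_density
    + (cintegral mu setT g2 + -1 * cintegral mu setT g1)).
  apply: etrans (cintegralD ih (cintegrableD i2 i1')) _; congr (_ + _).
  apply: etrans (cintegralD i2 i1') _; congr (_ + _).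
  exact: cintegralZ.
have -> : cintegral mu setT half_density = M.[0] / D.[0] by rewrite dE I0 H0.
rewrite I1 I2 mulN1r; congr (_ + _).
rewrite /H !mulr_suml -sumrB; apply: eq_bigr => k _; ring.
Qed.

Lemma newton_sum_init (z : R[i]) : \sum_(k < l) c k 0 * (rem M k).[z] = M.[z].
Proof. exact: H0. Qed.

End Residue.
End RationalDensity.

(* [\sum_k c k y * (q M k)] is [M e^(yX)] reduced modulo [root_poly r], and
   [kappa] is the function on the half-line with Laplace transform
   [M / root_poly r]. *)
Lemma rational_density {R : realType} {l : nat} (r : 'I_l -> R[i]) :
  (forall j, complex.Re (r j) < 0) ->
  exists (c : 'I_l -> R -> R[i]) (q : {poly R[i]} -> 'I_l -> {poly R[i]}),
    (forall k, cbm (c k)) /\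
    forall M : {poly R[i]}, (size M <= l)%N ->
      [/\ forall k, (size (q M k) <= l)%N,
          forall y j, 0 <= y ->
            \sum_(k < l) c k y * (q M k).[r j] = M.[r j] * cexp (r j * y%:C)
        & exists kappa : R -> R[i],
            [/\ cintegrable (@lebesgue_measure R) kappa,
                forall s : R[i], 0 <= complex.Re s ->
                  cintegral (@lebesgue_measure R) setT
                    (fun x => cexp (- s * (Num.max x 0)%:C) * kappa x)
                  = M.[s] / (root_poly r).[s]
              & forall (s : R[i]) y, 0 <= complex.Re s -> 0 <= y ->
                  cintegral (@lebesgue_measure R) setT
                    (fun x => cexp (- s * (Num.max (x - y) 0)%:C) * kappa x)
                  = M.[0] / (root_poly r).[0] + \sum_(k < l) c k y *
                      ((q M k).[s] / (root_poly r).[s]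
                       - (q M k).[0] / (root_poly r).[0])]].
Proof.
move=> r_lt0; have [e [e0 re]] := spectral_gap r_lt0.
pose node (k : nat) : R[i] :=
  if insub k is Some j then r j else (- (2 * e))%:C.
have node_le k : complex.Re (node k) <= - (2 * e).
  by rewrite /node; case: insubP => [j _ _|_] //=.
have [c hc] := exists_newton_coefs node_le.
have c_exp k : exp_poly e (c k) by have [] := hc k.
have c_init k : c k 0 = (k == 0%N)%:R by have [] := hc k.
have c_deriv k : forall x,
    cderiv (c k) x (node k * c k x + (if k is j.+1 then c j x else 0)).
  by have [] := hc k.
pose newton (k : nat) : {poly R[i]} := \prod_(0 <= j < k) ('X - (node j)%:P).
(* The coefficients decay on y >= 0 only; clipping their argument makes them bounded on the whole
   line. *)
exists (fun k y => c k (Num.max y 0)), (fun M k => (M * newton k) %% root_poly r).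
split.
  move=> k; split.
    apply: (cmeasurable_comp (measurable_maxr0 (R := R))).
    split; apply: continuous_measurable_fun.
    - exact: (is_derive_cont (fun x => (c_deriv k x).1)).
    - exact: (is_derive_cont (fun x => (c_deriv k x).2)).
  have [C [C0 hC]] := exp_poly_decaying e0 (c_exp k).
  exists C => x; have x0 : 0 <= Num.max x 0 by rewrite le_max lexx orbT.
  have [h1 h2] := hC _ x0.
  have h : C * expR (- e * Num.max x 0) <= C.
    by rewrite ler_piMr// expR_le1 mulNr oppr_le0 mulr_ge0// ltW.
  by split; apply: le_trans h.
move=> M sM; split.
- move=> k; rewrite -ltnS -(size_root_poly r) ltn_modp.
  exact: root_poly_neq0.
- by move=> y j y0; rewrite max_l//; exact: (residue_root c_init c_deriv sM).
exists (half_density r e c M).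
have key s y (s0 : 0 <= complex.Re s) (y0 : 0 <= y) :=
  half_density_integral e0 re c_exp c_init c_deriv sM s0 y0.
split.
- by have [] := key 0 0 (lexx _) (lexx _).
(* At y = 0 the Newton sum is [M] itself, and the constant M(0)/D(0) cancels. *)
- move=> s s0; have [_] := key s 0 s0 (lexx _).
  under eq_fun do rewrite subr0; move=> ->.
  under eq_bigr do rewrite mulrBr !mulrA.
  rewrite sumrB -!mulr_suml.
  rewrite !(@newton_sum_init _ _ r e c c_init M sM).
  by rewrite addrC subrK.
- by move=> s y s0 y0; rewrite max_l//; have [_] := key s y s0 y0.
Qed.

(** * Markov chains with an atom *)

Section Doeblin.
Context {R : realType} {d : measure_display} {U : measurableType d}.
Implicit Types f : R -> R.
Variables (rho : probability U R) (g : R * U -> R) (S : set U) (x0 : R).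
Hypotheses (mg : measurable_fun setT g) (mS : measurable S).
Hypothesis gS : forall x u, S u -> g (x, u) = x0.
Hypothesis S_gt0 : (0 < rho S)%E.

Definition transition (f : R -> R) (x : R) : R := \int[rho]_u f (g (x, u)).

Let p : R := fine (rho S).

Let pE : rho S = p%:E.
Proof. by rewrite /p fineK// fin_num_measure. Qed.

Let p_gt0 : 0 < p. Proof. by rewrite -lte_fin -pE. Qed.

Let p_le1 : p <= 1. Proof. by rewrite -lee_fin -pE probability_le1. Qed.

Let mSC : measurable (~` S). Proof. exact: measurableC. Qed.

Let rhoC : rho (~` S) = (1 - p)%:E.
Proof. by rewrite probability_setC// pE. Qed.

Let rhoC_lty : (rho (~` S) < +oo)%E. Proof. by rewrite rhoC ltry. Qed.

Local Notation rho' := (mfrestr mSC rhoC_lty).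

Section Step.
Variable mu : {measure set R -> \bar R}.

(** The law after one step whose noise avoids [S], hence without regeneration: [rho'] is [rho]
    restricted to the complement and each step multiplies the mass by 1 - p. *)
Definition excursion (A : set R) : \bar R := (mu \x rho')%E (g @^-1` A).

Let mgA A : measurable A -> measurable (g @^-1` A).
Proof. by move=> mA; rewrite -[X in measurable X]setTI; exact: mg. Qed.

Let excursion0 : excursion set0 = 0%E.
Proof. by rewrite /excursion preimage_set0 measure0. Qed.

Let excursion_ge0 A : (0 <= excursion A)%E.
Proof. exact: measure_ge0. Qed.

Let excursion_sigma_additive : semi_sigma_additive excursion.
Proof.
move=> F mF tF mUF; rewrite /excursion preimage_bigcup.
apply: measure_semi_sigma_additive.
- by move=> n; exact: mgA.
- apply/trivIsetP => /= i j _ _ ij; rewrite -preimage_setI.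
  by move/trivIsetP : tF => /(_ _ _ _ _ ij) ->//; rewrite preimage_set0.
- by rewrite -preimage_bigcup; exact: mgA.
Qed.

HB.instance Definition _ := isMeasure.Build _ _ _ excursion
  excursion0 excursion_ge0 excursion_sigma_additive.

End Step.

Let p_ge0 : 0 <= p. Proof. exact: ltW. Qed.

(* The stationary state, restricted to the event that the last noise in [S] was
   used [n] steps ago, has law [cycle_measure n]. *)
Fixpoint cycle_measure (n : nat) : {measure set R -> \bar R} :=
  if n is m.+1 then excursion (cycle_measure m) : {measure set R -> \bar R}
  else mscale (NngNum p_ge0) (dirac x0).

Let kernel' (A : set R) (x : R) : \bar R := rho' (xsection (g @^-1` A) x).

Let cycle_measureS n A : cycle_measure n.+1 A = (\int[cycle_measure n]_x kernel' A x)%E.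
Proof. by []. Qed.

Let cycle_measure_setT n : cycle_measure n setT = (p * (1 - p) ^+ n)%:E.
Proof.
elim: n => [|n ih]; first by rewrite /= /mscale /= diracT expr0 mulr1 mule1.
rewrite cycle_measureS (eq_integral (fun=> (1 - p)%:E)); last first.
  move=> x _; rewrite /kernel' preimage_setT [xsection _ _](_ : _ = setT).
    by rewrite /= /mfrestr /mrestr setTI rhoC.
  by apply/seteqP; split => u //= _; rewrite /xsection /= inE.
by rewrite integral_cst// ih -EFinM exprSr mulrC mulrA.
Qed.

Definition invariant_measure : set R -> \bar R := mseries cycle_measure 0.

HB.instance Definition _ := Measure.on invariant_measure.

Let invariant_setT : invariant_measure setT = 1%E.
Proof.
rewrite /invariant_measure /mseries.
under eq_eseriesr do rewrite cycle_measure_setT.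
apply/cvg_lim => //.
rewrite (_ : (fun n => _) = fun n => (1 - (1 - p) ^+ n)%:E); last first.
  apply/funext => n; elim: n => [|n ih]; first by rewrite big_geq// expr0 subrr.
  by rewrite big_nat_recr//= ih -EFinD; congr EFin; rewrite exprS; ring.
apply: cvg_EFin; first exact: nearW.
rewrite -[X in _ --> X]subr0; apply: cvgB; first exact: cvg_cst.
apply: cvg_expr; rewrite ger0_norm ?subr_ge0//.
by rewrite ltrBlDr ltrDl.
Qed.

HB.instance Definition _ :=
  Measure_isProbability.Build _ _ _ invariant_measure invariant_setT.

Let Q : probability R R := invariant_measure.

Let mkernel' A : measurable A -> measurable_fun setT (kernel' A).
Proof.
move=> mA; apply: measurable_fun_xsection.
by rewrite -[X in measurable X]setTI; exact: mg.
Qed.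

Let rho_kernel A x : measurable A ->
  rho (xsection (g @^-1` A) x) = (p%:E * (\1_A x0)%:E + kernel' A x)%E.
Proof.
move=> mA.
have mX : measurable (xsection (g @^-1` A) x).
  apply: measurable_xsection.
  by rewrite -[X in measurable X]setTI; exact: mg.
rewrite -[X in rho X](setIT _) -(setUv S) setIUr measureU//; last 3 first.
- exact: measurableI.
- exact: measurableI.
- by rewrite setIACA setICr setI0.
congr (_ + _)%E.
rewrite indicE; have [Ax|Ax] := boolP (x0 \in A).
  rewrite mule1 -pE; congr (rho _); apply/seteqP; split => [u []//|u Su].
  split=> //; rewrite /xsection /= inE /= gS//; exact: set_mem.
rewrite mule0; apply: (@eq_trans _ _ (rho set0)); last exact: measure0.
congr (rho _); rewrite -subset0 => u [].
rewrite /xsection /= inE /= => + Su; rewrite gS// => Ax0.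
by move/negP : Ax; apply; rewrite inE.
Qed.

(** One step shifts the series: noise outside [S] turns the n-th cycle measure into the next one,
    and noise in [S], from whatever state, recreates the term p times the unit mass at [x0]. *)
Let invariant_set A : measurable A -> (Q \x rho)%E (g @^-1` A) = Q A.
Proof.
move=> mA; rewrite /product_measure1.
under eq_integral do rewrite /= (rho_kernel _ mA).
rewrite ge0_integralD//; last first.
- exact: mkernel'.
- by move=> x _; rewrite mule_ge0// lee_fin.
rewrite integral_cst// measure_probability_setT mule1.
rewrite [RHS](_ : _ = \sum_(0 <= k <oo) cycle_measure k A)%E//.
rewrite nneseries_recl//; congr (_ + _)%E.
rewrite -(@nneseries_addn _ (fun k => cycle_measure k A) 1)//.
rewrite ge0_integral_measure_series//; last exact: mkernel'.
by apply: eq_eseriesr => n _; rewrite addn1.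
Qed.

Lemma measurable_transition f (M : R) : measurable_fun setT f ->
  (forall x, `|f x| <= M) -> measurable_fun setT (transition f).
Proof.
move=> mf fM.
have [] := @cbm_cintegral _ _ _ _ _ rho (fun z => (f (g z))%:C).
  by apply: (@cbm_real _ _ _ _ M) => //; exact: measurableT_comp.
by case.
Qed.

Let mgx x : measurable_fun setT (fun u => g (x, u)).
Proof. by apply: (measurableT_comp mg); exact: measurable_pair1. Qed.

Lemma transition_bound f (M : R) : measurable_fun setT f ->
  (forall x, `|f x| <= M) -> forall x, `|transition f x| <= M.
Proof.
by move=> mf fM x; apply: Rintegral_le_bound => //; exact: (measurableT_comp mf).
Qed.

Lemma iter_transition f (M : R) n : measurable_fun setT f ->
  (forall x, `|f x| <= M) ->
  measurable_fun setT (iter n transition f) /\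
  forall x, `|iter n transition f x| <= M.
Proof.
move=> mf fM; elim: n => [|n [m b]]//=.
by split; [exact: measurable_transition b|exact: transition_bound].
Qed.

Lemma invariant_transition f (M : R) : measurable_fun setT f ->
  (forall x, `|f x| <= M) ->
  \int[Q]_x transition f x = \int[Q]_x f x.
Proof.
move=> mf fM.
have mfg : measurable_fun setT (fun z => f (g z)) by exact: measurableT_comp.
have ifg : ((Q \x rho)%E).-integrable setT (EFin \o (fun z => f (g z))).
  by apply: (@bounded_integrable _ _ _ (prod_prob Q rho) _ M).
rewrite -(Rfubini1 ifg) /Rintegral; congr fine.
rewrite (eq_measure_integral (pushforward (Q \x rho)%E g)); last first.
  by move=> A mA _; exact: (esym (invariant_set mA)).
apply/esym; apply: (@integral_pushforward _ _ _ _ _ g mg (Q \x rho)%E setT (EFin \o f)) => //.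
exact/measurable_EFinP.
Qed.

(** Two copies driven by the same noise coincide as soon as the noise falls in [S], so only the
    complement, of mass 1 - p, contributes to the difference. *)
Lemma transition_contract f (M c : R) : measurable_fun setT f ->
  (forall x, `|f x| <= M) -> (forall x y, `|f x - f y| <= c) ->
  forall x y, `|transition f x - transition f y| <= (1 - p) * c.
Proof.
move=> mf fM fc x y.
have mfx z : measurable_fun setT (fun u => f (g (z, u))).
  exact: (measurableT_comp mf).
have ifx z : rho.-integrable setT (EFin \o (fun u => f (g (z, u)))).
  by apply: (@bounded_integrable _ _ _ rho _ M).
rewrite /transition -RintegralB//.
have iB := integrable_EFinB (ifx x) (ifx y).
rewrite (le_trans (le_normr_Rintegral measurableT iB))//.
have ic : rho.-integrable setT (EFin \o (fun u => c * \1_(~` S) u)).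
  apply: integrable_EFinZ.
  by apply: integrable_indic => //; rewrite setTI.
apply: le_trans (_ : \int[rho]_u (c * \1_(~` S) u) <= _).
  apply: le_Rintegral => //; first exact: (integrable_norm iB).
  move=> u _; rewrite indicE; have [Su|Su] := boolP (u \in ~` S).
    by rewrite mulr1.
  have {}Su : S u by move: Su; rewrite notin_setE => /contrapT.
  by rewrite mulr0 !gS// subrr normr0.
rewrite RintegralZl//; last by apply: integrable_indic => //; rewrite setTI.
rewrite /Rintegral integral_indic// setIT mulrC.
by rewrite (_ : fine _ = 1 - p)//; exact: (congr1 fine rhoC).
Qed.

Lemma iter_transition_osc f (M : R) n : measurable_fun setT f ->
  (forall x, `|f x| <= M) ->
  forall x y, `|iter n transition f x - iter n transition f y| <= (1 - p) ^+ n * (2 * M).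
Proof.
move=> mf fM; elim: n => [|n ih] x y.
  rewrite /= expr0 mul1r (le_trans (ler_normB _ _))// mulr_natl mulr2n.
  by rewrite lerD.
have [m b] := iter_transition n mf fM.
by rewrite /= exprS -mulrA; exact: (transition_contract m b ih).
Qed.

Lemma iter_transition_cvg f (M : R) x : measurable_fun setT f ->
  (forall x, `|f x| <= M) ->
  iter n transition f x @[n --> \oo] --> \int[Q]_y f y.
Proof.
move=> mf fM.
have inv n : \int[Q]_y iter n transition f y = \int[Q]_y f y.
  elim: n => [//|n ih]; have [m b] := iter_transition n mf fM.
  by rewrite /= (invariant_transition m b).
have key n : `|\int[Q]_y f y - iter n transition f x| <= (1 - p) ^+ n * (2 * M).
  have [m b] := iter_transition n mf fM.
  (* The value at [x] is written as the integral of a constant against [Q]; the difference is then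
     an average of oscillations. *)
  rewrite -(inv n) -[X in _ - X](Rintegral_cst1 Q) -RintegralB//; last 2 first.
  - exact: (@bounded_integrable _ _ _ Q _ M m b).
  - exact: (@bounded_integrable _ _ _ Q _ `|iter n transition f x|).
  apply: Rintegral_le_bound => [|y]; last exact: iter_transition_osc.
  by apply: measurable_funB => //; exact: measurable_cst.
have h : (1 - p) ^+ n * (2 * M) @[n --> \oo] --> (0 : R).
  rewrite -(mul0r (2 * M)); apply: cvgM; last exact: cvg_cst.
  apply: cvg_expr; rewrite ger0_norm ?subr_ge0//.
  by rewrite ltrBlDr ltrDl.
apply/cvgrPdist_le => eps eps0.
move/cvgr0Pnorm_le : h => /(_ _ eps0) h; near=> n.
rewrite (le_trans (key n))// (le_trans (ler_norm _))//.
by near: n.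
Unshelve. all: by end_near. Qed.

Lemma exists_invariant : exists Q : probability R R,
  (forall (f : R -> R) (M : R), measurable_fun setT f -> (forall x, `|f x| <= M) ->
     \int[Q]_x transition f x = \int[Q]_x f x) /\
  (forall (f : R -> R) (M : R) x, measurable_fun setT f -> (forall x, `|f x| <= M) ->
     iter n transition f x @[n --> \oo] --> \int[Q]_y f y).
Proof.
exists Q; split=> [f M|f M x]; [exact: invariant_transition|exact: iter_transition_cvg].
Qed.

End Doeblin.

(** * The reflected autoregression as a Markov chain *)

Section JointLaw.
Context {R : realType} {d d1 d2 : measure_display} {T : measurableType d}
  {T1 : measurableType d1} {T2 : measurableType d2}.
Variables (P : probability T R) (P1 : probability T1 R) (P2 : probability T2 R).
Variables (X : T -> T1) (Y : T -> T2) (D : set T) (c : \bar R).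
Hypotheses (mX : measurable_fun setT X) (mY : measurable_fun setT Y).
Hypotheses (mD : measurable D) (c_ge0 : (0 <= c)%E) (c_fin : c \is a fin_num).

(** Measurable rectangles are stable under intersection and generate the product, so two finite
    measures that agree on them agree. The fixed event [D] and factor [c] allow one coordinate to be
    treated at a time while the others stay prescribed. *)
Lemma joint_law :
  (forall A1 A2, measurable A1 -> measurable A2 ->
    P (X @^-1` A1 `&` (Y @^-1` A2 `&` D)) = (c * (P1 A1 * P2 A2))%E) ->
  forall Z, measurable Z ->
    P ((fun t => (X t, Y t)) @^-1` Z `&` D) = (c * prod_prob P1 P2 Z)%E.
Proof.
move=> rect Z mZ.
have mXY : measurable_fun setT (fun t => (X t, Y t)) by exact: measurable_fun_pair.
have fc0 : 0 <= fine c by exact: fine_ge0.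
pose m0 : {measure set (T1 * T2) -> \bar R} :=
  pushforward (mrestr P mD) (fun t => (X t, Y t)).
pose m1 := m0 mXY.
pose m2 : {measure set (T1 * T2) -> \bar R} := mscale (NngNum fc0) (prod_prob P1 P2).
have m2E A : m2 A = (c * prod_prob P1 P2 A)%E by rewrite /m2 /= /mscale /= fineK.
rewrite -m2E; suff : m1 Z = m2 Z by [].
apply: (@measure_unique _ _ _
    [set A `*` B | A in measurable & B in measurable] (fun=> setT) _ _ _ _ m1 m2) => //.
- exact: measurable_prod_measurableType.
- move=> _ _ [A1 mA1 [A2 mA2 <-]] [B1 mB1 [B2 mB2 <-]].
  exists (A1 `&` B1); first exact: measurableI.
  by exists (A2 `&` B2); [exact: measurableI|rewrite setXI].
- by move=> _; exists setT => //; exists setT => //; rewrite setXTT.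
- by rewrite bigcup_const.
- move=> _ [A1 mA1 [A2 mA2 <-]]; rewrite m2E /prod_prob product_measure1E//.
  rewrite -rect// /m1 /m0 /= /pushforward /mrestr setIA.
  by congr (P (_ `&` _)).
- move=> _; rewrite /m1 /m0 /= /pushforward /mrestr.
  rewrite (le_lt_trans (probability_le1 _ _)) ?ltry//.
  by rewrite preimage_setT setTI.
Qed.

End JointLaw.

Section ReflectedAR.
Context {R : realType} {d : measure_display} {T : measurableType d}.
Variables (P : probability T R) (V A B : nat -> {RV P >-> R}) (w : R).
Hypotheses (iidV : iid P (fun i => V i)) (iidA : iid P (fun i => A i))
  (iidB : iid P (fun i => B i)).
Hypothesis indVAB : independent_seqs P (fun i => V i) (fun i => A i) (fun i => B i).
Hypothesis w_ge0 : 0 <= w.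

(* The old state is clipped at 0 as well, so that the step is defined on all of
   [R] and depends on the state only through its positive part. *)
Definition reflected_step (z : (R * (R * (R * R)))%type) : R :=
  Num.max (z.2.1 * Num.max z.1 0 + z.2.2.2 - z.2.2.1) 0.

Local Notation W := (reflected_ar w (fun i => V i) (fun i => A i) (fun i => B i)).
Local Notation PV := (distribution P (V 0%N)).
Local Notation PA := (distribution P (A 0%N)).
Local Notation PB := (distribution P (B 0%N)).

Definition noise_law : probability (R * (R * R))%type R :=
  prod_prob PV (prod_prob PA PB).

Lemma measurable_reflected_step : measurable_fun setT reflected_step.
Proof.
have m1 : measurable_fun setT (fun z : (R * (R * (R * R)))%type => z.1).
  exact: measurable_fst.
have m2 : measurable_fun setT (fun z : (R * (R * (R * R)))%type => z.2).
  exact: measurable_snd.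
have m22 : measurable_fun setT (fun z : (R * (R * (R * R)))%type => z.2.2).
  by apply: (measurableT_comp _ m2); exact: measurable_snd.
apply: measurable_maxr; last exact: measurable_cst.
apply: measurable_funB; last first.
  by apply: (measurableT_comp _ m22); exact: measurable_fst.
apply: measurable_funD; last first.
  by apply: (measurableT_comp _ m22); exact: measurable_snd.
apply: measurable_funM.
  by apply: (measurableT_comp _ m2); exact: measurable_fst.
by apply: measurable_maxr => //; exact: measurable_cst.
Qed.

Lemma reflected_ar_ge0 n t : 0 <= W n t.
Proof. by case: n => //= n; rewrite le_max lexx orbT. Qed.

Lemma reflected_arS n t :
  W n.+1 t = reflected_step (W n t, (V n t, (A n t, B n t))).
Proof. by rewrite /reflected_step /= (max_l (reflected_ar_ge0 n t)). Qed.

Lemma measurable_noise n :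
  measurable_fun setT (fun t => (V n t, (A n t, B n t))).
Proof. by apply: measurable_fun_pair => //; exact: measurable_fun_pair. Qed.

Lemma measurable_reflected_ar n : measurable_fun setT (W n).
Proof.
elim: n => [|n ih]; first exact: measurable_cst.
rewrite (_ : W n.+1 =
    reflected_step \o (fun t => (W n t, (V n t, (A n t, B n t))))); last first.
  by apply/funext => t; rewrite reflected_arS.
apply: (measurableT_comp measurable_reflected_step).
by apply: measurable_fun_pair => //; exact: measurable_noise.
Qed.

Definition reflected_rv n : {RV P >-> R} :=
  HB.pack (W n) (isMeasurableFun.Build _ _ _ _ (W n) (measurable_reflected_ar n)).

Implicit Types (J : {fset nat}) (E F G : nat -> set R).

Definition future (J : {fset nat}) E F G : set T :=
  (\bigcap_(j in [set` J]) (V j @^-1` E j)) `&`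
  (\bigcap_(j in [set` J]) (A j @^-1` F j)) `&`
  (\bigcap_(j in [set` J]) (B j @^-1` G j)).

Let sigma_cylinder (X : nat -> {RV P >-> R}) J E :
  (forall j, measurable (E j)) ->
  sigma_seq (fun i => X i : T -> R) (\bigcap_(j in [set` J]) (X j @^-1` E j)).
Proof.
move=> mE; rewrite /sigma_seq.
apply: (@fin_bigcap_measurable _ (g_sigma_algebraType
  (\bigcup_n sigma_rv (fun t => X n t)))).
  exact: finite_fset.
move=> j _; apply: sub_sigma_algebra; exists j => //.
by exists (E j) => //; rewrite setTI.
Qed.

Let cylinderE (X : nat -> {RV P >-> R}) J E :
  iid P (fun i => X i) -> (forall j, measurable (E j)) ->
  P (\bigcap_(j in [set` J]) (X j @^-1` E j))
  = (\prod_(j <- J) distribution P (X 0%N) (E j))%E.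
Proof.
move=> [indX eqX] mE; rewrite indX; last first.
  by move=> j _; exists (E j) => //; rewrite setTI.
by apply: eq_bigr => j _; rewrite eqX.
Qed.

Lemma futureE J E F G : (forall j, measurable (E j)) ->
  (forall j, measurable (F j)) -> (forall j, measurable (G j)) ->
  P (future J E F G) = ((\prod_(j <- J) PV (E j)) * (\prod_(j <- J) PA (F j))
                        * (\prod_(j <- J) PB (G j)))%E.
Proof.
move=> mE mF mG; rewrite /future indVAB; [|exact: sigma_cylinder..].
by rewrite !cylinderE.
Qed.

Lemma measurable_future J E F G : (forall j, measurable (E j)) ->
  (forall j, measurable (F j)) -> (forall j, measurable (G j)) ->
  measurable (future J E F G).
Proof.
move=> mE mF mG; apply: measurableI; first apply: measurableI.
- apply: fin_bigcap_measurable => [|j _]; first exact: finite_fset.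
  exact: measurable_funPTI.
- apply: fin_bigcap_measurable => [|j _]; first exact: finite_fset.
  exact: measurable_funPTI.
- apply: fin_bigcap_measurable => [|j _]; first exact: finite_fset.
  exact: measurable_funPTI.
Qed.

Let upd (E : nat -> set R) n (E1 : set R) j := if j == n then E1 else E j.

Let bigcap_upd (X : nat -> {RV P >-> R}) J E n (E1 : set R) : n \notin J ->
  \bigcap_(j in [set` (n |` J)%fset]) (X j @^-1` upd E n E1 j)
  = X n @^-1` E1 `&` \bigcap_(j in [set` J]) (X j @^-1` E j).
Proof.
move=> nJ; apply/seteqP; split=> t /=.
- move=> h; split.
    by have := h n; rewrite /upd /= eqxx !inE eqxx => /(_ isT).
  move=> j /= jJ; have := h j; rewrite /upd /= !inE jJ orbT => /(_ isT).
  by case: eqP jJ nJ => // -> ->.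
- move=> [h1 h2] j /=; rewrite !inE /upd => /orP[/eqP ->|jJ].
    by rewrite eqxx.
  by case: eqP jJ nJ => [-> ->//|_ jJ _]; exact: h2.
Qed.

Let future_upd J E F G n (E1 F1 G1 : set R) : n \notin J ->
  future (n |` J)%fset (upd E n E1) (upd F n F1) (upd G n G1)
  = A n @^-1` F1 `&` (B n @^-1` G1 `&` (V n @^-1` E1 `&` future J E F G)).
Proof.
move=> nJ; rewrite /future !bigcap_upd//.
by apply/seteqP; split=> t [] => [[[? ?] [? ?]] [? ?]|? [? [? [[? ?] ?]]]]; do !split.
Qed.

Let prod_upd (p : set R -> \bar R) J E n (E1 : set R) : n \notin J ->
  (\prod_(j <- (n |` J)%fset) p (upd E n E1 j) = p E1 * \prod_(j <- J) p (E j))%E.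
Proof.
move=> nJ; rewrite big_fsetU1//= /upd eqxx; congr (_ * _)%E.
apply: eq_big_seq => j jJ; case: eqP => // jn.
by move: nJ; rewrite -jn jJ.
Qed.

Let measurable_upd E n (E1 : set R) : (forall j, measurable (E j)) -> measurable E1 ->
  forall j, measurable (upd E n E1 j).
Proof. by move=> mE mE1 j; rewrite /upd; case: eqP. Qed.

(** Independence of [W n] from the noise at times [n] and later, tested on cylinders over finitely
    many indices. *)
Definition nonanticipating n := forall (E0 : set R) J E F G, measurable E0 ->
  (forall j, measurable (E j)) -> (forall j, measurable (F j)) ->
  (forall j, measurable (G j)) -> (forall j, j \in J -> (n <= j)%N) ->
  P (W n @^-1` E0 `&` future J E F G)
  = (P (W n @^-1` E0) * P (future J E F G))%E.

Let mWn n (E0 : set R) : measurable E0 -> measurable (W n @^-1` E0).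
Proof. exact: (measurable_funPTI (reflected_rv n)). Qed.

(** Three uses of [joint_law] separate the state from the noise triple, then V from (A, B), then A
    from B; at each stage the coordinate just prescribed joins the fixed event. Keeping the strictly
    later future as a factor is what carries independence to time n + 1. *)
Lemma step_law n J E F G Z : nonanticipating n ->
  (forall j, measurable (E j)) -> (forall j, measurable (F j)) ->
  (forall j, measurable (G j)) -> (forall j, j \in J -> (n < j)%N) ->
  measurable Z ->
  P ((fun t => (W n t, (V n t, (A n t, B n t)))) @^-1` Z `&` future J E F G)
  = (P (future J E F G) * prod_prob (distribution P (reflected_rv n)) noise_law Z)%E.
Proof.
move=> na mE mF mG nJ mZ.
have nnJ : n \notin J by apply/negP => /nJ; rewrite ltnn.
have mfut := measurable_future J mE mF mG.
apply: joint_law => //.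
- exact: measurable_reflected_ar.
- exact: measurable_noise.
- exact: fin_num_measure.
move=> E0 Y mE0 mY.
rewrite setIA (setIC (_ @^-1` E0)) -setIA muleCA muleA.
have mD0 : measurable (W n @^-1` E0 `&` future J E F G).
  by apply: measurableI => //; exact: mWn.
apply: (@joint_law _ _ _ _ _ _ _ P PV (prod_prob PA PB) (V n)
  (fun t => (A n t, B n t)) (W n @^-1` E0 `&` future J E F G)
  (distribution P (reflected_rv n) E0 * P (future J E F G))%E) => //.
- exact: measurable_fun_pair.
- by rewrite mule_ge0.
- by rewrite fin_numM// fin_num_measure//; exact: mWn.
move=> E1 Y' mE1 mY'.
rewrite setIA (setIC (V n @^-1` _)) -setIA.
have mD1 : measurable (V n @^-1` E1 `&` (W n @^-1` E0 `&` future J E F G)).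
  by apply: measurableI => //; exact: measurable_funPTI.
rewrite muleA.
apply: (@joint_law _ _ _ _ _ _ _ P PA PB (A n) (B n) _
  (distribution P (reflected_rv n) E0 * P (future J E F G) * PV E1)%E) => //.
- by rewrite !mule_ge0.
- by rewrite !fin_numM// fin_num_measure.
move=> F1 G1 mF1 mG1.
(* The constraints on the noise at time [n] are absorbed into a cylinder over the indices [J] and
   [n], to which the hypothesis on [W n] applies. *)
have -> : A n @^-1` F1 `&` (B n @^-1` G1 `&`
      (V n @^-1` E1 `&` (W n @^-1` E0 `&` future J E F G)))
    = W n @^-1` E0 `&` future (n |` J)%fset (upd E n E1) (upd F n F1) (upd G n G1).
  rewrite future_upd//; apply/seteqP.
  by split=> t [? [? [? [? ?]]]]; do 4!split=> //.
rewrite na//; try exact: measurable_upd; last first.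
  by move=> j; rewrite !inE => /orP[/eqP ->//|/nJ /ltnW].
rewrite futureE; try exact: measurable_upd.
rewrite !prod_upd// futureE//.
rewrite (_ : P (W n @^-1` E0) = distribution P (reflected_rv n) E0)//.
rewrite /=.
move: (distribution P (reflected_rv n) E0) (\prod_(j <- J) PV (E j))%E
  (\prod_(j <- J) PA (F j))%E (\prod_(j <- J) PB (G j))%E
  (PV E1) (PA F1) (PB G1) => m a b c x y z.
rewrite -!muleA; congr (_ * _)%E.
rewrite muleCA; congr (_ * _)%E.
rewrite (muleCA y b) (muleCA x b); congr (_ * _)%E.
by rewrite [RHS]muleC -!muleA.
Qed.

Let nonanticipating_step n : nonanticipating n -> nonanticipating n.+1.
Proof.
move=> na E0 J E F G mE0 mE mF mG nJ.
have mZ : measurable (reflected_step @^-1` E0).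
  by rewrite -[X in measurable X]setTI; exact: measurable_reflected_step.
have WE : W n.+1 @^-1` E0 =
    (fun t => (W n t, (V n t, (A n t, B n t)))) @^-1` (reflected_step @^-1` E0).
  by apply/seteqP; split=> t /=; rewrite -/(W n.+1 t) reflected_arS.
rewrite WE (step_law na mE mF mG nJ mZ) muleC; congr (_ * _)%E.
have empty j : j \in (fset0 : {fset nat}) -> (n < j)%N by rewrite in_fset0.
have := step_law (J := fset0) (E := fun=> setT) (F := fun=> setT)
  (G := fun=> setT) na (fun=> measurableT) (fun=> measurableT)
  (fun=> measurableT) empty mZ.
have -> : future fset0 (fun=> setT) (fun=> setT) (fun=> setT) = setT.
  by rewrite /future; apply/seteqP; split=> // t _; split=> //; split.
by rewrite setIT measure_probability_setT mul1e => ->.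
Qed.

Lemma nonanticipatingP n : nonanticipating n.
Proof.
elim: n => [|n]; last exact: nonanticipating_step.
move=> E0 J E F G mE0 mE mF mG _.
have [wE|wE] := pselect (E0 w).
  have -> : W 0 @^-1` E0 = setT by apply/seteqP; split.
  by rewrite setTI measure_probability_setT mul1e.
have -> : W 0 @^-1` E0 = set0 by apply/seteqP; split.
by rewrite set0I measure0 mul0e.
Qed.

Let step_law0 n Z : measurable Z ->
  P ((fun t => (W n t, (V n t, (A n t, B n t)))) @^-1` Z)
  = prod_prob (distribution P (reflected_rv n)) noise_law Z.
Proof.
move=> mZ.
have empty j : j \in (fset0 : {fset nat}) -> (n < j)%N by rewrite in_fset0.
have := step_law (J := fset0) (E := fun=> setT) (F := fun=> setT)
  (G := fun=> setT) (@nonanticipatingP n) (fun=> measurableT) (fun=> measurableT)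
  (fun=> measurableT) empty mZ.
have -> : future fset0 (fun=> setT) (fun=> setT) (fun=> setT) = setT.
  by rewrite /future; apply/seteqP; split=> // t _; split=> //; split.
by rewrite setIT measure_probability_setT mul1e.
Qed.

(** The joint law at time 0 with the state left free. *)
Lemma noise_lawE Z : measurable Z ->
  noise_law Z = P ((fun t => (V 0%N t, (A 0%N t, B 0%N t))) @^-1` Z).
Proof.
move=> mZ.
have mTZ : measurable (setT `*` Z : set (R * (R * (R * R)))) by exact: measurableX.
have := step_law0 0 mTZ; rewrite /prod_prob product_measure1E//.
rewrite measure_probability_setT mul1e => <-; congr (P _).
by apply/seteqP; split=> t //= [].
Qed.

Lemma reflected_ar_law n (E0 : set R) : measurable E0 ->
  distribution P (reflected_rv n.+1) E0
  = prod_prob (distribution P (reflected_rv n)) noise_law (reflected_step @^-1` E0).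
Proof.
move=> mE0.
have mZ : measurable (reflected_step @^-1` E0).
  by rewrite -[X in measurable X]setTI; exact: measurable_reflected_step.
rewrite -(step_law0 n mZ).
congr (P _); apply/seteqP.
by split=> t /=; rewrite -/(W n.+1 t) reflected_arS.
Qed.

(** Integrating out the last step replaces [f] at time n + 1 by its transition at time n; [iterSr]
    peels the iterate at that end. *)
Lemma reflected_ar_expectation n (f : R -> R) (M : R) : measurable_fun setT f ->
  (forall x, `|f x| <= M) ->
  \int[P]_t f (W n t) = iter n (transition noise_law reflected_step) f w.
Proof.
elim: n f => [|n ih] f mf fM; first by rewrite /= Rintegral_cst1.
rewrite iterSr -ih; last 2 first.
- exact: (measurable_transition noise_law measurable_reflected_step mf fM).
- exact: (transition_bound noise_law measurable_reflected_step mf fM).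
have bf m : P.-integrable setT (EFin \o (fun t => f (W m t))).
  apply: (@bounded_integrable _ _ _ P _ M) => //.
  by apply: measurableT_comp => //; exact: measurable_reflected_ar.
have toD m (h : R -> R) (N : R) : measurable_fun setT h -> (forall x, `|h x| <= N) ->
    \int[P]_t h (W m t) = \int[distribution P (reflected_rv m)]_x h x.
  move=> mh hN; rewrite /Rintegral integral_distribution//; first exact/measurable_EFinP.
  apply: (@bounded_integrable _ _ _ P (h \o W m) N) => [|t]; last exact: hN.
  by apply: measurableT_comp => //; exact: measurable_reflected_ar.
rewrite (toD _ _ _ mf fM).
rewrite (toD _ _ _ (measurable_transition noise_law measurable_reflected_step mf fM)
  (transition_bound noise_law measurable_reflected_step mf fM)).
set mu := distribution P (reflected_rv n).
have mfg : measurable_fun setT (fun z => f (reflected_step z)).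
  by apply: measurableT_comp => //; exact: measurable_reflected_step.
have ifg : ((mu \x noise_law)%E).-integrable setT
    (EFin \o (fun z => f (reflected_step z))).
  by apply: (@bounded_integrable _ _ _ (prod_prob mu noise_law) _ M).
rewrite -(Rfubini1 ifg) /Rintegral; congr fine.
pose push : {measure set R -> \bar R} :=
  pushforward (mu \x noise_law)%E reflected_step.
transitivity (\int[push measurable_reflected_step]_x (f x)%:E)%E.
  by apply: eq_measure_integral => E0 mE0 _; exact: (reflected_ar_law n mE0).
apply: (@integral_pushforward _ _ _ _ _ _ measurable_reflected_step
  (mu \x noise_law)%E setT (EFin \o f)) => //.
exact/measurable_EFinP.
Qed.

End ReflectedAR.

(** * The transform of one step *)

Section ComplexTransform.
Context {R : realType} {d : measure_display} {T : measurableType d}.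
Variables (mu : {measure set T -> \bar R}) (X : T -> R) (k : T -> R[i]).
Hypotheses (mX : measurable_fun setT X) (ik : cintegrable mu k).
Implicit Types F G : R -> R[i].
Local Notation Re := complex.Re.
Local Notation Im := complex.Im.

(** Integration of [F] against a complex measure on the line, given as the image under [X] of [mu]
    with density [k]. This form covers a law, an atom and a Lebesgue density at once. *)
Definition pairing F : R[i] := cintegral mu setT (fun t => F (X t) * k t).

Lemma pairing_integrable F : cbm F -> cintegrable mu (fun t => F (X t) * k t).
Proof. by move=> bF; apply: cintegrableM => //; exact: (cbm_comp mX bF). Qed.

Lemma pairingD F G : cbm F -> cbm G ->
  pairing (fun x => F x + G x) = pairing F + pairing G.
Proof.
move=> bF bG; rewrite /pairing -cintegralD; [|exact: pairing_integrable..].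
by apply: eq_cintegral => t _; rewrite mulrDl.
Qed.

Lemma pairingZ (a : R[i]) F : cbm F -> pairing (fun x => a * F x) = a * pairing F.
Proof.
move=> bF; rewrite /pairing -cintegralZ; last exact: pairing_integrable.
by apply: eq_cintegral => t _; rewrite mulrA.
Qed.

Lemma pairing_sum I (s : seq I) (F : I -> R -> R[i]) : (forall i, cbm (F i)) ->
  pairing (fun x => \sum_(i <- s) F i x) = \sum_(i <- s) pairing (F i).
Proof.
move=> bF; elim: s => [|i s ih].
  rewrite big_nil /pairing; under eq_cintegral do rewrite big_nil mul0r.
  exact: cintegral0.
rewrite big_cons -ih -pairingD//; last exact: cbm_sum.
by congr pairing; apply/funext => x; rewrite big_cons.
Qed.

Lemma pairing_split F : cbm F ->
  pairing F = pairing (fun x => (Re (F x))%:C)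
              + 'i * pairing (fun x => (Im (F x))%:C).
Proof.
move=> [[F1 F2] [M FM]].
have b1 : cbm (fun x => (Re (F x))%:C).
  by apply: (@cbm_real _ _ _ _ M) => // x; case: (FM x).
have b2 : cbm (fun x => (Im (F x))%:C).
  by apply: (@cbm_real _ _ _ _ M) => // x; case: (FM x).
rewrite -pairingZ// -pairingD//; last by apply: cbmM => //; exact: cbm_cst.
by congr pairing; apply/funext => x; rewrite -complexE.
Qed.

End ComplexTransform.

Lemma pairing_unique {R : realType} {d1 d2} {T1 : measurableType d1}
    {T2 : measurableType d2}
    (mu1 : {measure set T1 -> \bar R}) (mu2 : {measure set T2 -> \bar R})
    (X1 : T1 -> R) (X2 : T2 -> R) (k1 : T1 -> R[i]) (k2 : T2 -> R[i]) :
  measurable_fun setT X1 -> measurable_fun setT X2 ->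
  cintegrable mu1 k1 -> cintegrable mu2 k2 ->
  (forall n : nat,
    pairing mu1 X1 k1 (fun x => (expR (- (n%:R * Num.max x 0)))%:C)
    = pairing mu2 X2 k2 (fun x => (expR (- (n%:R * Num.max x 0)))%:C)) ->
  forall F : R -> R[i], cbounded F -> continuous (fun x => complex.Re (F x)) ->
    continuous (fun x => complex.Im (F x)) -> (forall x, F (Num.max x 0) = F x) ->
    pairing mu1 X1 k1 F = pairing mu2 X2 k2 F.
Proof.
move=> mX1 mX2 ik1 ik2 e12 F [M FM] c1 c2 F0.
have bF : cbm F by split; [split; exact: continuous_measurable_fun|exists M].
have l h := laplace_unique (h := h) mX1 mX2 ik1 ik2 e12.
rewrite (pairing_split mX1 ik1 bF) (pairing_split mX2 ik2 bF); congr (_ + _ * _).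
- have := l _ M c1 (fun x => (FM x).1).
  by rewrite /pairing; under eq_cintegral do rewrite F0; move=> ->;
    under eq_cintegral do rewrite F0.
- have := l _ M c2 (fun x => (FM x).2).
  by rewrite /pairing; under eq_cintegral do rewrite F0; move=> ->;
    under eq_cintegral do rewrite F0.
Qed.

Section ExpNeg.
Context {R : realType}.
Local Notation Re := complex.Re.
Local Notation Im := complex.Im.

(* Clipping at 0 makes the exponential bounded on the whole line when
   [0 <= Re s]. *)
Definition expneg (s : R[i]) (x : R) : R[i] := cexp (- s * (Num.max x 0)%:C).

Lemma cbm_cexp_le0 d (T : measurableType d) (s : R[i]) (h : T -> R) :
  Re s <= 0 -> measurable_fun setT h -> (forall t, 0 <= h t) ->
  cbm (fun t => cexp (s * (h t)%:C)).
Proof.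
move=> s0 mh h0; apply: cbm_cexp.
  by apply: cmeasurableM; [exact: cmeasurable_cst|exact: cmeasurable_real].
by move=> t; rewrite cReM /= mulr0 subr0 mulr_le0_ge0.
Qed.

Lemma max0_ge0 (x : R) : 0 <= Num.max x 0. Proof. by rewrite le_max lexx orbT. Qed.

Lemma cbm_expneg (s : R[i]) : 0 <= Re s -> cbm (expneg s).
Proof.
move=> s0; apply: cbm_cexp_le0; first by rewrite cReN oppr_le0.
- exact: measurable_maxr0.
- by move=> t; exact: max0_ge0.
Qed.

Lemma expneg_nat (n : nat) (x : R) :
  expneg n%:R x = (expR (- (n%:R * Num.max x 0)))%:C.
Proof.
rewrite /expneg -cexp_real; congr cexp.
by rewrite rmorphN rmorphM /= rmorph_nat mulNr.
Qed.

Lemma Re_natr_ge0 (n : nat) : 0 <= Re (n%:R : R[i]).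
Proof. by rewrite -(rmorph_nat (real_complex R)) /= ler0n. Qed.

Lemma continuous_max0 : continuous (fun x : R => Num.max x 0).
Proof.
by move=> x; apply: continuous_max; [exact: cvg_id|exact: cvg_cst].
Qed.

Lemma continuous_cexp_max (s : R[i]) (y : R) :
  continuous (fun x => Re (cexp (s * (Num.max (x - y) 0)%:C))) /\
  continuous (fun x => Im (cexp (s * (Num.max (x - y) 0)%:C))).
Proof.
have cm : continuous (fun x : R => Num.max (x - y) 0).
  move=> x; apply: (@continuous_comp _ _ _ (fun x => x - y) (fun x => Num.max x 0)).
    by apply: cvgB; [exact: cvg_id|exact: cvg_cst].
  exact: continuous_max0.
have d1 := is_derive_cont (fun x => (cderiv_cexp s x).1).
have d2 := is_derive_cont (fun x => (cderiv_cexp s x).2).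
by split=> x; [exact: (continuous_comp (cm x) (d1 _))|
               exact: (continuous_comp (cm x) (d2 _))].
Qed.

End ExpNeg.

Section TransformOfStep.
Context {R : realType} {l : nat} (r : 'I_l -> R[i]) (N : {poly R[i]}).
Variables PV PA PB : probability R R.
Local Notation Re := complex.Re.
Local Notation Im := complex.Im.
Local Notation D := (root_poly r).
Hypothesis V_lt0 : {ae PV, forall v, v < 0}.
Hypothesis A_ge0 : {ae PA, forall a, 0 <= a}.
Hypothesis r_lt0 : forall j, Re (r j) < 0.
Hypothesis N_size : (size N <= l)%N.
Hypothesis B_lst : forall s : R[i], 0 <= Re s ->
  cintegral PB setT (expneg s) = N.[s] / D.[s].
Variables (c : 'I_l -> R -> R[i]) (q : 'I_l -> {poly R[i]}).
Hypothesis cbm_c : forall k, cbm (c k).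
Hypothesis q_size : forall k, (size (q k) <= l)%N.
Hypothesis q_root : forall y j, 0 <= y ->
  \sum_(k < l) c k y * (q k).[r j] = N.[r j] * cexp (r j * y%:C).
Variable kappa : R -> R[i].
Hypothesis kappa_int : cintegrable (@lebesgue_measure R) kappa.
Hypothesis kappa_lst : forall s : R[i], 0 <= Re s ->
  cintegral (@lebesgue_measure R) setT
    (fun x => cexp (- s * (Num.max x 0)%:C) * kappa x) = N.[s] / D.[s].
Hypothesis kappa_shift : forall (s : R[i]) y, 0 <= Re s -> 0 <= y ->
  cintegral (@lebesgue_measure R) setT
    (fun x => cexp (- s * (Num.max (x - y) 0)%:C) * kappa x)
  = N.[0] / D.[0]
    + \sum_(k < l) c k y * ((q k).[s] / D.[s] - (q k).[0] / D.[0]).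

Let theta (s : R[i]) (k : 'I_l) := (q k).[s] / D.[s] - (q k).[0] / D.[0].

Let N0 : N.[0] / D.[0] = 1.
Proof.
rewrite -B_lst//; under eq_cintegral do rewrite /expneg oppr0 mul0r cexp0.
exact: cintegral_cst.
Qed.

(** [PB] and the density [kappa] have the same transform at all integers, so they give the same
    integral to b -> exp(- s [b - y]^+), which is bounded and continuous. The formula computed for
    [kappa] thus passes to [PB]. *)
Lemma shifted_transform (s : R[i]) y : 0 <= Re s -> 0 <= y ->
  cintegral PB setT (fun b => cexp (- s * (Num.max (b - y) 0)%:C))
  = 1 + \sum_(k < l) c k y * theta s k.
Proof.
move=> s0 y0; rewrite -N0 -kappa_shift//.
pose F (x : R) := cexp (- s * (Num.max (x - y) 0)%:C).
have mid : measurable_fun [set: measurableTypeR R] (id : R -> R).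
  by move=> _ A mA; rewrite setTI.
have := @pairing_unique _ _ _ _ _ PB (@lebesgue_measure R) id id (fun=> 1) kappa.
move=> /(_ (@measurable_id _ _ _) mid (cbm_integrable _ (cbm_cst _)) kappa_int) h.
have {}h := h _ F; rewrite /pairing in h.
have -> : cintegral PB setT (fun b => F b) = cintegral PB setT (fun b => F b * 1).
  by apply: eq_cintegral => b _; rewrite mulr1.
apply: h.
- move=> n; under eq_cintegral do rewrite -expneg_nat mulr1.
  rewrite B_lst -?kappa_lst; [|exact: Re_natr_ge0..].
  by apply: eq_cintegral => x _; rewrite -expneg_nat.
- suff [] : cbm F by [].
  apply: cbm_cexp_le0; first by rewrite cReN oppr_le0.
    apply: measurable_maxr; last exact: measurable_cst.
    by apply: measurable_funB => //; exact: measurable_cst.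
  by move=> t; exact: max0_ge0.
- by have [] := continuous_cexp_max (- s) y.
- by have [] := continuous_cexp_max (- s) y.
(* Since y >= 0, a negative argument and its positive part 0 both give 0. *)
- move=> x; suff e : Num.max (Num.max x 0 - y) 0 = Num.max (x - y) 0 by rewrite /F e.
  have [//|x0] := leP 0 x.
  have xy : x - y <= 0 by rewrite subr_le0 (le_trans (ltW x0)).
  by rewrite (max_r xy) max_r// sub0r oppr_le0.
Qed.

Let rho : probability (R * (R * R))%type R := prod_prob PV (prod_prob PA PB).

Definition cstep (F : R -> R[i]) (x : R) : R[i] :=
  cintegral rho setT (fun u => F (reflected_step (x, u))).

Lemma cintegral_noise (F : (R * (R * R))%type -> R[i]) : cbm F ->
  cintegral rho setT F = cintegral (prod_prob PV PA) setT
    (fun z => cintegral PB setT (fun b => F (z.1, (z.2, b)))).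
Proof.
move=> bF.
have bF' : cbm (fun y : (R * R) * R => F (y.1.1, (y.1.2, y.2))).
  apply: (cbm_comp _ bF); apply: measurable_fun_pair.
    by apply: measurableT_comp; [exact: measurable_fst|exact: measurable_fst].
  apply: measurable_fun_pair; last exact: measurable_snd.
  by apply: measurableT_comp; [exact: measurable_snd|exact: measurable_fst].
rewrite [LHS]cintegral_prod_prob// cintegral_prod_prob; last first.
  exact: (cbm_cintegral PB bF').
apply: eq_cintegral => v _; rewrite cintegral_prod_prob//.
by apply: (cbm_comp _ bF); exact: measurable_pair1.
Qed.

(** The signs of V and A are almost sure only; this confines every later computation to v < 0 and a
    >= 0. *)
Lemma ae_eq_cintegral_VA (F1 F2 : (R * R)%type -> R[i]) : cbm F1 -> cbm F2 ->
  (forall v a, v < 0 -> 0 <= a -> F1 (v, a) = F2 (v, a)) ->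
  cintegral (prod_prob PV PA) setT F1 = cintegral (prod_prob PV PA) setT F2.
Proof.
move=> b1 b2 e12; rewrite (cintegral_prod_prob _ _ b1) (cintegral_prod_prob _ _ b2).
apply: ae_eq_cintegral.
- by have [] := cbm_cintegral PA b1.
- by have [] := cbm_cintegral PA b2.
apply: filterS V_lt0 => v v0; apply: ae_eq_cintegral.
- by have [] := cbm_comp (measurable_pair1 v) b1.
- by have [] := cbm_comp (measurable_pair1 v) b2.
by apply: filterS A_ge0 => a a0; exact: e12.
Qed.

(* With [y = lag x (v, a)], the next state is the positive part of [b - y]. *)
Let lag (x : R) (z : (R * R)%type) : R := z.2 - z.1 * Num.max x 0.

Let measurable_lag2 : measurable_fun setT
  (fun y : (R * (R * R))%type => lag y.1 y.2).
Proof.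
have m2 : measurable_fun setT (fun z : (R * (R * R))%type => z.2).
  exact: measurable_snd.
apply: measurable_funB.
  by apply: (measurableT_comp _ m2); exact: measurable_snd.
apply: measurable_funM.
  by apply: (measurableT_comp _ m2); exact: measurable_fst.
by apply: (measurableT_comp measurable_maxr0); exact: measurable_fst.
Qed.

Let measurable_lag x : measurable_fun setT (lag x).
Proof.
exact: (measurableT_comp measurable_lag2 (measurable_pair1 x)).
Qed.

Let lag_ge0 x v a : v < 0 -> 0 <= a -> 0 <= lag x (v, a).
Proof.
move=> v0 a0; rewrite /lag /= subr_ge0 (le_trans _ a0)//.
by rewrite mulr_le0_ge0 ?max0_ge0// ltW.
Qed.

Let C (k : 'I_l) (x : R) : R[i] :=
  cintegral (prod_prob PV PA) setT (fun z => c k (lag x z)).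

Let cbm_C k : cbm (C k).
Proof.
exact: (@cbm_cintegral _ _ _ _ _ (prod_prob PV PA) _ (cbm_comp measurable_lag2 (cbm_c k))).
Qed.

Let comb_integral x (t : 'I_l -> R[i]) :
  cintegral (prod_prob PV PA) setT (fun z => \sum_(k < l) c k (lag x z) * t k)
  = \sum_(k < l) C k x * t k.
Proof.
have ic k : cintegrable (prod_prob PV PA) (fun z => c k (lag x z)).
  apply: (@cbm_integrable _ _ _ (prod_prob PV PA)).
  exact: (cbm_comp (measurable_lag x) (cbm_c k)).
rewrite cintegral_sum; last first.
  by move=> k; under eq_fun do rewrite mulrC; exact: cintegrableZ.
apply: eq_bigr => k _; under eq_cintegral do rewrite mulrC.
by rewrite cintegralZ// mulrC.
Qed.

Let cbm_comb x (t : 'I_l -> R[i]) :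
  cbm (fun z => \sum_(k < l) c k (lag x z) * t k).
Proof.
apply: cbm_sum => k; apply: cbmM; last exact: cbm_cst.
exact: (cbm_comp (measurable_lag x) (cbm_c k)).
Qed.

(** Given v and a, the next state is [b - y]^+ with y = [lag] >= 0, so [shifted_transform] applies
    before averaging. The state enters through the [C k] alone and [s] through [theta] alone; this
    separation makes the transform rational with denominator [D] whatever the measure of the
    state. *)
Lemma cstep_expneg (s : R[i]) x : 0 <= Re s ->
  cstep (expneg s) x = 1 + \sum_(k < l) C k x * theta s k.
Proof.
move=> s0; rewrite /cstep cintegral_noise; last first.
  apply: (cbm_comp _ (cbm_expneg s0)).
  apply: (measurableT_comp measurable_reflected_step).
  exact: measurable_pair1.
transitivity (cintegral (prod_prob PV PA) setT
    (fun z => 1 + \sum_(k < l) c k (lag x z) * theta s k)); last first.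
  rewrite cintegralD.
  - by rewrite cintegral_cst comb_integral.
  - by apply: (@cbm_integrable _ _ _ (prod_prob PV PA)); exact: cbm_cst.
  - by apply: (@cbm_integrable _ _ _ (prod_prob PV PA)); exact: cbm_comb.
have E z b : expneg s (reflected_step (x, (z.1, (z.2, b))))
    = cexp (- s * (Num.max (b - lag x z) 0)%:C).
  rewrite /expneg /reflected_step /lag /=; congr (cexp (_ * _%:C)).
  rewrite (max_l (max0_ge0 _)); congr Num.max; ring.
under eq_cintegral do under eq_cintegral do rewrite E.
apply: ae_eq_cintegral_VA.
- apply: (@cbm_cintegral _ _ _ _ _ PB
    (fun y => cexp (- s * (Num.max (y.2 - lag x y.1) 0)%:C))).
  apply: cbm_cexp_le0; first by rewrite cReN oppr_le0.
    apply: (measurableT_comp measurable_maxr0).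
    apply: measurable_funB; first exact: measurable_snd.
    by apply: (measurableT_comp (measurable_lag x)); exact: measurable_fst.
  by move=> t; exact: max0_ge0.
- by apply: cbmD; [exact: cbm_cst|exact: cbm_comb].
by move=> v a v0 a0; exact: (shifted_transform s0 (lag_ge0 x v0 a0)).
Qed.

(** Phi_A at - s_j, with [a] clipped so that the integrand is bounded everywhere. *)
Definition a_lst (j : 'I_l) : R[i] :=
  cintegral PA setT (fun a => cexp (r j * (Num.max a 0)%:C)).

(** At a root the combination is e^(r_j y) with y = a - v x, a product of a factor in a and a factor
    in v, and these are independent. Clipping v at 0 keeps the second factor bounded. *)
Let comb_root x j : \sum_(k < l) C k x * (q k).[r j]
  = N.[r j] * (a_lst j *
      cintegral PV setT (fun v => expneg (r j * (Num.min v 0)%:C) x)).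
Proof.
have rj0 : Re (r j) <= 0 by exact: ltW.
have bA : cbm (fun a : R => cexp (r j * (Num.max a 0)%:C)).
  by apply: cbm_cexp_le0 => //; [exact: measurable_maxr0|move=> t; exact: max0_ge0].
have bV : cbm (fun v : R => expneg (r j * (Num.min v 0)%:C) x).
  rewrite (_ : (fun v => _) = fun v : R =>
      cexp (r j * (- Num.min v 0 * Num.max x 0)%:C)); last first.
    apply/funext => v; rewrite /expneg; congr cexp.
    by rewrite rmorphM rmorphN /=; ring.
  apply: cbm_cexp_le0 => //.
    apply: measurable_funM; last exact: measurable_cst.
    apply: measurableT_comp => //.
    by apply: measurable_minr; [exact: measurable_id|exact: measurable_cst].
  move=> v; rewrite mulr_ge0 ?max0_ge0// oppr_ge0 ge_min lexx orbT//.
rewrite -comb_integral.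
transitivity (cintegral (prod_prob PV PA) setT (fun z =>
    N.[r j] * (cexp (r j * (Num.max z.2 0)%:C)
               * expneg (r j * (Num.min z.1 0)%:C) x))).
  apply: ae_eq_cintegral_VA; first exact: cbm_comb.
    apply: cbmM; first exact: cbm_cst.
    apply: cbmM.
      by apply: (cbm_comp _ bA); exact: measurable_snd.
    by apply: (cbm_comp _ bV); exact: measurable_fst.
  move=> v a v0 a0; rewrite q_root ?lag_ge0//=; congr (_ * _).
  rewrite /expneg -cexpD (max_l a0) (min_l (ltW v0)); congr cexp.
  by rewrite /lag /= rmorphB rmorphM /=; ring.
have bz : cbm (fun z : (R * R)%type => cexp (r j * (Num.max z.2 0)%:C)
               * expneg (r j * (Num.min z.1 0)%:C) x).
  apply: cbmM.
    by apply: (cbm_comp _ bA); exact: measurable_snd.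
  by apply: (cbm_comp _ bV); exact: measurable_fst.
rewrite cintegralZ; last exact: (@cbm_integrable _ _ _ (prod_prob PV PA)).
congr (_ * _); rewrite cintegral_prod_prob//=.
rewrite -[RHS]cintegralZ; last exact: cbm_integrable.
apply: eq_cintegral => v _; rewrite [RHS]mulrC /a_lst -cintegralZ.
  by apply: eq_cintegral => a _; rewrite mulrC.
exact: cbm_integrable.
Qed.

Section Functional.
Context {d : measure_display} {T : measurableType d}.
Variables (mu : {sigma_finite_measure set T -> \bar R}) (X : T -> R) (f : T -> R[i]).
Hypotheses (mX : measurable_fun setT X) (intf : cintegrable mu f).
Local Notation m := (pairing mu X f).

(** Subtracting the multiple of [D] makes each summand vanish at 0, so the value at 0 records the
    total mass alone. *)
Definition step_poly : {poly R[i]} :=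
  m (fun=> 1) *: D + \sum_(k < l) m (C k) *: (q k - ((q k).[0] / D.[0]) *: D).

Lemma size_step_poly : (size step_poly <= l.+1)%N.
Proof.
rewrite (leq_trans (size_polyD _ _))// geq_max; apply/andP; split.
  by rewrite (leq_trans (size_scale_leq _ _))// size_root_poly.
apply: (leq_trans (size_sum _ _ _)); apply/bigmax_leqP => k _.
rewrite (leq_trans (size_scale_leq _ _))// (leq_trans (size_polyD _ _))//.
rewrite size_polyN geq_max (leq_trans (q_size k))//=.
by rewrite (leq_trans (size_scale_leq _ _))// size_root_poly.
Qed.

Let D0 s : 0 <= Re s -> D.[s] != 0.
Proof. exact: root_poly_Re_ge0. Qed.

Let step_polyE s : step_poly.[s] = m (fun=> 1) * D.[s]
  + \sum_(k < l) m (C k) * ((q k).[s] - (q k).[0] / D.[0] * D.[s]).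
Proof.
rewrite /step_poly hornerD hornerZ horner_sum; congr (_ + _).
by apply: eq_bigr => k _; rewrite !hornerE.
Qed.

Lemma step_poly_transform s : 0 <= Re s ->
  m (cstep (expneg s)) = step_poly.[s] / D.[s].
Proof.
move=> s0; have Ds := D0 s0.
rewrite (_ : cstep _ = fun x => 1 + \sum_(k < l) theta s k * C k x); last first.
  apply/funext => x; rewrite cstep_expneg//.
  by congr (_ + _); apply: eq_bigr => k _; rewrite mulrC.
rewrite pairingD//; [|exact: cbm_cst|]; last first.
  by apply: cbm_sum => k; apply: cbmM => //; exact: cbm_cst.
rewrite pairing_sum//; last by move=> k; apply: cbmM => //; exact: cbm_cst.
rewrite step_polyE mulrDl mulfK//; congr (_ + _).
rewrite mulr_suml; apply: eq_bigr => k _.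
rewrite pairingZ// /theta; have := D0 (lexx 0 : 0 <= Re (0 : R[i])).
move: (m _) (D.[s]) (D.[0]) (q k).[s] (q k).[0] Ds => u a b x y a0 b0.
by field; rewrite a0 b0.
Qed.

Lemma step_poly0 : step_poly.[0] = m (fun=> 1) * D.[0].
Proof.
rewrite step_polyE big1 ?addr0// => k _.
by rewrite divfK ?subrr ?mulr0// D0.
Qed.

(** The polynomial is evaluated at the root, outside the half-plane where it is tied to a transform.
    The terms in [D] vanish there, and what remains is the pairing of [comb_root]. *)
Lemma step_poly_root j : step_poly.[r j] =
  N.[r j] * (a_lst j *
    cintegral PV setT (fun v => m (expneg (r j * (Num.min v 0)%:C)))).
Proof.
rewrite step_polyE root_poly_root mulr0 add0r.
under eq_bigr do rewrite mulr0 subr0 mulrC -(pairingZ mX intf)//.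
rewrite -(pairing_sum mX intf); last first.
  by move=> k; apply: cbmM => //; exact: cbm_cst.
have bF : cbm (fun y : (T * R)%type => expneg (r j * (Num.min y.2 0)%:C) (X y.1)).
  rewrite (_ : (fun y => _) = fun y : (T * R)%type =>
      cexp (r j * (- Num.min y.2 0 * Num.max (X y.1) 0)%:C)); last first.
    apply/funext => v; rewrite /expneg; congr cexp.
    by rewrite rmorphM rmorphN /=; ring.
  apply: cbm_cexp_le0; first exact: ltW.
    apply: measurable_funM.
      apply: measurableT_comp => //; apply: measurable_minr.
        exact: measurable_snd.
      exact: measurable_cst.
    apply: (measurableT_comp measurable_maxr0).
    by apply: (measurableT_comp mX); exact: measurable_fst.
  by move=> v; rewrite mulr_ge0 ?max0_ge0// oppr_ge0 ge_min lexx orbT.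
have bI := cbm_cintegral PV bF.
(* The average over v moves inside the pairing, where it can be compared with [comb_root] pointwise
   in the state. *)
rewrite /pairing -(cfubini_swap PV intf bF) mulrA.
rewrite -cintegralZ; last exact: cintegrableM.
apply: eq_cintegral => t _; rewrite mulrA; congr (_ * _).
under eq_bigr do rewrite mulrC.
by rewrite comb_root mulrA.
Qed.

End Functional.

End TransformOfStep.

Lemma ae_distribution {R : realType} d (T : measurableType d)
    (P : probability T R) (X : {RV P >-> R}) (S : set R) : measurable S ->
  {ae P, forall t, S (X t)} -> {ae distribution P X, forall x, S x}.
Proof.
move=> mS PS; exists (~` S); split => //; first exact: measurableC.
rewrite /distribution /pushforward; apply: measure_negligible => //.
by apply: measurable_funPTI; exact: measurableC.
Qed.

Lemma cintegral_restrict {R : realType} d (T : measurableType d)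
    (mu : {measure set T -> \bar R}) (S : set T) (f : T -> R[i]) :
  cintegral mu S f = cintegral mu setT (fun x => (\1_S x)%:C * f x).
Proof.
rewrite /cintegral Rintegral_mkcond [X in _ +i* X]Rintegral_mkcond.
by congr (_ +i* _); apply: eq_Rintegral => x _; rewrite patchE indicE;
  case: (x \in S); rewrite ?cReM ?cImM /= ?mul1r ?mul0r ?subr0 ?addr0.
Qed.

(** * The integrals in the linear system *)

Section SystemValue.
Context {R : realType} {l : nat} (r : 'I_l -> R[i]).
Variable PV : probability R R.
Local Notation Re := complex.Re.
Local Notation Im := complex.Im.
Local Notation D := (root_poly r).
Hypothesis V_lt0 : {ae PV, forall v, v < 0}.
Hypothesis r_lt0 : forall j, Re (r j) < 0.

Lemma cbounded_prod I (s : seq I) (F : I -> R -> R[i]) : (forall i, cbounded (F i)) ->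
  cbounded (fun x => \prod_(i <- s) F i x).
Proof.
move=> bF; elim: s => [|i s ih].
  by under eq_fun do rewrite big_nil; exact: cbounded_cst.
by under eq_fun do rewrite big_cons; exact: cboundedM.
Qed.

Lemma inv_bound (z : R[i]) (a : R) : 0 < a -> a <= Re z ->
  `|Re z^-1| <= a^-1 /\ `|Im z^-1| <= a^-1.
Proof.
move=> a0; rewrite cReV cImV; case: z => x y /= ax.
have x0 : 0 < x by exact: lt_le_trans ax.
have n0 : 0 < x ^+ 2 + y ^+ 2 by rewrite ltr_wpDr ?sqr_ge0// exprn_gt0.
have key t : `|t| * a <= x ^+ 2 + y ^+ 2 -> `|t / (x ^+ 2 + y ^+ 2)| <= a^-1.
  move=> h; rewrite normrM normfV (gtr0_norm n0) ler_pdivrMr// mulrC.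
  by rewrite ler_pdivlMr.
rewrite normrN; split; apply: key.
  by rewrite gtr0_norm//; nra.
have y2 : `|y| ^+ 2 = y ^+ 2 by rewrite real_normK// num_real.
rewrite -y2; have t0 := normr_ge0 y; have := sqr_ge0 (`|y| - a).
have ax2 : a * a <= x * x by rewrite ler_pM// ltW.
have : 0 <= `|y| * a by rewrite mulr_ge0// ltW.
move: (`|y|) t0 => t t0; rewrite !expr2; nra.
Qed.

Definition ratio (j : 'I_l) (k : nat) (v : R) : R[i] :=
  (Num.min v 0)%:C ^+ k / \prod_(m < l) (r j * (Num.min v 0)%:C - r m).

Lemma min0_le0 (v : R) : Num.min v 0 <= 0. Proof. by rewrite ge_min lexx orbT. Qed.

Lemma Re_factor (j m : 'I_l) (u : R) : u <= 0 ->
  Num.min (- Re (r j)) (- Re (r m)) * (1 - u) <= Re (r j * u%:C - r m).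
Proof.
move=> u0; rewrite !cReImE /= mulr0 subr0.
set b := Num.min _ _.
have h1 : b <= - Re (r j) by rewrite ge_min lexx.
have h2 : b <= - Re (r m) by rewrite ge_min lexx orbT.
nra.
Qed.

(** With u = min(v, 0) and w = 1 - u >= 1, the ratio is u^k / w^l times [l] factors w / (r_j u -
    r_m). The first is at most 1 in modulus because |u| <= w and k <= l; by [Re_factor] each
    denominator has real part at least b w with b > 0. *)
Lemma cbm_ratio j k : (k <= l)%N -> cbm (ratio j k).
Proof.
move=> kl; have mm : measurable_fun setT (fun v : R => Num.min v 0).
  by apply: measurable_minr; [exact: measurable_id|exact: measurable_cst].
split.
  apply: cmeasurableM.
    rewrite (_ : (fun v => _) = fun v : R => (Num.min v 0 ^+ k)%:C); last first.
      by apply/funext => v; rewrite rmorphXn.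
    by apply: cmeasurable_real; exact: measurable_funX.
  apply: cmeasurableV; apply: cmeasurable_prod => m.
  apply: cmeasurableD; last exact: cmeasurable_cst.
  by apply: cmeasurableM; [exact: cmeasurable_cst|exact: cmeasurable_real].
pose w (v : R) : R := 1 - Num.min v 0.
have w1 v : 1 <= w v by rewrite lerBrDr gerDl min0_le0.
have w0 v : 0 < w v by exact: lt_le_trans (w1 v).
have wn0 v : (w v)%:C != 0.
  by apply/eqP => -[] /eqP; rewrite gt_eqF.
rewrite (_ : ratio j k = fun v => (Num.min v 0 ^+ k / w v ^+ l)%:C *
    \prod_(m < l) ((w v)%:C / (r j * (Num.min v 0)%:C - r m))); last first.
  apply/funext => v; rewrite /ratio big_split /= prodr_const card_ord prodfV.
  rewrite rmorphM fmorphV !rmorphXn /= mulrA; congr (_ / _).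
  by rewrite mulrVK// unitfE expf_neq0.
apply: cboundedM.
  exists 1 => v /=; rewrite normr0; split => //.
  rewrite normrM normfV !normrX (gtr0_norm (w0 v)).
  rewrite ler_pdivrMr ?exprn_gt0// mul1r (le_trans _ (ler_weXn2l (w1 v) kl))//.
  apply: lerXn2r; rewrite ?nnegrE// ?(ltW (w0 v))//.
  rewrite (ler0_norm (min0_le0 v)) /w; lra.
apply: cbounded_prod => m.
pose b := Num.min (- Re (r j)) (- Re (r m)).
have b0 : 0 < b by rewrite lt_min !oppr_gt0 !r_lt0.
exists b^-1 => v.
have h := Re_factor j m (min0_le0 v); rewrite -/b -/(w v) in h.
have [h1 h2] := inv_bound (mulr_gt0 b0 (w0 v)) h.
rewrite cReM cImM /= !mul0r subr0 addr0 !normrM (gtr0_norm (w0 v)).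
rewrite mulrC -ler_pdivlMr// -invfM; split => //.
by rewrite mulrC -ler_pdivlMr// -invfM.
Qed.

Lemma ratio_integral j k : (k <= l)%N ->
  cintegral PV `]-oo, 0[ (fun y : R => y%:C ^+ k / \prod_(m < l) (r j * y%:C - r m))
  = cintegral PV setT (ratio j k).
Proof.
move=> kl; rewrite cintegral_restrict.
have [mr _] := cbm_ratio j kl.
have -> : (fun y : R => (\1_(`]-oo, 0[) y)%:C *
      (y%:C ^+ k / \prod_(m < l) (r j * y%:C - r m)))
    = fun y => (\1_(`]-oo, 0[) y)%:C * ratio j k y.
  apply/funext => y; rewrite indicE.
  have [yI|yI] := boolP (y \in (`]-oo, 0[%classic : set R)); last by rewrite !mul0r.
  have y0 : y < 0 by move: yI; rewrite inE /= in_itv.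
  by rewrite /ratio (min_l (ltW y0)).
apply: ae_eq_cintegral => //.
  by apply: cmeasurableM => //; apply: cmeasurable_real; exact: measurable_indic.
by apply: filterS V_lt0 => v v0; rewrite indicE mem_set ?mul1r//=.
Qed.

(** If p / D is the transform of a measure, the left side is the mean of that transform at s_j V.
    Expanding [p] produces exactly the integrals of the linear system, each convergent because k <=
    l. *)
Lemma system_value (p : {poly R[i]}) j : (size p <= l.+1)%N ->
  cintegral PV setT (fun v => p.[r j * (Num.min v 0)%:C] / D.[r j * (Num.min v 0)%:C])
  = \sum_(k < l.+1) p`_k * r j ^+ k * cintegral PV `]-oo, 0[
      (fun y : R => y%:C ^+ k / \prod_(m < l) (r j * y%:C - r m)).
Proof.
move=> sp.
have ik (k : 'I_l.+1) : cintegrable PV (ratio j k).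
  by apply: cbm_integrable; apply: cbm_ratio; rewrite -ltnS.
under [RHS]eq_bigr => k _ do
  rewrite (ratio_integral j (ltn_ord k : (k <= l)%N)) -(cintegralZ _ (ik k)).
rewrite -cintegral_sum; last by move=> k; exact: cintegrableZ.
apply: eq_cintegral => v _; rewrite (horner_coef_wide _ sp) mulr_suml.
apply: eq_bigr => k _; rewrite root_polyE /ratio exprMn.
by rewrite !mulrA.
Qed.

End SystemValue.

(** * Uniqueness for the linear system *)

Section ReflectedStepContinuity.
Context {R : realType}.
Variable rho : probability (R * (R * R))%type R.
Local Notation K := (transition rho reflected_step).

Lemma reflected_step_max (x : R) (u : (R * (R * R))%type) :
  reflected_step (Num.max x 0, u) = reflected_step (x, u).
Proof. by rewrite /reflected_step /= (max_l (max0_ge0 x)). Qed.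

Lemma transition_max (f : R -> R) x : K f (Num.max x 0) = K f x.
Proof. by apply: eq_Rintegral => u _; rewrite reflected_step_max. Qed.

(** The Feller property: the step is continuous in the state for each noise, and dominated
    convergence along sequences concludes. *)
Lemma continuous_transition (f : R -> R) (M : R) : continuous f ->
  (forall x, `|f x| <= M) -> continuous (K f).
Proof.
move=> cf fM x; apply/(@cvg_nbhsP _ R^o) => w wx.
apply: (@Rintegral_dominated _ _ _ _ _ _ (fun=> M)).
- move=> n; apply: measurableT_comp; first exact: continuous_measurable_fun.
  by apply: (measurableT_comp measurable_reflected_step); exact: measurable_pair1.
- move=> u.
  have cg : continuous (fun y => reflected_step (y, u)).
    pose h y : R := u.1 * Num.max y 0 + u.2.2 - u.2.1.
    have ch : continuous h.
      move=> y; apply: cvgB; last exact: cvg_cst.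
      apply: cvgD; last exact: cvg_cst.
      apply: cvgM; first exact: cvg_cst.
      exact: continuous_max0.
    by move=> y; exact: (continuous_comp (ch y) (@continuous_max0 R (h y))).
  have h : reflected_step (w n, u) @[n --> \oo] --> reflected_step (x, u).
    exact: (cvg_comp w (fun y => reflected_step (y, u)) wx (cg x)).
  exact: (cvg_comp _ f h (cf _)).
- by apply: (@bounded_integrable _ _ _ _ _ `|M|) => //; exact: measurable_cst.
- by move=> n u; exact: fM.
Qed.

End ReflectedStepContinuity.

Lemma ccvgD {R : realType} (u v : nat -> R[i]) (a b : R[i]) :
  ccvg u a -> ccvg v b -> ccvg (fun n => u n + v n) (a + b).
Proof.
move=> [u1 u2] [v1 v2]; split.
- by under eq_fun do rewrite cReD; rewrite cReD; exact: cvgD.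
- by under eq_fun do rewrite cImD; rewrite cImD; exact: cvgD.
Qed.

Section InvariantFunctional.
Context {R : realType} {d1 d2 : measure_display}
  {T1 : measurableType d1} {T2 : measurableType d2}.
Variables (mu1 : {measure set T1 -> \bar R}) (X1 : T1 -> R) (k1 : T1 -> R[i]).
Variables (mu2 : {measure set T2 -> \bar R}) (X2 : T2 -> R) (k2 : T2 -> R[i]).
Hypotheses (mX1 : measurable_fun setT X1) (ik1 : cintegrable mu1 k1).
Hypotheses (mX2 : measurable_fun setT X2) (ik2 : cintegrable mu2 k2).
Variables (rho : probability (R * (R * R))%type R) (Q : probability R R).
Local Notation K := (transition rho reflected_step).
Implicit Types (f g h : R -> R) (M : R).

(** A sum of two complex measures, because a polynomial of degree [l] over [D] is the transform of
    an atom plus a density, and the two live on different spaces. *)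
Definition real_pairing f : R[i] :=
  pairing mu1 X1 k1 (fun x => (f x)%:C) + pairing mu2 X2 k2 (fun x => (f x)%:C).

Local Notation L := real_pairing.

Let bounded_measurable f := measurable_fun setT f /\ exists M, forall x, `|f x| <= M.

Let bm_cbm f : bounded_measurable f -> cbm (fun x => (f x)%:C).
Proof. by move=> [mf [M fM]]; exact: cbm_real fM. Qed.

Let real_pairing_lin (a : R) f g : bounded_measurable f -> bounded_measurable g ->
  L (fun x => a * f x + g x) = a%:C * L f + L g.
Proof.
move=> /bm_cbm bf /bm_cbm bg; rewrite /real_pairing.
have e x : (a * f x + g x)%:C = a%:C * (f x)%:C + (g x)%:C.
  by rewrite rmorphD rmorphM.
have ba : cbm (fun x => a%:C * (f x)%:C) by apply: cbmM => //; exact: cbm_cst.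
have -> : (fun x => (a * f x + g x)%:C) = (fun x => a%:C * (f x)%:C + (g x)%:C).
  exact/funext.
by rewrite !pairingD// !pairingZ//; ring.
Qed.

Let real_pairing_dominated (h_ : nat -> R -> R) h M :
  (forall n, measurable_fun setT (h_ n)) ->
  (forall x, h_ n x @[n --> \oo] --> h x) -> (forall n x, `|h_ n x| <= M) ->
  ccvg (fun n => L (h_ n)) (L h).
Proof.
move=> mh hh hM; apply: ccvgD.
- apply: (@cintegral_dominated _ _ _ mu1 (fun n t => h_ n (X1 t))
    (fun t => h (X1 t)) k1 M) => //.
  by move=> n; exact: (measurableT_comp (mh n)).
- apply: (@cintegral_dominated _ _ _ mu2 (fun n t => h_ n (X2 t))
    (fun t => h (X2 t)) k2 M) => //.
  by move=> n; exact: (measurableT_comp (mh n)).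
Qed.

Let bm_lin (a : R) f g : bounded_measurable f -> bounded_measurable g ->
  bounded_measurable (fun x => a * f x + g x).
Proof.
move=> [mf [M fM]] [mg [N gN]]; split.
  by apply: measurable_funD => //; apply: measurable_funM.
exists (`|a| * M + N) => x; rewrite (le_trans (ler_normD _ _))// normrM.
by rewrite lerD// ler_wpM2l.
Qed.

Let bm_transition f : bounded_measurable f -> bounded_measurable (K f).
Proof.
move=> [mf [M fM]]; split.
  exact: (measurable_transition rho measurable_reflected_step mf fM).
by exists M; exact: (transition_bound rho measurable_reflected_step mf fM).
Qed.

Let transition_integrable f x : bounded_measurable f ->
  rho.-integrable setT (EFin \o (fun u => f (reflected_step (x, u)))).
Proof.
move=> [mf [M fM]]; apply: (@bounded_integrable _ _ _ _ _ M) => //.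
apply: measurableT_comp => //.
by apply: (measurableT_comp measurable_reflected_step); exact: measurable_pair1.
Qed.

Let transition_lin (a : R) f g x : bounded_measurable f -> bounded_measurable g ->
  K (fun x => a * f x + g x) x = a * K f x + K g x.
Proof.
move=> bf bg; rewrite /transition RintegralD//; last 2 first.
- by apply: integrable_EFinZ; exact: transition_integrable.
- exact: transition_integrable.
by rewrite RintegralZl//; exact: transition_integrable.
Qed.

Let e_ (n : nat) (x : R) : R := expR (- (n%:R * Num.max x 0)).

Let bm_e n : bounded_measurable (e_ n).
Proof.
split; first by have [[h _] _] := cbm_exp_nat (R := R) n.
exists 1 => x; rewrite ger0_norm ?expR_ge0// expR_le1 oppr_le0 mulr_ge0//.
exact: max0_ge0.
Qed.

Hypothesis L_exp : forall n, L (K (e_ n)) = L (e_ n).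
Hypothesis L_one : L (fun=> 1) = 0.
Hypothesis K_cvg : forall f M x, measurable_fun setT f -> (forall x, `|f x| <= M) ->
  iter n K f x @[n --> \oo] --> \int[Q]_y f y.

(** Linearity extends invariance from the exponentials to polynomials in exp(- x), the approximants
    of [exp_poly_approx]. *)
Let L_sum (a : nat -> R) n :
  let f x := \sum_(i < n) a i * e_ i x in
  bounded_measurable f /\ L (K f) = L f.
Proof.
elim: n => [|n [bf ih]] /=.
  have e0 : (fun x : R => \sum_(i < 0) a i * e_ i x) = fun=> 0.
    by apply/funext => x; rewrite big_ord0.
  rewrite e0; split.
    by split; [exact: measurable_cst|exists 0 => x; rewrite normr0].
  by congr L; apply/funext => x; rewrite /transition Rintegral_cst1.
have eS : (fun x : R => \sum_(i < n.+1) a i * e_ i x)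
    = fun x => a n * e_ n x + \sum_(i < n) a i * e_ i x.
  by apply/funext => x; rewrite big_ord_recr /= addrC.
rewrite eS; split; first exact: bm_lin.
rewrite (_ : K _ = fun x =>
    a n * K (e_ n) x + K (fun x => \sum_(i < n) a i * e_ i x) x).
  rewrite !real_pairing_lin//; first by rewrite L_exp ih.
    exact: bm_transition.
  exact: bm_transition.
by apply/funext => x; exact: transition_lin.
Qed.

(* By the Weierstrass theorem in the variable [expR (- x)]. *)
Let L_continuous f M : continuous f -> (forall x, `|f x| <= M) ->
  (forall x, f (Num.max x 0) = f x) -> L (K f) = L f.
Proof.
move=> cf fM f0; have [p [pM pf]] := exp_poly_approx cf fM.
pose g n x := (p n).[expR (- Num.max x 0)].
have gE n : g n = fun x => \sum_(i < size (p n)) (p n)`_i * e_ i x.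
  apply/funext => x; rewrite /g horner_coef.
  by apply: eq_bigr => i _; rewrite exp_natE.
have mg n : measurable_fun setT (g n) by exact: measurable_exp_poly.
have pf' x : g n x @[n --> \oo] --> f x by rewrite -f0; exact: pf.
have c1 := real_pairing_dominated mg pf' pM.
have c2 : ccvg (fun n => L (K (g n))) (L (K f)).
  apply: (real_pairing_dominated (M := M)).
  - move=> n.
    exact: (measurable_transition rho measurable_reflected_step (mg n) (pM n)).
  - move=> x; apply: (@Rintegral_dominated _ _ _ _ _ _ (fun=> M)).
    + move=> n; apply: measurableT_comp; first exact: mg.
      by apply: (measurableT_comp measurable_reflected_step); exact: measurable_pair1.
    + by move=> u; exact: pf'.
    + by apply: (@bounded_integrable _ _ _ _ _ `|M|) => //; exact: measurable_cst.
    + by move=> n u; exact: pM.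
  - by move=> n; exact: (transition_bound rho measurable_reflected_step (mg n) (pM n)).
apply: (ccvg_unique c2); move: c1; congr ccvg; apply/funext => n.
by have [_] := L_sum (fun i => (p n)`_i) (size (p n)); rewrite /= -gE.
Qed.

(** Continuity, the bound and dependence on the positive part are all inherited by the iterates of
    [f], so [L_continuous] applies at every stage. *)
Lemma invariant_functional_eq0 f M : continuous f -> (forall x, `|f x| <= M) ->
  (forall x, f (Num.max x 0) = f x) -> L f = 0.
Proof.
move=> cf fM f0.
have iterP n : [/\ continuous (iter n K f), forall x, `|iter n K f x| <= M,
    forall x, iter n K f (Num.max x 0) = iter n K f x & L (iter n K f) = L f].
  elim: n => [//|n [c b m0 e]]; split => //=.
  - by move=> x; exact: (@continuous_transition R rho _ M c b x).
  - apply: (transition_bound rho measurable_reflected_step _ b).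
    exact: continuous_measurable_fun.
  - by move=> x; exact: transition_max.
  - by rewrite (L_continuous c b m0).
have c : ccvg (fun n => L (iter n K f)) (L (fun=> \int[Q]_y f y)).
  apply: (real_pairing_dominated (M := M)).
  - by move=> n; have [c _ _ _] := iterP n; exact: continuous_measurable_fun.
  - by move=> x; apply: (K_cvg _ _ fM); exact: continuous_measurable_fun.
  - by move=> n; have [_ b _ _] := iterP n.
have L0 : L (fun=> \int[Q]_y f y) = 0.
  have bm1 (a : R) : bounded_measurable (fun=> a).
    by split; [exact: measurable_cst|exists `|a|].
  (* A constant is a multiple of 1, on which the functional vanishes. *)
  have := real_pairing_lin (\int[Q]_y f y) (bm1 1) (bm1 0).
  rewrite L_one mulr0 add0r.
  have -> : L (fun=> 0) = 0.
    by rewrite /real_pairing /pairing; under eq_cintegral do rewrite mul0r;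
      rewrite cintegral0 add0r; under eq_cintegral do rewrite mul0r;
      rewrite cintegral0.
  by move=> <-; congr L; apply/funext => x; rewrite mulr1 addr0.
rewrite -L0; apply: (ccvg_unique (ccvg_cst (L f))).
by move: c; congr ccvg; apply/funext => n; have [] := iterP n.
Qed.

Lemma invariant_functional_exp n : L (e_ n) = 0.
Proof.
have [_ [M eM]] := bm_e n.
apply: (invariant_functional_eq0 (M := M)) => //.
- move=> x; have dn y := @is_derive1_comp _ _ _ _ _ _ (is_derive_expR _)
    (is_derive_scale (- n%:R : R) y).
  have ce := is_derive_cont dn.
  have e' y : e_ n y = expR (- n%:R * Num.max y 0) by rewrite /e_ mulNr.
  rewrite (_ : e_ n = (fun y => expR (- n%:R * y)) \o (fun y => Num.max y 0)).
    exact: (continuous_comp (@continuous_max0 R x) (ce _)).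
  by apply/funext => y; rewrite e'.
- by move=> x; rewrite /e_ (max_l (max0_ge0 x)).
Qed.

End InvariantFunctional.

(** * The linear system for the stationary law *)

Section StationaryTransform.
Context {R : realType} {l : nat} (r : 'I_l -> R[i]) (N : {poly R[i]}).
Variables PV PA PB Q : probability R R.
Local Notation Re := complex.Re.
Local Notation Im := complex.Im.
Local Notation D := (root_poly r).
Local Notation rho := (prod_prob PV (prod_prob PA PB)).
Local Notation K := (transition rho reflected_step).
Hypothesis V_lt0 : {ae PV, forall v, v < 0}.
Hypothesis A_ge0 : {ae PA, forall a, 0 <= a}.
Hypothesis r_lt0 : forall j, Re (r j) < 0.
Hypothesis N_size : (size N <= l)%N.
Hypothesis B_lst : forall s : R[i], 0 <= Re s ->
  cintegral PB setT (expneg s) = N.[s] / D.[s].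

(** The linear system with its terms regrouped around p(s_j); in this form it can be compared with
    [step_poly_root]. *)
Definition solves_system (p : {poly R[i]}) := forall j, p.[r j] =
  N.[r j] * (a_lst r PA j * \sum_(k < l.+1) p`_k * r j ^+ k *
    cintegral PV `]-oo, 0[
      (fun y : R => y%:C ^+ k / \prod_(m < l) (r j * y%:C - r m))).

Lemma Re_root_min0 j (v : R) : 0 <= Re (r j * (Num.min v 0)%:C).
Proof.
have := min0_le0 v; have := r_lt0 j; rewrite cReM.
by case: (r j) => x y /= x0 v0; rewrite mulr0 subr0 mulr_le0// ltW.
Qed.

Lemma expneg0 : expneg (0 : R[i]) = fun=> 1.
Proof. by apply/funext => x; rewrite /expneg oppr0 mul0r cexp0. Qed.

Lemma stationary_transform :
  (forall (f : R -> R) (M : R), measurable_fun setT f -> (forall x, `|f x| <= M) ->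
     \int[Q]_x K f x = \int[Q]_x f x) ->
  exists p : {poly R[i]}, [/\ (size p <= l.+1)%N, p.[0] = D.[0],
    forall s, 0 <= Re s -> cintegral Q setT (expneg s) = p.[s] / D.[s]
    & solves_system p].
Proof.
move=> Q_inv.
have [c [q [cbm_c hq]]] := rational_density r_lt0.
have [qs qr [kappa [ki kl ks]]] := hq _ N_size.
have mid : measurable_fun [set: R] (id : R -> R) by exact: measurable_id.
have i1 : cintegrable Q (fun=> 1 : R[i]) by exact: (cbm_integrable _ (cbm_cst _)).
pose p := step_poly r PV PA c (q N) Q id (fun=> 1).
have pairE F : pairing Q id (fun=> 1) F = cintegral Q setT F.
  by rewrite /pairing; under eq_cintegral do rewrite mulr1.
have inv F : cbm F -> cintegral Q setT (cstep PV PA PB F) = cintegral Q setT F.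
  move=> [[F1 F2] [M FM]]; rewrite /cintegral; congr (_ +i* _).
    by apply: (Q_inv (fun x => Re (F x)) M) => // x; have [] := FM x.
  by apply: (Q_inv (fun x => Im (F x)) M) => // x; have [] := FM x.
have ptr s : 0 <= Re s -> cintegral Q setT (expneg s) = p.[s] / D.[s].
  move=> s0; rewrite -inv; last exact: cbm_expneg.
  rewrite -pairE.
  exact: (step_poly_transform V_lt0 A_ge0 r_lt0 B_lst cbm_c ki kl ks mid i1 s0).
have sp : (size p <= l.+1)%N by exact: size_step_poly.
exists p; split => //.
- by rewrite /p step_poly0// pairE cintegral_cst mul1r.
- move=> j; rewrite -(system_value V_lt0 r_lt0 j sp).
  rewrite [LHS](step_poly_root V_lt0 A_ge0 r_lt0 cbm_c qr mid i1 j).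
  congr (_ * (_ * _)); apply: eq_cintegral => v _.
  by rewrite pairE ptr//; exact: Re_root_min0.
Qed.

End StationaryTransform.

(** * Uniqueness when the roots are distinct *)

Lemma poly_eq0_natr {R : realType} (p : {poly R[i]}) :
  (forall n : nat, p.[n%:R] = 0) -> p = 0.
Proof.
move=> p0; apply/eqP; apply: contraT => pn0.
have := @max_poly_roots _ p [seq n%:R | n <- iota 0 (size p)] pn0.
rewrite size_map size_iota ltnn; apply.
  by apply/allP => _ /mapP[n _ ->]; rewrite rootE p0.
rewrite map_inj_uniq ?iota_uniq// => m n /eqP.
by rewrite eqr_nat => /eqP.
Qed.

Section SystemUniqueness.
Context {R : realType} {l : nat} (r : 'I_l -> R[i]) (N : {poly R[i]}).
Variables PV PA PB Q : probability R R.
Local Notation Re := complex.Re.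
Local Notation Im := complex.Im.
Local Notation D := (root_poly r).
Local Notation rho := (prod_prob PV (prod_prob PA PB)).
Local Notation K := (transition rho reflected_step).
Hypothesis V_lt0 : {ae PV, forall v, v < 0}.
Hypothesis A_ge0 : {ae PA, forall a, 0 <= a}.
Hypothesis r_lt0 : forall j, Re (r j) < 0.
Hypothesis r_inj : injective r.
Hypothesis N_size : (size N <= l)%N.
Hypothesis B_lst : forall s : R[i], 0 <= Re s ->
  cintegral PB setT (expneg s) = N.[s] / D.[s].
Hypothesis K_cvg : forall (f : R -> R) (M : R) x, measurable_fun setT f ->
  (forall x, `|f x| <= M) ->
  iter n K f x @[n --> \oo] --> \int[Q]_y f y.

(** Here the distinctness of the roots enters: together with 0, which is not a root since Re r_j <
    0, they form l + 1 interpolation nodes. *)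
Lemma poly_eq_nodes (p q : {poly R[i]}) : (size p <= l.+1)%N -> (size q <= l.+1)%N ->
  p.[0] = q.[0] -> (forall j, p.[r j] = q.[r j]) -> p = q.
Proof.
move=> sp sq e0 er; apply/eqP; rewrite -subr_eq0; apply: contraT => n0.
have := @max_poly_roots _ _ (0 :: codom r) n0.
rewrite /= size_codom card_ord => h.
have : (size (p - q)%R <= l.+1)%N.
  by rewrite (leq_trans (size_polyD _ _))// size_polyN geq_max sp.
rewrite leqNgt h//.
- rewrite rootE !hornerE e0 subrr eqxx /=.
  by apply/allP => _ /codomP[j ->]; rewrite rootE !hornerE er subrr.
- rewrite -/(codom r) (map_inj_uniq r_inj) enum_uniq andbT.
  by apply/codomP => -[j j0]; have := r_lt0 j; rewrite -j0 ltxx.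
Qed.

Lemma coef_sum_subZ (p : {poly R[i]}) (a : R[i]) j (I : nat -> R[i]) :
  \sum_(k < l.+1) (p - a *: D)`_k * r j ^+ k * I k
  = \sum_(k < l.+1) p`_k * r j ^+ k * I k - a * \sum_(k < l.+1) D`_k * r j ^+ k * I k.
Proof.
rewrite mulr_sumr -sumrB; apply: eq_bigr => k _.
by rewrite coefB coefZ; ring.
Qed.

(* Writing [p = a D + M] with [M] of size at most [l], the quotient [p / D] is
   the transform of an atom of mass [a] at 0 plus a density; the system says
   that this complex measure is invariant. *)
Lemma system_unique (p : {poly R[i]}) : (size p <= l.+1)%N -> p.[0] = 0 ->
  solves_system r N PV PA p -> p = 0.
Proof.
move=> sp p0 psys.
have [c [q [cbm_c hq]]] := rational_density r_lt0.
have [qs qr [kappa [ki kl ks]]] := hq _ N_size.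
(* [D] is monic of degree [l], so subtracting a D cancels the coefficient of degree [l]. *)
pose a := p`_l; pose M := p - a *: D.
have sM : (size M <= l)%N.
  apply/leq_sizeP => k; rewrite leq_eqVlt => /orP[/eqP <-|lk].
    have Dl : D`_l = 1.
      by have /monicP := root_poly_monic r; rewrite /lead_coef size_root_poly.
    by rewrite coefB coefZ Dl mulr1 subrr.
  rewrite coefB coefZ nth_default ?(leq_trans sp)// sub0r.
  by rewrite nth_default ?mulr0 ?oppr0// size_root_poly.
have [_ _ [kM [kMi kMl _]]] := hq _ sM.
have mid : measurable_fun [set: measurableTypeR R] (id : R -> R).
  by move=> _ S mS; rewrite setTI.
have m0 : measurable_fun [set: R] (fun=> 0 : R) by exact: measurable_cst.
have ia : cintegrable PB (fun=> a) by exact: (cbm_integrable _ (cbm_cst _)).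
(* The atom of mass [a] at 0, as the image of [PB] under the zero map with constant density [a]. *)
pose m1 := pairing PB (fun=> 0 : R) (fun=> a).
pose m2 := pairing (@lebesgue_measure R) id kM.
have m1E s : m1 (expneg s) = a.
  rewrite /m1 /pairing /expneg max_l// mulr0 cexp0.
  by under eq_cintegral do rewrite mul1r; exact: cintegral_cst.
have m2E s : 0 <= Re s -> m2 (expneg s) = M.[s] / D.[s] by move=> s0; exact: kMl.
have ME s : M.[s] = p.[s] - a * D.[s] by rewrite /M !hornerE.
have mE s : 0 <= Re s -> m1 (expneg s) + m2 (expneg s) = p.[s] / D.[s].
  move=> s0; rewrite m1E m2E// ME mulrBl mulfK ?root_poly_Re_ge0//.
  by rewrite addrCA subrr addr0.
have m_one : m1 (fun=> 1) + m2 (fun=> 1) = 0.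
  by rewrite -expneg0 mE// p0 mul0r.
pose p1 := step_poly r PV PA c (q N) PB (fun=> 0) (fun=> a).
pose p2 := step_poly r PV PA c (q N) (@lebesgue_measure R) id kM.
have root1 j : p1.[r j] = N.[r j] * (a_lst r PA j * a).
  rewrite [LHS](step_poly_root V_lt0 A_ge0 r_lt0 cbm_c qr m0 ia j).
  congr (_ * (_ * _)); transitivity (cintegral PV setT (fun=> a)).
    by apply: eq_cintegral => v _; exact: m1E.
  exact: cintegral_cst.
have root2 j : p2.[r j] = N.[r j] * (a_lst r PA j * (\sum_(k < l.+1) M`_k * r j ^+ k *
    cintegral PV `]-oo, 0[
      (fun y : R => y%:C ^+ k / \prod_(m < l) (r j * y%:C - r m)))).
  rewrite -(system_value V_lt0 r_lt0 j (leqW sM)).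
  rewrite [LHS](step_poly_root V_lt0 A_ge0 r_lt0 cbm_c qr mid kMi j).
  congr (_ * (_ * _)); apply: eq_cintegral => v _.
  by apply: m2E; exact: Re_root_min0.
(* [D / D] is constantly 1, the transform of a unit atom, so the part a D of [p] contributes exactly
   [a] to the system, as in [root1]. *)
have Dsum j : \sum_(k < l.+1) D`_k * r j ^+ k * cintegral PV `]-oo, 0[
    (fun y : R => y%:C ^+ k / \prod_(m < l) (r j * y%:C - r m)) = 1.
  rewrite -(system_value V_lt0 r_lt0 j) ?size_root_poly//.
  transitivity (cintegral PV setT (fun=> 1 : R[i])); last exact: cintegral_cst.
  apply: eq_cintegral => v _; rewrite divff// root_poly_Re_ge0//.
  exact: Re_root_min0.
(* At 0 both sides vanish because the total mass is 0; at the roots the equality is the system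
   satisfied by [p]. *)
have p12 : p1 + p2 = p.
  apply: poly_eq_nodes => //.
  - by rewrite (leq_trans (size_polyD _ _))// geq_max; apply/andP; split;
      exact: size_step_poly.
  - rewrite hornerD /p1 /p2 !step_poly0// -mulrDl -/(m1 _) -/(m2 _).
    by rewrite m_one mul0r p0.
  - move=> j; rewrite hornerD root1 root2 psys -mulrDr -mulrDr.
    rewrite (coef_sum_subZ p a j (fun k => cintegral PV `]-oo, 0[
      (fun y : R => y%:C ^+ k / \prod_(m < l) (r j * y%:C - r m)))).
    by rewrite Dsum mulr1 addrCA subrr addr0.
pose L := real_pairing PB (fun=> 0 : R) (fun=> a) (@lebesgue_measure R) id kM.
have LE n : L (fun x => expR (- (n%:R * Num.max x 0))) = p.[n%:R] / D.[n%:R].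
  rewrite -mE; last exact: Re_natr_ge0.
  by rewrite /L /real_pairing; congr (_ + _); congr pairing; apply/funext => x;
    rewrite expneg_nat.
have LK n : L (K (fun x => expR (- (n%:R * Num.max x 0))))
    = L (fun x => expR (- (n%:R * Num.max x 0))).
  have s0 : 0 <= Re (n%:R : R[i]) by exact: Re_natr_ge0.
  have KE : (fun x => (K (fun x => expR (- (n%:R * Num.max x 0))) x)%:C)
      = cstep PV PA PB (expneg n%:R).
    apply/funext => x; rewrite /cstep /transition /cintegral.
    under [in RHS]eq_Rintegral do rewrite expneg_nat /=.
    under [X in _ +i* X]eq_Rintegral do rewrite expneg_nat /=.
    by rewrite [X in _ +i* X]Rintegral_cst1.
  rewrite LE -p12 hornerD mulrDl /L /real_pairing KE.
  congr (_ + _).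
  - exact: (step_poly_transform V_lt0 A_ge0 r_lt0 B_lst cbm_c ki kl ks m0 ia s0).
  - exact: (step_poly_transform V_lt0 A_ge0 r_lt0 B_lst cbm_c ki kl ks mid kMi s0).
have Lexp := invariant_functional_exp m0 ia mid kMi LK m_one K_cvg.
apply: poly_eq0_natr => n; have := Lexp n; rewrite -/L LE => /eqP.
have Dn : D.[n%:R] != 0 by apply: root_poly_Re_ge0 => //; exact: Re_natr_ge0.
by rewrite mulf_eq0 invr_eq0 (negPf Dn) orbF => /eqP.
Qed.

End SystemUniqueness.

(** * From laws on the line to the random variables *)

Lemma expectation_bounded {R : realType} d (T : measurableType d)
    (P : probability T R) (f : T -> R) (M : R) : measurable_fun setT f ->
  (forall t, `|f t| <= M) -> ('E_P[f] = (\int[P]_t f t)%R%:E)%E.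
Proof.
move=> mf fM; rewrite unlock fineK//.
by apply: integrable_fin_num => //; exact: (bounded_integrable P mf fM).
Qed.

Lemma ae_eq_cintegral_distribution {R : realType} d (T : measurableType d)
    (P : probability T R) (X : {RV P >-> R}) (f g : R -> R[i]) :
  cbm f -> cmeasurable g -> {ae P, forall t, f (X t) = g (X t)} ->
  cintegral P setT (g \o X) = cintegral (distribution P X) setT f.
Proof.
move=> bf [g1 g2] fg; rewrite cintegral_distribution//.
have [[f1 f2] _] := bf.
apply: ae_eq_cintegral.
- by split; [apply: (measurableT_comp g1)|apply: (measurableT_comp g2)].
- by split; [apply: (measurableT_comp f1)|apply: (measurableT_comp f2)].
- by apply: filterS fg => t /= ->.
Qed.

Section LaplaceOfDistribution.
Context {R : realType} {d : measure_display} {T : measurableType d}.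
Variables (P : probability T R) (X : {RV P >-> R}).
Hypothesis X_ge0 : {ae P, forall t, 0 <= X t}.
Local Notation Re := complex.Re.

Lemma lst_distribution (s : R[i]) : 0 <= Re s ->
  lst P X s = cintegral (distribution P X) setT (expneg s).
Proof.
move=> s0; apply: (ae_eq_cintegral_distribution (g := fun x => cexp (- s * x%:C))).
- exact: cbm_expneg.
- apply: cmeasurable_cexp; apply: cmeasurableM; first exact: cmeasurable_cst.
  by apply: cmeasurable_real; exact: measurable_id.
- by apply: filterS X_ge0 => t t0; rewrite /expneg max_l.
Qed.

Lemma lst_distributionN l (r : 'I_l -> R[i]) j : Re (r j) < 0 ->
  lst P X (- r j) = a_lst r (distribution P X) j.
Proof.
move=> rj0; rewrite lst_distribution; last by rewrite cReN oppr_ge0 ltW.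
by apply: eq_cintegral => x _; rewrite /expneg opprK.
Qed.

End LaplaceOfDistribution.

Section CoefSystem.
Context {R : realType} {d : measure_display} {T : measurableType d}.
Variables (P : probability T R) (V A : {RV P >-> R}).
Variables (l : nat) (r : 'I_l -> R[i]) (N : {poly R[i]}).
Hypothesis A_ge0 : {ae P, forall t, 0 <= A t}.
Hypothesis r_lt0 : forall j, complex.Re (r j) < 0.

Lemma coef_systemE (p : {poly R[i]}) : (size p <= l.+1)%N ->
  coef_system V A r N (fun k => p`_k)
  <-> solves_system r N (distribution P V) (distribution P A) p.
Proof.
move=> sp; rewrite /coef_system /solves_system.
have E j (I : nat -> R[i]) : \sum_(k < l.+1) p`_k * r j ^+ k *
      (1 - N.[r j] * lst P A (- r j) * I k)
    = p.[r j] - N.[r j] * (a_lst r (distribution P A) j *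
      \sum_(k < l.+1) p`_k * r j ^+ k * I k).
  rewrite (horner_coef_wide _ sp) -lst_distributionN// mulrA mulr_sumr -sumrB.
  by apply: eq_bigr => k _; ring.
split=> h j.
- by apply/eqP; rewrite -subr_eq0 -(E j (fun k => cintegral _ _ (fun y : R =>
    y%:C ^+ k / \prod_(m < l) (r j * y%:C - r m)))); apply/eqP; exact: h.
- by rewrite (E j (fun k => cintegral _ _ (fun y : R =>
    y%:C ^+ k / \prod_(m < l) (r j * y%:C - r m)))) h subrr.
Qed.

End CoefSystem.

(** The event {B <= A} is covered by the noise event and the negligible set {V >= 0}, so the noise
    event cannot be negligible. *)
Lemma noise_law_gt0 {R : realType} d (T : measurableType d) (P : probability T R)
    (V A B : nat -> {RV P >-> R}) (w : R)
    (iidV : iid P (fun i => V i)) (iidA : iid P (fun i => A i))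
    (iidB : iid P (fun i => B i))
    (indVAB : independent_seqs P (fun i => V i) (fun i => A i) (fun i => B i)) :
  0 <= w -> {ae P, forall t, V 0%N t < 0} ->
  (0 < P [set t | (B 0%N t <= A 0%N t)%R])%E ->
  let S := [set u : (R * (R * R))%type | u.1 <= 0 /\ u.2.2 <= u.2.1] in
  measurable S /\ (0 < noise_law V A B S)%E.
Proof.
move=> w_ge0 V_lt0 BA_pos S.
have m2 : measurable_fun setT (fun z : (R * (R * R))%type => z.2).
  exact: measurable_snd.
have mS : measurable S.
  apply: measurableI.
    rewrite -[X in measurable X]setTI.
    by apply: measurable_fun_le => //; exact: measurable_fst.
  rewrite -[X in measurable X]setTI; apply: measurable_fun_le => //.
    by apply: (measurableT_comp _ m2); exact: measurable_snd.
  by apply: (measurableT_comp _ m2); exact: measurable_fst.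
split => //; rewrite (noise_lawE iidV iidA iidB indVAB w_ge0 mS).
set G := _ @^-1` S.
have mG : measurable G.
  by rewrite -[X in measurable X]setTI; exact: (measurable_noise V A B 0).
rewrite lt0e measure_ge0 andbT; apply: contraTN BA_pos => /eqP G0.
have mBA : measurable [set t | (B 0%N t <= A 0%N t)%R].
  by rewrite -[X in measurable X]setTI; exact: measurable_fun_le.
rewrite -leNgt measure_negligible//.
have nV : P.-negligible (~` [set t | V 0%N t < 0]) by [].
have nG : P.-negligible G by exact/negligibleP.
apply: (negligibleS _ (negligibleU nG nV)) => t /= BA.
by have [v0|v0] := leP (V 0%N t) 0; [left|right; apply/negP; rewrite -leNgt ltW].
Qed.

(** The last clause makes precise that the system determines the constants. Two of its equations
    coincide when a root is repeated, so uniqueness is stated for distinct roots. *)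
Theorem theorem6 (R : realType) (d : measure_display) (T : measurableType d)
    (P : probability T R) (V A B : nat -> {RV P >-> R}) (w : R)
    (l : nat) (r : 'I_l -> R[i]) (N : {poly R[i]})
    (iidV : iid P (fun i => V i)) (iidA : iid P (fun i => A i))
    (iidB : iid P (fun i => B i))
    (indVAB : independent_seqs P (fun i => V i) (fun i => A i) (fun i => B i))
    (A_ge0 : {ae P, forall t, 0 <= A 0%N t})
    (B_ge0 : {ae P, forall t, 0 <= B 0%N t})
    (V_int : ('E_P[fun t => `|V 0%N t|%R] < +oo)%E)
    (BA_int : ('E_P[fun t => `|B 0%N t - A 0%N t|%R] < +oo)%E)
    (w_ge0 : 0 <= w)
    (V_lt0 : {ae P, forall t, V 0%N t < 0})
    (r_lt0 : forall j, complex.Re (r j) < 0)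
    (N_size : (size N <= l)%N)
    (N_coprime : forall z : R[i], ~~ (root N z && root (root_poly r) z))
    (B_lst : forall s : R[i], 0 <= complex.Re s ->
       lst P (B 0%N) s = N.[s] / (root_poly r).[s])
    (BA_pos : (0 < P [set t | (B 0%N t <= A 0%N t)%R])%E) :
  exists (d' : measure_display) (T' : measurableType d')
    (Q : probability T' R) (W : {RV Q >-> R}),
    [/\ {ae Q, forall t, 0 <= W t},
        cvg_weakly P (reflected_ar w (fun i => V i) (fun i => A i)
                       (fun i => B i)) Q W
      & exists a : 'I_l.+1 -> R[i],
          [/\ a ord0 = (-1) ^+ l * \prod_(i < l) r i,
              forall s : R[i], 0 <= complex.Re s ->
                lst Q W s
                = (\sum_(k < l.+1) a k * s ^+ k) / (root_poly r).[s],
              coef_system (V 0%N) (A 0%N) r N a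
            & injective r ->
              forall c : 'I_l.+1 -> R[i],
                c ord0 = (-1) ^+ l * \prod_(i < l) r i ->
                coef_system (V 0%N) (A 0%N) r N c ->
                forall k, c k = a k]].

Proof.
pose S := [set u : (R * (R * R))%type | u.1 <= 0 /\ u.2.2 <= u.2.1].
have [mS S_gt0] := noise_law_gt0 iidV iidA iidB indVAB w_ge0 V_lt0 BA_pos.
have gS (x : R) (u : (R * (R * R))%type) : S u -> reflected_step (x, u) = 0.
  move=> [v0 ba]; rewrite /reflected_step /=; apply: max_r.
  rewrite -addrA; have := mulr_le0_ge0 v0 (max0_ge0 x); lra.
have [Q [Q_inv Q_cvg]] := exists_invariant measurable_reflected_step mS gS S_gt0.
have PV_lt0 : {ae distribution P (V 0%N), forall v, v < 0}.
  apply: (ae_distribution (S := [set v : R | v < 0])) V_lt0.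
  by rewrite -set_itvNyo; exact: measurable_itv.
have PA_ge0 : {ae distribution P (A 0%N), forall a, 0 <= a}.
  apply: (ae_distribution (S := [set v : R | 0 <= v])) A_ge0.
  by rewrite -set_itvcy; exact: measurable_itv.
have PB_lst s : 0 <= complex.Re s ->
    cintegral (distribution P (B 0%N)) setT (expneg s) = N.[s] / (root_poly r).[s].
  by move=> s0; rewrite -lst_distribution// B_lst.
have [p [sp p0 ptr psys]] :=
  stationary_transform PV_lt0 PA_ge0 r_lt0 N_size PB_lst Q_inv.
(* Taking the positive part of the coordinate makes [W] non-negative everywhere, without showing
   that [Q] sits on the half-line. *)
pose W : {RV Q >-> R} := HB.pack (fun x : R => Num.max x 0)
  (isMeasurableFun.Build _ _ _ _ (fun x : R => Num.max x 0) measurable_maxr0).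
exists _, _, Q, W; split.
- by apply: aeW => x; exact: max0_ge0.
- move=> f cf [M fM].
  have mf : measurable_fun setT f by exact: continuous_measurable_fun.
  (* The limit theorem is applied to [g], whose [Q]-integral is the mean of f(W); along the chain
     [g] and [f] agree because the states are non-negative. *)
  pose g x := f (Num.max x 0).
  have mg : measurable_fun setT g by exact: (measurableT_comp mf measurable_maxr0).
  have gM x : `|g x| <= M by exact: fM.
  rewrite (@expectation_bounded _ _ _ _ _ M)//.
  have WE n : ('E_P[f \o reflected_ar w (fun i => V i) (fun i => A i) (fun i => B i) n]
      = (iter n (transition (noise_law V A B) reflected_step) g w)%:E)%E.
    rewrite (@expectation_bounded _ _ _ _ _ M); last 2 first.
    - exact: (measurableT_comp mf (measurable_reflected_ar V A B w_ge0 n)).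
    - by move=> t; exact: fM.
    rewrite -(reflected_ar_expectation iidV iidA iidB indVAB w_ge0 n mg gM).
    congr (_%:E); apply: eq_Rintegral => t _; rewrite /g max_l//.
    exact: (reflected_ar_ge0 V A B w_ge0).
  under eq_fun do rewrite WE.
  apply/fine_cvgP; split; first exact: nearW.
  exact: (Q_cvg g M w mg gM).
- exists (fun k => p`_k); split.
  + by rewrite -horner_coef0 p0 root_poly0.
  + by move=> s s0; rewrite -(horner_coef_wide _ sp) -ptr.
  + exact/coef_systemE.
  + move=> r_inj c c0 csys k.
    pose p' : {poly R[i]} := \poly_(i < l.+1) c (inord i).
    have p'E (i : 'I_l.+1) : p'`_i = c i by rewrite coef_poly ltn_ord inord_val.
    have sp' : (size p' <= l.+1)%N by exact: size_poly.
    have p'sys : solves_system r N (distribution P (V 0%N)) (distribution P (A 0%N)) p'.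
      apply/coef_systemE => // j; rewrite -[RHS](csys j).
      by apply: eq_bigr => i _; rewrite p'E.
    (* The constant coefficients of both solutions are prescribed, so their difference solves the
       system and vanishes at 0. *)
    suff pp : p' - p = 0 by rewrite -p'E; move/eqP: pp; rewrite subr_eq0 => /eqP ->.
    apply: (system_unique PV_lt0 PA_ge0 r_lt0 r_inj N_size PB_lst Q_cvg).
    * by rewrite (leq_trans (size_polyD _ _))// size_polyN geq_max sp'.
    * rewrite !hornerE p0 root_poly0 -c0 -(p'E ord0) /= horner_coef0.
      by rewrite subrr.
    * move=> j; rewrite hornerD hornerN psys p'sys -mulrBr -mulrBr.
      congr (_ * (_ * _)); rewrite -sumrB; apply: eq_bigr => i _.
      by rewrite coefB; ring.
Qed.
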